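(* Let $\boxplus_k=(\tau_k,\mathscr{T}_k)$, $k\in\mathbb{N}$, be a sequence of discretizations consisting of time steps $\tau_k\to0$ and finite simplicial decompositions $\mathscr{T}_k$ of $K$ whose mesh sizes tend to zero. For each $k$ let $(G_k^n)_{n\ge0}\subset\mathcal{A}_{\mathscr{T}_k}$ be such that, for every $n\ge1$, $G_k^n$ is a global minimizer over $\mathcal{A}_{\mathscr{T}_k}$ of $G\mapsto\mathbf{E}_{\tau_k,\mathscr{T}_k}(G;G_k^{n-1})$. Let $\rho_k^n,\mathbf{v}_k^n$ be the induced densities and velocities and $\widetilde\rho_k,\widetilde{\mathbf{v}}_k$ their piecewise constant interpolations. Assume that $\rho_k^0\to\rho^0\in\mathcal{P}_2^{\rm ac}(\mathbb{R}^d)$ narrowly and $\sup_k\mathcal{E}(\rho_k^0)<\infty$. Suppose (passing to a subsequence) that $\widetilde\rho_k(t)\to\rho_*(t)$ narrowly for each $t>0$, where $\rho_*:[0,\infty)\to\mathcal{P}_2^{\rm ac}(\mathbb{R}^d)$ is Hölder-$\frac12$-continuous in $\mathrm{W}_2$, and that $\widetilde{\mathbf{v}}_k\widetilde\rho_k\to\mathbf{v}_*\rho_*$ in the weak-$\star$ sense, where $\mathbf{v}_*\in L^2([0,\infty)\times\mathbb{R}^d;\rho_* )$ and $\partial_t\rho_*+\nabla\cdot(\rho_*\mathbf{v}_* )=0$ in the sense of distributions. Let $T>0$ and assume in addition that: (1) $P(\widetilde\rho_k)\to p_*$ in the weak-$\star$ sense on $[0,T]\times\mathbb{R}^d$ with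 some $p_*\in L^1([0,T]\times\mathbb{R}^d)$; (2) each $G_k^n$ is injective; (3) as $k\to\infty$, all simplices in the images of $\mathscr{T}_k$ under $G_k^n$ have uniformly non-degenerate interior angles and tend to zero in diameter, uniformly with respect to $n$. Then $\rho_*$ satisfies $$\partial_t\rho_*=\Delta p_*+\nabla\cdot(\rho_*\nabla V)$$ in the sense of distributions on $(0,T)\times\mathbb{R}^d$.
   Context: Standing assumptions. $d\ge2$. $h\in C^1([0,\infty))\cap C^\infty((0,\infty))$ is non-negative and convex with $h(0)=h'(0)=0$ and $\lim_{s\to\infty}s\,h''(s)=+\infty$; $P(r)=r\,h'(r)-h(r)$ for $r\ge0$; $V\in C^2(\mathbb{R}^d)$ is non-negative. $\mathcal{P}_2^{\rm ac}(\mathbb{R}^d)$ is the set of probability densities on $\mathbb{R}^d$ with finite second moment, and $\mathrm{W}_2$ is the $L^2$-Wasserstein distance on it. $\overline\rho\in\mathcal{P}_2^{\rm ac}(\mathbb{R}^d)$ is a fixed reference density whose support $K\subset\mathbb{R}^d$ is convex and compact. Narrow convergence is convergence tested against bounded continuous functions. $G_\#\rho$ denotes the push-forward. $L^2([0,\infty)\times\mathbb{R}^d;\rho_* )$ means $\int_0^\infty\int\|\mathbf{v}_*\|^2\rho_*\,\mathrm{d}x\,\mathrm{d}t<\infty$. Entropy: $\mathcal{E}(\rho)=\int_{\mathbb{R}^d}[h(\rho(x))+V(x)\rho(x)]\,\mathrm{d}x$. For a finite simplicial decomposition $\mathscr{T}$ of $K$ with $d$-simplices $\Delta_1,\dots,\Delta_M$: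 $\overline\rho_{\mathscr{T}}$ is constant on each $\Delta_m$ with value $\frac1{|\Delta_m|}\int_{\Delta_m}\overline\rho\,\mathrm{d}\omega$ (and zero outside $K$). $\mathcal{A}_{\mathscr{T}}$ is the set of continuous maps $G:K\to\mathbb{R}^d$ that on each $\Delta_m$ are affine, $G(\omega)=A_m\omega+b_m$, with $\det A_m>0$. With $\widetilde h(s)=s\,h(1/s)$ for $s>0$, $$\mathbf{E}(G|\overline\rho_{\mathscr{T}})=\int_K\Big[\widetilde h\Big(\frac{\det \mathrm{D}G}{\overline\rho_{\mathscr{T}}}\Big)+V\circ G\Big]\overline\rho_{\mathscr{T}}\,\mathrm{d}\omega,\qquad \mathbf{E}_{\tau,\mathscr{T}}(G;G^* )=\frac1{2\tau}\int_K\|G-G^*\|^2\overline\rho_{\mathscr{T}}\,\mathrm{d}\omega+\mathbf{E}(G|\overline\rho_{\mathscr{T}}).$$ Induced densities and velocities: $\rho_k^n=(G_k^n)_\#\overline\rho_{\mathscr{T}_k}$ for $n\ge0$, and for $n\ge1$, $\mathbf{v}_k^n=\frac1{\tau_k}\big(\mathrm{id}-G_k^{n-1}\circ(G_k^n)^{-1}\big)$ on the image of $G_k^n$ (arbitrary values outside). Interpolations: $\widetilde\rho_k(t)=\rho_k^n$, $\widetilde{\mathbf{v}}_k(t)=\mathbf{v}_k^n$ for $t\in((n-1)\tau_k,n\tau_k]$. Weak-$\star$ convergence of integrable functions (scalar or vector valued) on $[0,\infty)\times\mathbb{R}^d$, resp. $[0,T]\times\mathbb{R}^d$, means convergence of the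 integrals against every continuous compactly supported test function on that set. Uniformly non-degenerate interior angles means uniform shape regularity: there is a constant $C$, independent of $k$, $n$ and the simplex, such that each image simplex $G_k^n(\Delta)$, $\Delta\in\mathscr{T}_k$, has diameter at most $C$ times its inradius. *)

(* Defs.v *)
From HB Require Import structures.
From mathcomp Require Import all_boot all_order all_algebra.
From mathcomp Require Import all_classical all_reals all_analysis.
From mathcomp Require Import measurable_realfun.

Set Implicit Arguments.
Unset Strict Implicit.
Unset Printing Implicit Defensive.

Import Order.TTheory GRing.Theory Num.Theory.
Import numFieldNormedType.Exports.

Local Open Scope classical_set_scope.
Local Open Scope ring_scope.

HB.instance Definition _ (R : realType) (m n : nat) :=
  @isMeasurable.Build (sigma_display (@open 'M[R]_(m, n))) 'M[R]_(m, n)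
    <<s @open 'M[R]_(m, n) >>
    (@sigma_algebra0 _ setT _) (@sigma_algebraC _ _)
    (@sigma_algebra_bigcup _ setT _).

Section lebesgue_rV.
Variable R : realType.

Lemma open_measurable_mx m n (U : set 'M[R]_(m, n)) : open U -> measurable U.
Proof. exact: sub_gen_smallest. Qed.

Definition rV_cons n (z : measurableTypeR R * 'rV[R]_n) : 'rV[R]_n.+1 :=
  row_mx (z.1%:M : 'rV_1) z.2.

Lemma rV_cons0 n z : @rV_cons n z ord0 ord0 = z.1.
Proof.
by rewrite /rV_cons mxE; case: splitP => //= j _; rewrite (ord1 j) mxE eqxx.
Qed.

Lemma rV_consS n z j : @rV_cons n z ord0 (lift ord0 j) = z.2 ord0 j.
Proof.
rewrite /rV_cons mxE; case: splitP => [k|k] /=; first by rewrite (ord1 k).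
by rewrite /bump leq0n !add1n => -[] /val_inj ->.
Qed.

Definition rat_ball n (q : 'rV[rat]_n * rat) : set 'rV[R]_n :=
  ball (map_mx (@ratr R) q.1 : 'rV[R]_n) (ratr q.2 : R).

Lemma open_rat_ball n (U : set 'rV[R]_n) : open U ->
  U = \bigcup_(q in [set q | rat_ball q `<=` U]) rat_ball q.
Proof.
move=> oU; apply/seteqP; split => [x Ux|x [q /= qU]]; last exact: qU.
have /nbhs_ballP[e/= e0 eU] : nbhs x U by rewrite nbhsE; exists U.
have [r /andP[r0 re]] : exists r : rat, (0 < (ratr r : R) < e / 2).
  have /rat_in_itvoo[r] : 0 < e / 2 by rewrite divr_gt0.
  by rewrite in_itv/= => ?; exists r.
have /choice[q qP] : forall i, exists s : rat, `|x ord0 i - ratr s| < ratr r.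
  move=> i; have /rat_in_itvoo[s] : x ord0 i - ratr r < x ord0 i + ratr r.
    by rewrite ltrD2l gtrN.
  rewrite in_itv/= => /andP[s1 s2]; exists s.
  by rewrite ltr_distlC ltrBlDr s2 andbT -ltrBlDr.
exists (\row_i q i, r) => /=.
  move=> y [_ yq]; apply: eU; split => // i j.
  rewrite -(subrK (ratr (q j)) (x i j)).
  have := yq i j; rewrite !mxE /ball/= (ord1 i) => qy.
  rewrite -addrA (le_lt_trans (ler_normD _ _))//.
  by rewrite (splitr e) ltrD// (lt_trans _ re)//; exact: qP.
split => // i j; rewrite !mxE (ord1 i) /ball/= distrC; exact: qP.
Qed.

Lemma measurable_rV_cons n : measurable_fun setT (@rV_cons n).
Proof.
apply: (@measurability _ _ _ _ _ _ (@open 'rV[R]_n.+1)) => //.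
move=> _ [U oU <-]; rewrite setTI (open_rat_ball oU) preimage_bigcup.
rewrite bigcup_mkcond; apply: countable_bigcupT_measurable => [|q].
  exact: countableP.
case: ifPn => // _.
have -> : @rV_cons n @^-1` rat_ball q =
    ball (ratr (q.1 ord0 ord0) : R) (ratr q.2 : R) `*`
    ball (map_mx ratr (\row_i (q.1 ord0 (lift ord0 i))) : 'rV[R]_n)
         (ratr q.2 : R).
  apply/seteqP; split => [[x v]/= [q0 H]|[x v]/= [x0 [q0 H]]].
    split => /=; first by have := H ord0 ord0; rewrite rV_cons0 mxE.
    split => // i j; rewrite (ord1 i) !mxE.
    by have := H ord0 (lift ord0 j); rewrite rV_consS mxE.
  split => // i j; rewrite (ord1 i) mxE; case: (unliftP ord0 j) => [k|] ->.
    by have := H ord0 k; rewrite rV_consS !mxE.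
  by rewrite rV_cons0.
apply: measurableX; first exact: measurable_ball.
by apply: open_measurable_mx; apply: ball_open.
Qed.

HB.instance Definition _ n :=
  @isMeasurableFun.Build _ _ _ _ (@rV_cons n) (@measurable_rV_cons n).


Definition rV_uncons n (v : 'rV[R]_n.+1) : measurableTypeR R * 'rV[R]_n :=
  (v ord0 ord0, \row_i v ord0 (lift ord0 i)).

Lemma rV_consK n : cancel (@rV_cons n) (@rV_uncons n).
Proof.
move=> [x v]; rewrite /rV_uncons rV_cons0; congr pair.
by apply/rowP => j; rewrite mxE rV_consS.
Qed.

Lemma measurable_rV_uncons n : measurable_fun setT (@rV_uncons n).
Proof.
apply: measurable_fun_pair.
  apply: (measurability _ (RGenOInfty.measurableE R)).
  move=> _ [_ [a ->] <-]; rewrite setTI; apply: open_measurable_mx.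
  apply: open_comp; last exact: interval_open.
  by move=> x _; exact: coord_continuous.
apply: (@measurability _ _ _ _ _ _ (@open 'rV[R]_n)) => //.
move=> _ [U oU <-]; rewrite setTI; apply: open_measurable_mx.
apply: open_comp => // x _ /= A /nbhs_ballP[e/= e0 eA].
apply/nbhs_ballP; exists e => //= y [_ xy]; apply: eA; split => // i j.
by rewrite !mxE; exact: xy.
Qed.

Section lebesgue_rV_step.
Variables (n : nat) (mu : {sigma_finite_measure set 'rV[R]_n -> \bar R}).

Definition lebesgue_rV_step : set 'rV[R]_n.+1 -> \bar R :=
  pushforward (lebesgue_measure \x mu)%E (@rV_cons n).

Let step0 : lebesgue_rV_step set0 = 0%E.
Proof. exact: measure0. Qed.

Let step_ge0 A : (0 <= lebesgue_rV_step A)%E.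
Proof. exact: measure_ge0. Qed.

Let step_sigma_additive : semi_sigma_additive lebesgue_rV_step.
Proof. exact: measure_semi_sigma_additive. Qed.

HB.instance Definition _ := isMeasure.Build _ _ _ lebesgue_rV_step
  step0 step_ge0 step_sigma_additive.

Let step_sigma_finite : sigma_finite setT lebesgue_rV_step.
Proof.
have /sigma_finiteP[F [TF ndF Foo]] := sigma_finiteT (@lebesgue_measure R).
have /sigma_finiteP[G [TG ndG Goo]] := sigma_finiteT mu.
exists (fun i => @rV_uncons n @^-1` (F i `*` G i)).
  rewrite -preimage_bigcup (_ : \bigcup_i _ = setT) ?preimage_setT//.
  rewrite -setXTT TF TG predeqE => -[x y]; split.
    by move=> [i _ []/= ? ?]; split; exists i.
  move=> [/= [i _ Fx] [k _ Gy]]; exists (maxn i k) => //; split.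
  - by move: x Fx; exact/subsetPset/ndF/leq_maxl.
  - by move: y Gy; exact/subsetPset/ndG/leq_maxr.
move=> i; have [mF Fi] := Foo i; have [mG Gi] := Goo i; split.
  rewrite -[X in measurable X]setTI; apply: measurable_rV_uncons => //.
  exact: measurableX.
rewrite /lebesgue_rV_step /pushforward -comp_preimage.
rewrite (_ : _ \o _ = id); last by apply/funext => z /=; rewrite rV_consK.
by rewrite preimage_id product_measure1E// lte_mul_pinfty// ge0_fin_numE.
Qed.

HB.instance Definition _ := Measure_isSigmaFinite.Build _ _ _ lebesgue_rV_step
  step_sigma_finite.

End lebesgue_rV_step.

Fixpoint lebesgue_rV n : {sigma_finite_measure set 'rV[R]_n -> \bar R} :=
  match n with
  | 0 => \d_(0 : 'rV[R]_0)
  | n'.+1 => lebesgue_rV_step (lebesgue_rV n')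
  end.

Definition rV_box n (a b : 'rV[R]_n) : set 'rV[R]_n :=
  [set x | forall i, a ord0 i <= x ord0 i <= b ord0 i].

Lemma rV_box_cons n (a b : 'rV[R]_n.+1) :
  @rV_cons n @^-1` rV_box a b =
    `[a ord0 ord0, b ord0 ord0]%classic `*`
    rV_box (rV_uncons a).2 (rV_uncons b).2.
Proof.
apply/seteqP; split => [z/= H|z /= [/=]].
  rewrite /= in_itv/= -{1 2}(rV_cons0 z); split; first exact: H.
  by move=> i; rewrite !mxE -(rV_consS z); exact: H.
rewrite in_itv/= => z1 H i; case: (unliftP ord0 i) => [k|] ->.
  by have := H k; rewrite rV_consS !mxE.
by rewrite rV_cons0.
Qed.

Lemma measurable_rV_box n (a b : 'rV[R]_n) : measurable (rV_box a b).
Proof.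
have -> : rV_box a b =
    \bigcap_i ((fun x : 'rV[R]_n => x ord0 i) @^-1` `[a ord0 i, b ord0 i]).
  apply/seteqP; split => x H i; first by move=> _; rewrite /= in_itv; exact: H.
  by have := H i I; rewrite /= in_itv.
rewrite -[X in measurable X]setCK setC_bigcap; apply: measurableC.
apply: open_measurable_mx; apply: bigcup_open => i _.
rewrite openC; apply: preimage_closed; last exact: itv_closed.
by move=> x _; exact: coord_continuous.
Qed.

Lemma lebesgue_rV_box n (a b : 'rV[R]_n) :
  (forall i, a ord0 i <= b ord0 i) ->
  lebesgue_rV n (rV_box a b) = (\prod_i (b ord0 i - a ord0 i))%:E.
Proof.
elim: n a b => [|n IH] a b ab.
  by rewrite big_ord0 /= /dirac indicE mem_set// => -[].
rewrite /= /lebesgue_rV_step /pushforward rV_box_cons.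
rewrite product_measure1E//; last exact: measurable_rV_box.
rewrite IH; last by move=> i; rewrite !mxE.
rewrite [X in (X * _)%E](lebesgue_measure_itv `[a ord0 ord0, b ord0 ord0])/=.
rewrite lte_fin big_ord_recl EFinM.
congr (_ * _)%E; last by congr EFin; apply: eq_bigr => i _; rewrite !mxE.
have := ab ord0; rewrite le_eqVlt => /predU1P[->|->].
  by rewrite ltxx subrr.
by rewrite EFinB.
Qed.

End lebesgue_rV.

Section euclidean.
Variables (R : realType) (d : nat).
Implicit Types (u v : 'rV[R]_d) (A : set 'rV[R]_d).

(* The library's norm on 'rV[R]_d is the sup norm. *)
Definition dotv u v : R := \sum_i u ord0 i * v ord0 i.

Definition enorm u : R := Num.sqrt (dotv u u).

Definition diameter A : R := sup [set enorm (z.1 - z.2) | z in A `*` A].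

Definition inradius A : R :=
  sup [set r | 0 <= r /\ exists x, [set y | enorm (y - x) <= r] `<=` A].

End euclidean.

Section calculus.
Variable R : realType.

Fixpoint Ck (X : normedModType R) (n : nat) (f : X -> R) : Prop :=
  continuous f /\
  if n is m.+1 then
    forall v : X, (forall x, derivable f x v) /\ Ck m ('D_v f)
  else True.

Definition Cinfty (X : normedModType R) (f : X -> R) : Prop :=
  forall n, Ck n f.

Variable d : nat.
Implicit Types (phi : R * 'rV[R]_d -> R) (V : 'rV[R]_d -> R).

Definition grad V (x : 'rV[R]_d) : 'rV[R]_d :=
  \row_i 'D_(delta_mx ord0 i) V x.

Definition dt phi (z : R * 'rV[R]_d) : R := 'D_((1, 0) : R * 'rV[R]_d) phi z.

Definition dx (i : 'I_d) phi (z : R * 'rV[R]_d) : R :=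
  'D_((0, delta_mx ord0 i) : R * 'rV[R]_d) phi z.

Definition gradx phi (z : R * 'rV[R]_d) : 'rV[R]_d := \row_i dx i phi z.

Definition laplx phi (z : R * 'rV[R]_d) : R := \sum_i dx i (dx i phi) z.

(* C_c^infty(U) for an open set U, its elements being extended by zero. *)
Definition test_function (U : set (R * 'rV[R]_d)) phi : Prop :=
  Cinfty phi /\
  exists C : set (R * 'rV[R]_d),
    [/\ compact C, C `<=` U & forall z, ~ C z -> phi z = 0].

(* C_c(D): the support is compact in D, but need not avoid the boundary of D
   in R * R^d. *)
Definition Cc (D : set (R * 'rV[R]_d)) phi : Prop :=
  {within D, continuous phi} /\
  exists C : set (R * 'rV[R]_d),
    [/\ compact C, C `<=` D & forall z, D z -> ~ C z -> phi z = 0].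

End calculus.

Section densities.
Variables (R : realType) (d : nat).
Implicit Types (rho sigma : 'rV[R]_d -> R) (K : set 'rV[R]_d).
Local Notation leb := (lebesgue_rV R d).

(* Densities are everywhere-defined representatives, nonnegative everywhere. *)
Definition P2ac rho : Prop :=
  [/\ measurable_fun setT rho, forall x, 0 <= rho x,
      (\int[leb]_x (rho x)%:E = 1)%E &
      (\int[leb]_x (enorm x ^+ 2 * rho x)%:E < +oo)%E].

(* The support of the measure rho dx, independent of the representative. *)
Definition density_support rho : set 'rV[R]_d :=
  [set x | forall e : R, 0 < e -> (0 < \int[leb]_(y in ball x e) (rho y)%:E)%E].

Definition coupling rho sigma
    (gamma : {measure set ('rV[R]_d * 'rV[R]_d) -> \bar R}) : Prop :=
  forall A : set 'rV[R]_d, measurable A ->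
    gamma (A `*` setT) = (\int[leb]_(x in A) (rho x)%:E)%E /\
    gamma (setT `*` A) = (\int[leb]_(x in A) (sigma x)%:E)%E.

Definition W2 rho sigma : \bar R :=
  (ereal_inf [set (\int[gamma]_z (enorm (z.1 - z.2) ^+ 2)%:E) |
                gamma in [set gamma : {measure set _ -> \bar R} |
                            coupling rho sigma gamma]] `^ 2^-1)%E.

Definition W2_holder_half (rho : R -> 'rV[R]_d -> R) : Prop :=
  exists C : R, forall s t, 0 <= s -> 0 <= t ->
    (W2 (rho s) (rho t) <= (C * Num.sqrt `|s - t|)%:E)%E.

Definition narrow_cvg (rho_ : nat -> 'rV[R]_d -> R) rho : Prop :=
  forall phi : 'rV[R]_d -> R,
    continuous phi -> (exists M, forall x, `|phi x| <= M) ->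
    (\int[leb]_x (phi x * rho_ k x)%:E)%E @[k --> \oo] -->
    (\int[leb]_x (phi x * rho x)%:E)%E.

(* rho is (a version of) the density of G_# r, for a map G on K and a density r
   vanishing outside K. *)
Definition push_density K (G : 'rV[R]_d -> 'rV[R]_d) (r rho : 'rV[R]_d -> R)
    : Prop :=
  [/\ measurable_fun setT rho, forall x, 0 <= rho x &
      forall A : set 'rV[R]_d, measurable A ->
        (\int[leb]_(x in A) (rho x)%:E =
         \int[leb]_(w in K `&` G @^-1` A) (r w)%:E)%E].

End densities.

Section entropy.
Variable R : realType.
Implicit Types h : R -> R.

(* h is continuously differentiable on [0, +oo[ with derivative dh, which is
   one-sided at 0. *)
Definition C1_halfline h (dh : R -> R) : Prop :=
  {within `[0, +oo[%classic, continuous dh} /\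
  forall s, 0 <= s ->
    (h y - h s) / (y - s) @[y --> within `[0, +oo[%classic s^'] --> dh s.

Record entropy_density h : Prop := EntropyDensity {
  ed_C1 : exists dh, C1_halfline h dh /\ dh 0 = 0;
  ed_smooth : forall n s, 0 < s -> derivable (derive1n n h) s 1;
  ed_ge0 : forall s, 0 <= s -> 0 <= h s;
  ed_convex : convex_function (`[0, +oo[%classic : set R^o) h;
  ed_h0 : h 0 = 0;
  ed_superlinear : s * derive1n 2 h s @[s --> +oo] --> +oo }.

(* At r = 0 the two-sided derivative of h is meaningless, but it is multiplied
   by 0. *)
Definition pressure h (r : R) : R := r * derive1 h r - h r.

Definition htilde h (s : R) : R := s * h s^-1.

Variable d : nat.
Local Notation leb := (lebesgue_rV R d).

Definition entropy h (V rho : 'rV[R]_d -> R) : \bar R :=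
  (\int[leb]_x (h (rho x) + V x * rho x)%:E)%E.

End entropy.

Section discretization.
Variables (R : realType) (d : nat).
Local Notation leb := (lebesgue_rV R d).

Definition affinely_independent (p : 'I_d.+1 -> 'rV[R]_d) : Prop :=
  forall c : 'I_d.+1 -> R,
    \sum_i c i = 0 -> \sum_i c i *: p i = 0 -> forall i, c i = 0.

Definition face (p : 'I_d.+1 -> 'rV[R]_d) (I : {set 'I_d.+1}) :
    set 'rV[R]_d :=
  [set x | exists c : 'I_d.+1 -> R,
     [/\ forall i, 0 <= c i, forall i, i \notin I -> c i = 0,
         \sum_i c i = 1 & x = \sum_i c i *: p i]].

Definition simplex (p : 'I_d.+1 -> 'rV[R]_d) : set 'rV[R]_d :=
  face p [set: 'I_d.+1].

Record simplicial_decomposition (K : set 'rV[R]_d) := SimplicialDecomposition {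
  sd_size : nat;
  sd_vertex : 'I_sd_size -> 'I_d.+1 -> 'rV[R]_d;
  sd_indep : forall m, affinely_independent (sd_vertex m);
  sd_cover : \bigcup_(m in [set: 'I_sd_size]) simplex (sd_vertex m) = K;
  sd_distinct : forall m m', m != m' ->
    simplex (sd_vertex m) <> simplex (sd_vertex m');
  sd_common_face : forall m m', exists I J,
    simplex (sd_vertex m) `&` simplex (sd_vertex m') = face (sd_vertex m) I /\
    simplex (sd_vertex m) `&` simplex (sd_vertex m') = face (sd_vertex m') J }.

Variable K : set 'rV[R]_d.
Implicit Types (S : simplicial_decomposition K) (G : 'rV[R]_d -> 'rV[R]_d).

Definition cell S (m : 'I_(sd_size S)) : set 'rV[R]_d :=
  simplex (sd_vertex m).

Definition mesh S : R := \big[Num.max/0]_(m < sd_size S) diameter (cell m).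

(* On the (negligible) common faces of several cells, one of the corresponding
   averages is picked. *)
Definition discrete_density S (rhobar : 'rV[R]_d -> R) (w : 'rV[R]_d) : R :=
  if [pick m : 'I_(sd_size S) | `[< cell m w >]] is Some m then
    (fine (leb (cell m)))^-1 * \int[leb]_(x in cell m) rhobar x
  else 0.

(* Vectors are rows: w *m A is the image of w by the transpose of A. *)
Definition admissible S G : Prop :=
  {within K, continuous G} /\
  forall m : 'I_(sd_size S), exists (A : 'M[R]_d) (b : 'rV[R]_d),
    0 < \det A /\ forall w, cell m w -> G w = w *m A + b.

(* 'J G, the (transposed) matrix of DG, is meaningful in the interior of the
   cells, hence almost everywhere on K, for an admissible G. *)
Definition energy (h : R -> R) (V r : 'rV[R]_d -> R) G : \bar R :=
  (\int[leb]_(w in K)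
     ((htilde h (\det ('J G w) / r w) + V (G w)) * r w)%:E)%E.

Definition energy_tau (tau : R) (h : R -> R) (V r : 'rV[R]_d -> R) G Gstar :
    \bar R :=
  (((2 * tau)^-1)%:E * \int[leb]_(w in K) (enorm (G w - Gstar w) ^+ 2 * r w)%:E
   + energy h V r G)%E.

Definition is_minimizer S (F : ('rV[R]_d -> 'rV[R]_d) -> \bar R) G : Prop :=
  admissible S G /\ forall G', admissible S G' -> (F G <= F G')%E.

(* v = (id - Gprev \o G^-1) / tau on the image of G; no condition elsewhere. *)
Definition induced_velocity (tau : R) Gprev G (v : 'rV[R]_d -> 'rV[R]_d) :
    Prop :=
  forall w, K w -> v (G w) = tau^-1 *: (G w - Gprev w).

End discretization.

(* The value at t is f n for t in ](n - 1) tau, n tau]. *)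
Definition interpolation (R : realType) (X : Type) (tau : R) (f : nat -> X)
    (t : R) : X :=
  f `|Num.ceil (t / tau)|%N.

Definition slab (R : realType) (d : nat) (I : interval R) :
    set (measurableTypeR R * 'rV[R]_d) :=
  [set` I] `*` setT.

Section spacetime.
Variables (R : realType) (d : nat).
Local Notation mu := (@lebesgue_measure R \x lebesgue_rV R d)%E.

Definition weak_star_cvg (D : set (R * 'rV[R]_d))
    (f_ : nat -> R * 'rV[R]_d -> R) (f : R * 'rV[R]_d -> R) : Prop :=
  forall phi, Cc D phi ->
    (\int[mu]_(z in D) (f_ k z * phi z)%:E)%E @[k --> \oo] -->
    (\int[mu]_(z in D) (f z * phi z)%:E)%E.

Definition L2_velocity (rho : R -> 'rV[R]_d -> R)
    (v : R -> 'rV[R]_d -> 'rV[R]_d) : Prop :=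
  measurable_fun (slab `[0, +oo[)
    (fun z : R * 'rV[R]_d => v z.1 z.2) /\
  (\int[mu]_(z in slab `[0, +oo[%R)
     (enorm (v z.1 z.2) ^+ 2 * rho z.1 z.2)%:E < +oo)%E.

(* d_t rho + div (rho v) = 0 on ]0, +oo[ * R^d, in weak form. *)
Definition continuity_equation (rho : R -> 'rV[R]_d -> R)
    (v : R -> 'rV[R]_d -> 'rV[R]_d) : Prop :=
  forall phi, test_function (slab `]0, +oo[) phi ->
    (\int[mu]_(z in slab `]0, +oo[%R)
       (rho z.1 z.2 * dt phi z
        + rho z.1 z.2 * dotv (v z.1 z.2) (gradx phi z))%:E = 0)%E.

(* d_t rho = Delta p + div (rho grad V) on ]0, T[ * R^d, tested and integrated by
   parts: the three terms become - rho d_t phi, p Delta phi and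
   - rho (grad V . grad phi). *)
Definition limit_equation (T : R) (V : 'rV[R]_d -> R)
    (rho : R -> 'rV[R]_d -> R) (p : R * 'rV[R]_d -> R) : Prop :=
  forall phi, test_function (slab `]0, T[) phi ->
    (\int[mu]_(z in slab `]0, T[%R)
       (rho z.1 z.2 * dt phi z + p z * laplx phi z
        - rho z.1 z.2 * dotv (grad V z.2) (gradx phi z))%:E = 0)%E.

End spacetime.

(* Main.v *)
Require Import Defs.
From HB Require Import structures.
From mathcomp Require Import all_boot all_order all_algebra.
From mathcomp Require Import all_classical all_reals all_analysis.
From mathcomp Require Import measurable_realfun.
From mathcomp Require Import ring lra.

Set Implicit Arguments.
Unset Strict Implicit.
Unset Printing Implicit Defensive.

Import Order.TTheory GRing.Theory Num.Theory.
Import numFieldNormedType.Exports.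

Local Open Scope classical_set_scope.
Local Open Scope ring_scope.

(* A global minimizer is a critical point: perturbing G^n in the direction of the
   piecewise affine interpolation of xi o G^n, with xi = grad_x phi(t, .), gives the
   Euler-Lagrange equation.  Transported to the image of G^n, it is the momentum
   balance
     int (rho v . zeta + rho grad V . zeta - P(rho) div zeta) dx = 0,
   where zeta interpolates xi at the vertices of the image simplices.  Shape
   regularity makes |zeta - xi| and |div zeta - div xi| uniformly small as the
   diameters tend to zero, because the first derivatives of xi are uniformly
   continuous; the resulting error is controlled by int |rho v|, the mass and
   int P(rho) on a fixed ball.  These stay bounded: |rho v| <= rho + rho |v|^2, the
   kinetic energies sum up to at most twice the initial entropy (compare G^n with
   G^(n-1) in the minimization), and the pressure term converges by assumption.  So
   the balance holds in the limit with zeta = xi, and the continuity equation for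
   rho_*, tested with phi, replaces the momentum by the time derivative. *)

(** A direction of perturbation must be continuous and affine on every cell, which [xi o G] is not;
    its nodal interpolation is, and it is well defined because two cells meet in a common face.
    Jacobi's formula differentiates [det A] in the direction [B] to [det A tr (A^-1 B)], and in
    image coordinates this trace is [div zeta]. The balance is therefore exact for the affine field
    [zeta], and interpolation is the only source of error. The test field is frozen at each time
    [t], so time stepping adds no error of its own. Shape regularity is what controls [div zeta]:
    differences of nodal values are divided by the length of a segment inside the simplex, which
    must be comparable to the diameter. The pressure is controlled only against compactly supported
    test functions; hence the error carries a weight [chi] that is at least 1 near the support of
    the test field. All integrals are reduced to finite sums over open cells, with integrands that
    extend continuously to the whole space. The given densities agree with these explicit ones only
    up to null sets, so representatives have to be exchanged under the integral. *)

(** * Continuity and Borel measurability on row vectors *)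

Section continuity_rV.
Variable R : realType.

Lemma continuous_rV (T : topologicalType) n (f : T -> 'rV[R]_n) :
  (forall i, continuous (fun x => f x ord0 i)) -> continuous f.
Proof.
move=> fc x A /nbhs_ballP[e/= e0 eA].
have : \forall y \near x, forall i, ball (f x ord0 i) e (f y ord0 i).
  apply: filter_forall => i; exact: (fc i x _ (nbhsx_ballx _ _ e0)).
apply: filterS => y fy; apply: eA; split => // i j; rewrite (ord1 i); exact: fy.
Qed.

Lemma continuous_sum (T : topologicalType) (I : Type) (s : seq I)
  (f : I -> T -> R) :
  (forall i, continuous (f i)) -> continuous (fun x => \sum_(i <- s) f i x).
Proof.
move=> fc x; elim: s => [|i s IH].
  rewrite (_ : (fun _ => _) = cst 0); first exact: cst_continuous.
  by apply/funext => y; rewrite big_nil.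
rewrite (_ : (fun _ => _) = (fun y => f i y + \sum_(j <- s) f j y)).
  by apply: cvgD => //; exact: fc.
by apply/funext => y; rewrite big_cons.
Qed.

Lemma continuous_affine n m (A : 'M[R]_(n, m)) (b : 'rV[R]_m) :
  continuous (fun w : 'rV[R]_n => w *m A + b).
Proof.
apply: continuous_rV => i x.
rewrite (_ : (fun _ => _) =
    (fun w : 'rV[R]_n => \sum_j w ord0 j * A j i + b ord0 i)); last first.
  by apply/funext => w; rewrite !mxE.
apply: continuousD; last exact: cst_continuous.
apply: continuous_sum => j y.
by apply: continuousM; [exact: coord_continuous|exact: cst_continuous].
Qed.

Lemma continuous_linear_form n (a : 'cV[R]_n) :
  continuous (fun w : 'rV[R]_n => (w *m a) ord0 ord0).
Proof.
rewrite (_ : (fun _ => _) = (fun w : 'rV[R]_n => \sum_j w ord0 j * a j ord0)).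
  apply: continuous_sum => j y.
  by apply: continuousM; [exact: coord_continuous|exact: cst_continuous].
by apply/funext => w; rewrite !mxE.
Qed.

Lemma continuous_measurable_mx n m p q (f : 'M[R]_(n, m) -> 'M[R]_(p, q)) :
  continuous f -> measurable_fun setT f.
Proof.
move=> fc; apply: (@measurability _ _ _ _ _ _ (@open 'M[R]_(p, q))) => //.
move=> _ [U oU <-]; rewrite setTI; apply: open_measurable_mx.
by apply: open_comp => // x _; exact: fc.
Qed.

Lemma continuous_measurable_rV n m (f : 'M[R]_(n, m) -> R) :
  continuous f -> measurable_fun setT f.
Proof.
move=> fc; apply: (measurability _ (RGenOInfty.measurableE R)).
move=> _ [_ [a ->] <-]; rewrite setTI; apply: open_measurable_mx.
by apply: open_comp; [move=> x _; exact: fc|exact: interval_open].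
Qed.

Lemma continuous_rV_uncons n :
  continuous (@rV_uncons R n : 'rV[R]_n.+1 -> R * 'rV[R]_n).
Proof.
have c2 : continuous (fun v : 'rV[R]_n.+1 => (rV_uncons v).2).
  apply: continuous_rV => i y.
  rewrite (_ : (fun _ => _) = (fun v : 'rV[R]_n.+1 => v ord0 (lift ord0 i))).
    exact: coord_continuous.
  by apply/funext => v; rewrite mxE.
move=> v A [[B C] /= [Bv Cv] BCA].
have H1 : nbhs v [set w : 'rV[R]_n.+1 | B (w ord0 ord0)] by exact: coord_continuous Bv.
have H2 : nbhs v [set w : 'rV[R]_n.+1 | C (rV_uncons w).2] by exact: c2 Cv.
by apply: filterS2 H1 H2 => w ? ?; exact: (BCA (rV_uncons w)).
Qed.

(* [rV_cons] transports the question to ['rV_n.+1], where open sets are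
   measurable by definition. *)
Lemma continuous_measurable_prod n (f : R * 'rV[R]_n -> R) :
  continuous f ->
  measurable_fun setT (f : measurableTypeR R * 'rV[R]_n -> R).
Proof.
move=> fc.
have -> : f = (f \o @rV_uncons R n) \o @rV_cons R n.
  by apply/funext => z; rewrite /= rV_consK.
apply: measurableT_comp; last exact: measurable_rV_cons.
apply: continuous_measurable_rV => x; apply: continuous_comp; last exact: fc.
exact: continuous_rV_uncons.
Qed.

End continuity_rV.

(** * Lebesgue measure under invertible affine maps *)

Definition pushforward_measure d d' (T : measurableType d)
    (T' : measurableType d') (R : realFieldType)
    (mu : {measure set T -> \bar R}) (f : T -> T')
    (mf : measurable_fun setT f) : {measure set T' -> \bar R} :=
  measure_function_pushforward__canonical__measure_function_Measure mu mf.

Section affine_change_of_variables.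
Variable R : realType.
Local Notation leb := (lebesgue_rV R).
Local Open Scope ereal_scope.

Definition affine1 (a b : R) (x : measurableTypeR R) : measurableTypeR R :=
  (x * a + b)%R.

Lemma measurable_affine1 (a b : R) : measurable_fun setT (affine1 a b).
Proof. by apply: measurable_funD => //; exact: measurable_funM. Qed.

HB.instance Definition _ (a b : R) :=
  @isMeasurableFun.Build _ _ _ _ (affine1 a b) (@measurable_affine1 a b).

(** By uniqueness of Lebesgue measure it is enough to compare both sides on intervals []c, d]]. For
    [a < 0] the preimage is closed at the other end, which does not affect its length. *)
Lemma lebesgue_measure_affine (a b : R) (B : set (measurableTypeR R)) :
  a != 0%R -> measurable B ->
  `|a|%:E * lebesgue_measure (affine1 a b @^-1` B) = lebesgue_measure B.
Proof.
move=> a0 mB.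
pose nu : {measure set (measurableTypeR R) -> \bar R} :=
  mscale (NngNum (normr_ge0 a)) (pushforward_measure lebesgue_measure
    (@measurable_affine1 a b)).
suff nuE A : measurable A -> lebesgue_measure A = nu A by rewrite [RHS]nuE.
apply: lebesgue_measure_unique => _ [[c d] _ <-].
rewrite [RHS](_ : _ = `|a|%:E * lebesgue_measure (affine1 a b @^-1` `]c, d]))//.
rewrite lebesgue_measure_itv /= lte_fin.
case: (ltgtP a 0%R) (a0) => // [alt0|agt0] _.
  rewrite (_ : _ @^-1` _ = `[(d - b) / a, (c - b) / a[%classic)%R; last first.
    apply/seteqP; split => x; rewrite /= !in_itv /= /affine1 => /andP[h1 h2].
      by rewrite ler_ndivrMr // ltr_ndivlMr // lerBrDr ltrBlDr h1 h2.
    by move: h1 h2; rewrite ler_ndivrMr // ltr_ndivlMr // lerBrDr ltrBlDr => -> ->.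
  rewrite lebesgue_measure_itv /= lte_fin ltr_nM2r ?invr_lt0// ltrD2r.
  case: ifP => cd; last by rewrite mule0.
  rewrite -!EFinB -EFinM ltr0_norm//; congr EFin; field; exact: a0.
rewrite (_ : _ @^-1` _ = `](c - b) / a, (d - b) / a]%classic)%R; last first.
  apply/seteqP; split => x; rewrite /= !in_itv /= /affine1 => /andP[h1 h2].
    by rewrite ltr_pdivrMr // ler_pdivlMr // lerBrDr ltrBlDr h1 h2.
  by move: h1 h2; rewrite ltr_pdivrMr // ler_pdivlMr // lerBrDr ltrBlDr => -> ->.
rewrite lebesgue_measure_itv /= lte_fin ltr_pM2r ?invr_gt0// ltrD2r.
case: ifP => cd; last by rewrite mule0.
rewrite -!EFinB -EFinM gtr0_norm//; congr EFin; field; exact: a0.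
Qed.

Lemma ge0_integral_affine1 (a b : R) (f : measurableTypeR R -> \bar R) :
  a != 0%R -> measurable_fun setT f -> (forall x, 0 <= f x) ->
  `|a|%:E * \int[lebesgue_measure]_x f (affine1 a b x) =
  \int[lebesgue_measure]_x f x.
Proof.
move=> a0 mf f0.
pose nu : {measure set (measurableTypeR R) -> \bar R} :=
  mscale (NngNum (normr_ge0 a)) (pushforward_measure lebesgue_measure
    (@measurable_affine1 a b)).
rewrite [RHS](@eq_measure_integral _ _ _ _ nu); last first.
  by move=> A mA _; exact/esym/(lebesgue_measure_affine b a0 mA).
rewrite ge0_integral_mscale//; congr (_ * _).
apply/esym; rewrite -[in RHS](preimage_setT (affine1 a b)).
exact: (ge0_integral_pushforward (@measurable_affine1 a b)).
Qed.

Lemma measurable_rV_xsection n (A : set 'rV[R]_n.+1) x :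
  measurable A -> measurable [set v | A (rV_cons (x, v))].
Proof.
move=> mA; rewrite (_ : [set _ | _] = xsection (@rV_cons R n @^-1` A) x).
  apply: measurable_xsection.
  by rewrite -[X in measurable X]setTI; exact: measurable_rV_cons.
by apply/seteqP; split => v; rewrite /xsection /= inE.
Qed.

Lemma measurable_rV_ysection n (A : set 'rV[R]_n.+1) v :
  measurable A ->
  measurable ([set x | A (rV_cons (x, v))] : set (measurableTypeR R)).
Proof.
move=> mA; rewrite (_ : [set _ | _] = ysection (@rV_cons R n @^-1` A) v).
  apply: measurable_ysection.
  by rewrite -[X in measurable X]setTI; exact: measurable_rV_cons.
by apply/seteqP; split => x; rewrite /ysection /= inE.
Qed.

Lemma measurable_lebesgue_rV_xsection n (A : set 'rV[R]_n.+1) : measurable A ->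
  measurable_fun setT
    (fun x : measurableTypeR R => leb n [set v | A (rV_cons (x, v))]).
Proof.
move=> mA.
rewrite (_ : (fun _ => _) = leb n \o xsection (@rV_cons R n @^-1` A)).
  apply: measurable_fun_xsection.
  by rewrite -[X in measurable X]setTI; exact: measurable_rV_cons.
apply/funext => x /=; congr (leb n _); apply/seteqP; split => v;
  by rewrite /xsection /= inE.
Qed.

Lemma measurable_lebesgue_rV_ysection n (A : set 'rV[R]_n.+1) : measurable A ->
  measurable_fun setT (fun v : 'rV[R]_n =>
    lebesgue_measure ([set x | A (rV_cons (x, v))] : set (measurableTypeR R))).
Proof.
move=> mA.
rewrite (_ : (fun _ => _) =
    lebesgue_measure \o ysection (@rV_cons R n @^-1` A)).
  apply: measurable_fun_ysection.
  by rewrite -[X in measurable X]setTI; exact: measurable_rV_cons.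
apply/funext => v /=; congr (lebesgue_measure _); apply/seteqP; split => x;
  by rewrite /ysection /= inE.
Qed.

Lemma lebesgue_rVS_xsection n (A : set 'rV[R]_n.+1) : measurable A ->
  leb n.+1 A = \int[lebesgue_measure]_x leb n [set v | A (rV_cons (x, v))].
Proof.
move=> mA; rewrite /= /lebesgue_rV_step /pushforward /= /product_measure1.
apply: eq_integral => x _ /=; congr (leb n _); apply/seteqP; split => v;
  by rewrite /xsection /= inE.
Qed.

(** The measure is built by slicing along the first coordinate; slicing in the other order comes
    from the uniqueness of the product measure. *)
Lemma lebesgue_rVS_ysection n (A : set 'rV[R]_n.+1) : measurable A ->
  leb n.+1 A = \int[leb n]_v
    lebesgue_measure ([set x | A (rV_cons (x, v))] : set (measurableTypeR R)).
Proof.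
move=> mA; rewrite /= /lebesgue_rV_step /pushforward /=.
transitivity ((lebesgue_measure \x^ leb n) (@rV_cons R n @^-1` A)).
  apply: product_measure_unique => //=.
    by move=> *; rewrite product_measure2E.
  by rewrite -[X in measurable X]setTI; exact: measurable_rV_cons.
rewrite /product_measure2 /=.
apply: eq_integral => v _ /=; congr (lebesgue_measure _).
by apply/seteqP; split => x; rewrite /ysection /= inE.
Qed.

Definition affine_map n m (A : 'M[R]_(n, m)) (b : 'rV[R]_m) (w : 'rV[R]_n) :=
  (w *m A + b)%R.

Lemma measurable_affine_map n m A b : measurable_fun setT (@affine_map n m A b).
Proof. by apply: continuous_measurable_mx; exact: continuous_affine. Qed.

HB.instance Definition _ n m A b :=
  @isMeasurableFun.Build _ _ _ _ (@affine_map n m A b)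
    (@measurable_affine_map n m A b).

(** All translations [b] are included at once, because slicing a block matrix produces a translation
    that depends on the sliced coordinate. *)
Let scales n (A : 'M[R]_n) := forall b B, measurable B ->
  `|\det A|%:E * leb n (affine_map A b @^-1` B) = leb n B.

Let scales_integral n (A : 'M[R]_n) b (f : 'rV[R]_n -> \bar R) : scales A ->
  measurable_fun setT f -> (forall x, 0 <= f x) ->
  `|\det A|%:E * \int[leb n]_x f (affine_map A b x) = \int[leb n]_x f x.
Proof.
move=> sA mf f0.
pose nu : {measure set 'rV[R]_n -> \bar R} :=
  mscale (NngNum (normr_ge0 (\det A)))
    (pushforward_measure (leb n) (@measurable_affine_map n n A b)).
rewrite [RHS](@eq_measure_integral _ _ _ _ nu); last first.
  by move=> B mB _; exact/esym/(sA b B mB).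
rewrite ge0_integral_mscale//; congr (_ * _).
apply/esym; rewrite -[in RHS](preimage_setT (affine_map A b)).
exact: (ge0_integral_pushforward (@measurable_affine_map n n A b)).
Qed.

Let scalesM n (A B : 'M[R]_n) : scales A -> scales B -> scales (A *m B).
Proof.
move=> sA sB b S mS; rewrite det_mulmx normrM mulrC EFinM -muleA.
rewrite (_ : _ @^-1` _ = affine_map A 0 @^-1` (affine_map B b @^-1` S)).
  rewrite sA ?sB//.
  by rewrite -[X in measurable X]setTI; exact: measurable_affine_map.
by apply/seteqP; split => x; rewrite /= /affine_map addr0 mulmxA.
Qed.

Let affine_ublock n (a : R) (u : 'rV[R]_n) (B : 'M[R]_n) b x v :
  @affine_map n.+1 n.+1 (block_mx a%:M u 0%R B) b (rV_cons (x, v)) =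
  rV_cons (affine1 a (b ord0 ord0) x,
           affine_map B (x *: u + @rsubmx _ _ 1 n b)%R v).
Proof.
rewrite /affine_map /rV_cons /affine1 -{1}[b](@hsubmxK _ 1 1 n) (@mul_row_block _ 1 1 n 1 n).
rewrite (@add_row_mx _ 1 1 n) mulmx0 addr0 -scalar_mxM.
rewrite mul_scalar_mx /=; apply: (congr2 (@row_mx R 1 1 n)); last by rewrite addrCA addrA.
by apply/rowP => i; rewrite !mxE (ord1 i) eqxx !mulr1n; congr (_ + b _ _)%R;
  apply/val_inj.
Qed.

Let affine_lblock n (a : R) (c : 'cV[R]_n) (B : 'M[R]_n) b x v :
  @affine_map n.+1 n.+1 (block_mx a%:M 0%R c B) b (rV_cons (x, v)) =
  rV_cons (affine1 a ((v *m c) ord0 ord0 + b ord0 ord0)%R x,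
           affine_map B (@rsubmx _ _ 1 n b)%R v).
Proof.
rewrite /affine_map /rV_cons /affine1 -{1}[b](@hsubmxK _ 1 1 n) (@mul_row_block _ 1 1 n 1 n).
rewrite (@add_row_mx _ 1 1 n) mulmx0 add0r -scalar_mxM /=.
apply: (congr2 (@row_mx R 1 1 n)) => //.
apply/rowP => i; rewrite !mxE (ord1 i) eqxx !mulr1n -addrA.
by congr (_ + (_ + b _ _))%R; apply/val_inj.
Qed.

(** For fixed first coordinate [x] the map acts on the rest as [B] followed by a translation
    depending on [x]; the outer integral is then a one-dimensional dilation by [a]. *)
Let scales_ublock n (a : R) (u : 'rV[R]_n) (B : 'M[R]_n) :
  a != 0%R -> scales B -> @scales n.+1 (block_mx a%:M u 0%R B).
Proof.
move=> a0 sB b S mS; rewrite (@det_ublock _ 1 n) det_scalar1 normrM EFinM.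
rewrite [in RHS]lebesgue_rVS_xsection// -(ge0_integral_affine1 (b ord0 ord0) a0)//;
  last exact: measurable_lebesgue_rV_xsection.
rewrite lebesgue_rVS_xsection; last first.
  by rewrite -[X in measurable X]setTI; exact: measurable_affine_map.
rewrite -muleA -ge0_integralZl//; last first.
  apply: measurable_lebesgue_rV_xsection.
  by rewrite -[X in measurable X]setTI; exact: measurable_affine_map.
congr (_ * _); apply: eq_integral => x _.
rewrite /= -[RHS](sB (x *: u + @rsubmx _ _ 1 n b)%R); last exact: measurable_rV_xsection.
congr (_ * leb n _); apply/seteqP; split => v;
  by rewrite /= affine_ublock.
Qed.

(** Here the translation falls on the first coordinate and depends on the remaining ones, so the
    slicing goes the other way. *)
Let scales_lblock n (a : R) (c : 'cV[R]_n) (B : 'M[R]_n) :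
  a != 0%R -> scales B -> @scales n.+1 (block_mx a%:M 0%R c B).
Proof.
move=> a0 sB b S mS.
rewrite (@det_lblock _ 1 n) det_scalar1 normrM mulrC EFinM.
rewrite [in RHS]lebesgue_rVS_ysection//.
rewrite -(scales_integral (@rsubmx _ _ 1 n b) sB)//;
  last exact: measurable_lebesgue_rV_ysection.
rewrite lebesgue_rVS_ysection; last first.
  by rewrite -[X in measurable X]setTI; exact: measurable_affine_map.
rewrite -muleA -ge0_integralZl//; last first.
  apply: measurable_lebesgue_rV_ysection.
  by rewrite -[X in measurable X]setTI; exact: measurable_affine_map.
congr (_ * _); apply: eq_integral => v _.
rewrite -[RHS](lebesgue_measure_affine ((v *m c) ord0 ord0 + b ord0 ord0) a0);
  last exact: measurable_rV_ysection.
congr (_ * lebesgue_measure _); apply/seteqP; split => x;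
  by rewrite /= affine_lblock.
Qed.

Let scales1 n : scales (1%:M : 'M[R]_n).
Proof.
elim: n => [|n IH].
  move=> b B mB; rewrite det1 normr1 mul1e; congr (leb 0 _).
  by apply/seteqP; split => x; rewrite /= [affine_map _ _ _]thinmx0 [x]thinmx0.
rewrite (_ : 1%:M = @block_mx _ 1 n 1 n 1%:M 0 0 1%:M)%R; last first.
  exact: (@scalar_mx_block _ 1 n).
exact: scales_ublock.
Qed.

(** One step of Gaussian elimination: a lower shear times an upper block matrix whose lower right
    block is the Schur complement of the pivot. *)
Let scales_pivot n (A : 'M[R]_n.+1) :
  (forall B : 'M[R]_n, B \in unitmx -> scales B) ->
  A ord0 ord0 != 0%R -> A \in unitmx -> scales A.
Proof.
move=> IH a0 Au.
pose a := A ord0 ord0; pose u : 'rV[R]_n := @ursubmx _ 1 n 1 n A.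
pose c : 'cV[R]_n := @dlsubmx _ 1 n 1 n A; pose B := @drsubmx _ 1 n 1 n A.
have AE : A = (@block_mx _ 1 n 1 n 1%:M 0 (a^-1 *: c) 1%:M) *m
              (@block_mx _ 1 n 1 n a%:M u 0 (B - a^-1 *: (c *m u)))%R.
  rewrite mulmx_block !mul1mx !mul0mx !addr0.
  rewrite -[A in LHS](@submxK _ 1 n 1 n); apply: f_equal4 => //.
  - apply/matrixP => i j; rewrite !mxE (ord1 i) (ord1 j) mulr1n.
    by congr (A _ _); apply/val_inj.
  - by rewrite mul_mx_scalar scalerA mulfV// scale1r.
  - by rewrite -scalemxAl addrCA subrr addr0.
have := Au; rewrite AE unitmx_mul => /andP[_].
rewrite unitmxE (@det_ublock _ 1 n) unitrM => /andP[_ uB].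
apply: scalesM.
  by apply: scales_lblock => //; exact: oner_neq0.
by apply: scales_ublock => //; exact: IH.
Qed.

Lemma lebesgue_rV_affine n (A : 'M[R]_n) b (B : set 'rV[R]_n) :
  A \in unitmx -> measurable B ->
  `|\det A|%:E * leb n (affine_map A b @^-1` B) = leb n B.
Proof.
move=> Au; suff : scales A by exact.
elim: n A Au {b B} => [|n IH] A Au.
  by rewrite (_ : A = 1%:M); [exact: scales1|rewrite [A]thinmx0 [1%:M]thinmx0].
have [A0|] := eqVneq (A ord0 ord0) 0%R; last by move=> ?; exact: scales_pivot.
have [i ci] : exists i, A (lift ord0 i) ord0 != 0%R.
  apply/existsP; rewrite -negb_forall; apply/negP => /forallP A'0.
  move: Au; rewrite unitmxE (expand_det_col _ ord0) big1 ?unitr0// => j _.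
  case: (unliftP ord0 j) => [k|] ->; last by rewrite A0 mul0r.
  by rewrite (eqP (A'0 k)) mul0r.
(* [E 1] adds row [lift ord0 i] to row 0 and thereby creates a nonzero pivot; [E (-1)] undoes
   this. *)
pose E (s : R) := @block_mx _ 1 n 1 n 1%:M (s *: delta_mx ord0 i) 0%R 1%:M.
have EE : E (-1)%R *m E 1%R = 1%:M.
  rewrite /E mulmx_block !mulmx0 !mul0mx !mulmx1 !mul1mx !addr0 add0r.
  by rewrite scaleN1r scale1r subrr; exact/esym/(@scalar_mx_block _ 1 n).
have -> : A = E (-1)%R *m (E 1%R *m A) by rewrite mulmxA EE mul1mx.
apply: scalesM; first by apply: scales_ublock; [exact: oner_neq0|exact: scales1].
apply: scales_pivot => //; last first.
  rewrite unitmx_mul Au andbT unitmxE (@det_ublock _ 1 n) !det1 mulr1.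
  exact: unitr1.
rewrite /E scale1r -[A](@submxK _ 1 n 1 n) (@mulmx_block _ 1 n 1 n 1 n).
have ulE (M : 'M[R]_n.+1) : M ord0 ord0 = @ulsubmx _ 1 n 1 n M ord0 ord0.
  by rewrite !mxE; congr (M _ _); exact/val_inj.
rewrite ulE (@block_mxKul _ 1 n 1 n) mxE mul1mx -rowE -ulE A0 add0r !mxE.
rewrite (_ : A _ _ = A (lift ord0 i) ord0)//.
by congr (A _ _); exact/val_inj.
Qed.

Lemma ge0_integral_affine n (A : 'M[R]_n) b (f : 'rV[R]_n -> \bar R) :
  A \in unitmx -> measurable_fun setT f -> (forall x, 0 <= f x) ->
  `|\det A|%:E * \int[leb n]_x f (affine_map A b x) = \int[leb n]_x f x.
Proof.
by move=> Au; apply: scales_integral => c B mB; exact: lebesgue_rV_affine.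
Qed.

(** Induction on the dimension: if the first coefficient vanishes, the slices are hyperplanes of one
    dimension less; otherwise the lines along the first axis meet the set in a single point. *)
Lemma lebesgue_rV_hyperplane n (a : 'cV[R]_n) (c : R) : a != 0%R ->
  leb n [set w | (w *m a) ord0 ord0 = c] = 0.
Proof.
have mH m (a' : 'cV[R]_m) (c' : R) :
    measurable [set w : 'rV[R]_m | (w *m a') ord0 ord0 = c'].
  rewrite (_ : [set _ | _] =
      (fun w : 'rV[R]_m => (w *m a')%R ord0 ord0) @^-1` [set c'])//.
  rewrite -[X in measurable X]setTI.
  by apply: continuous_measurable_rV => //; exact: continuous_linear_form.
elim: n a c => [|n IH] a c; first by rewrite [a]flatmx0 eqxx.
have aE : a = @col_mx _ 1 n 1 (@usubmx _ 1 n 1 a) (@dsubmx _ 1 n 1 a).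
  by rewrite vsubmxK.
have HE x v : (rV_cons (x, v) *m a) ord0 ord0 =
    (x * a ord0 ord0 + (v *m @dsubmx _ 1 n 1 a) ord0 ord0)%R.
  rewrite {1}aE /rV_cons (@mul_row_col _ 1 1 n) !mxE big_ord1 !mxE mulr1n.
  by congr (_ * a _ _ + _)%R; apply/val_inj.
have [a0|a0] := eqVneq (a ord0 ord0) 0%R => an0.
  rewrite lebesgue_rVS_xsection//; apply: integral0_eq => x _.
  rewrite (_ : [set _ | _] =
      [set v : 'rV[R]_n | (v *m @dsubmx _ 1 n 1 a) ord0 ord0 = c]).
    apply: IH; apply: contraNneq an0 => d0; rewrite aE d0.
    apply/eqP/colP => i; rewrite !mxE; case: splitP => j _; rewrite !mxE//.
    by rewrite (ord1 j) -[RHS]a0; congr (a _ _); apply/val_inj.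
  by apply/seteqP; split => v /=; rewrite HE a0 mulr0 add0r.
rewrite lebesgue_rVS_ysection//; apply: integral0_eq => v _.
rewrite (_ : [set _ | _] =
  [set (c - (v *m @dsubmx _ 1 n 1 a) ord0 ord0) / a ord0 ord0]%R).
  exact: lebesgue_measure_set1.
apply/seteqP; split => x /=; rewrite HE.
  by move=> <-; rewrite addrK mulfK.
by move=> ->; rewrite divfK// subrK.
Qed.

Lemma lebesgue_rV_bounded n (A : set 'rV[R]_n) (M : R) : measurable A ->
  (forall x, A x -> forall i, `|x ord0 i| <= M)%R -> leb n A < +oo.
Proof.
move=> mA AM.
apply: (@le_lt_trans _ _ (leb n (rV_box (const_mx (- `|M|)) (const_mx `|M|))%R)).
  apply: le_measure; rewrite ?inE//; first exact: measurable_rV_box.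
  move=> x Ax i; rewrite !mxE -ler_norml.
  exact: (le_trans (AM x Ax i) (ler_norm _)).
rewrite lebesgue_rV_box ?ltry// => i; rewrite !mxE.
by rewrite (@le_trans _ _ 0%R)// oppr_le0.
Qed.

End affine_change_of_variables.

(** * Integrals and null sets, without measurability of the integrand *)

Section null_sets.
Import HBNNSimple.
Context d (T : measurableType d) (R : realType).
Variable mu : {measure set T -> \bar R}.
Local Open Scope ereal_scope.

(** A simple function below [f] can be cut off to the complement of [N]: its integral is unchanged
    and it lies below the restricted function. *)
Let nnintegral_setC_null (N : set T) (f : T -> \bar R) :
  measurable N -> mu N = 0 -> (forall x, 0 <= f x) ->
  \int[mu]_x f x = \int[mu]_x (f \_ (~` N)) x.
Proof.
move=> mN N0 f0.
have fN0 x : 0 <= (f \_ (~` N)) x by rewrite patchE; case: ifPn.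
apply/eqP; rewrite eq_le; apply/andP; split; last first.
  rewrite !ge0_integralTE//; apply: ge_ereal_sup => _ [g /= gf <-].
  apply: ereal_sup_ubound; exists g => // x.
  by apply: (le_trans (gf x)); rewrite patchE; case: ifPn.
rewrite !ge0_integralTE//; apply: ge_ereal_sup => _ [g /= gf <-].
have mNc := measurableC mN.
apply: (@le_trans _ _ (sintegral mu (proj_nnsfun g mNc))); last first.
  apply: ereal_sup_ubound; exists (proj_nnsfun g mNc) => // x; rewrite /= mindicE 1!patchE.
  have := gf x.
  by case: ifP => xN; rewrite ?mulr1 ?mulr0 ?lexx// => _; rewrite lexx.
rewrite -!integralT_nnsfun.
rewrite (@ge0_negligible_integral _ _ _ mu setT N)//; last 2 first.
  by apply/measurable_EFinP.
  by move=> x _; rewrite lee_fin.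
rewrite [leRHS](@ge0_negligible_integral _ _ _ mu setT N)//; last 2 first.
  by apply/measurable_EFinP.
  by move=> x _; rewrite lee_fin.
rewrite le_eqVlt; apply/orP; left; apply/eqP; apply: eq_integral => x.
by rewrite inE => -[_ Nx]; rewrite /= mindicE mem_set// mulr1.
Qed.

Lemma integral_setD_null (D N : set T) (f : T -> \bar R) :
  measurable N -> mu N = 0 ->
  \int[mu]_(x in D) f x = \int[mu]_(x in D `\` N) f x.
Proof.
move=> mN N0; rewrite integralE [RHS]integralE.
by congr (_ - _); rewrite integral_mkcond [RHS]integral_mkcond
  (nnintegral_setC_null mN)//; try (by move=> x; rewrite patchE; case: ifPn);
  apply: eq_integral => x _; rewrite !patchE setDE in_setI;
  case: (x \in D); case: (x \in ~` N).
Qed.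

(* Neither [D] nor the integrands need be measurable, because the integral is
   defined as a supremum over simple functions. *)
Lemma eq_integral_off_null (D N : set T) (f g : T -> \bar R) :
  measurable N -> mu N = 0 -> (forall x, D x -> ~ N x -> f x = g x) ->
  \int[mu]_(x in D) f x = \int[mu]_(x in D) g x.
Proof.
move=> mN N0 fg; rewrite (integral_setD_null _ _ mN N0).
rewrite [RHS](integral_setD_null _ _ mN N0); apply: eq_integral => x.
by rewrite inE => -[Dx Nx]; exact: fg.
Qed.

Lemma null_bigcup_fin (I : finType) (F : I -> set T) :
  (forall i, measurable (F i) /\ mu (F i) = 0) ->
  measurable (\bigcup_(i in [set: I]) F i) /\
  mu (\bigcup_(i in [set: I]) F i) = 0.
Proof.
move=> F0; have -> : \bigcup_(i in [set: I]) F i =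
    \big[setU/set0]_(i <- index_enum I) F i.
  rewrite -bigcup_seq; apply: eq_bigcupl; split=> i //= _; exact: mem_index_enum.
apply: (big_ind (fun A : set T => measurable A /\ mu A = 0)) => //.
move=> A B [mA A0] [mB B0]; split; first exact: measurableU.
by rewrite measureU0.
Qed.

End null_sets.

(** * Continuous functions on bounded sets *)

Section continuous_integrable.
Variable R : realType.
Local Notation leb := (lebesgue_rV R).

Lemma rV_norm_le n (x : 'rV[R]_n) (M : R) : 0 <= M ->
  (`|x| <= M) <-> (forall i, `|x ord0 i| <= M).
Proof.
move=> M0; rewrite [`|x|]mx_normrE; split => [/bigmax_leP[_ H] i|H].
  exact: (H (ord0, i) isT).
by apply/bigmax_leP; split => // -[i j] _ /=; rewrite (ord1 i).
Qed.

Lemma rV_norm_coord n (x : 'rV[R]_n) i : `|x ord0 i| <= `|x|.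
Proof. by have [H _] := rV_norm_le x (normr_ge0 x); exact: H. Qed.

Lemma continuous_bounded_image n (A : set 'rV[R]_n) (f : 'rV[R]_n -> R) :
  bounded_set A -> continuous f -> [bounded f x | x in A].
Proof.
move=> [M [_ AM]] fc.
have cB : compact [set x : 'rV[R]_n | `|x| <= `|M| + 1].
  apply: bounded_closed_compact.
    exists (`|M| + 1); split; first by rewrite num_real.
    by move=> y My x /= /le_trans; apply; exact: ltW.
  rewrite (_ : [set _ | _] =
      (fun x : 'rV[R]_n => `|x|) @^-1` [set x | x <= `|M| + 1])//.
  by apply: preimage_closed; [move=> x _; exact: norm_continuous|exact: closed_le].
have /compact_bounded[N [_ HN]] : compact (f @` [set x | `|x| <= `|M| + 1]).
  by apply: continuous_compact => //; exact: continuous_subspaceT.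
exists N; split; first by rewrite num_real.
move=> y Ny x Ax; apply: HN => //; exists x => //=; apply: AM => //.
by rewrite ltr_pwDr// ler_norm.
Qed.

Lemma bounded_set_lty n (A : set 'rV[R]_n) : measurable A -> bounded_set A ->
  (leb n A < +oo)%E.
Proof.
move=> mA [M [_ AM]]; apply: (@lebesgue_rV_bounded _ _ _ (`|M| + 1)) => //.
move=> x Ax i; apply: (le_trans (rV_norm_coord _ _)); apply: AM => //.
by rewrite ltr_pwDr// ler_norm.
Qed.

Lemma continuous_integrable n (A : set 'rV[R]_n) (f : 'rV[R]_n -> R) :
  measurable A -> bounded_set A -> continuous f ->
  (leb n).-integrable A (EFin \o f).
Proof.
move=> mA bA fc; apply: measurable_bounded_integrable => //.
- exact: bounded_set_lty.
- by apply: measurable_funTS; exact: continuous_measurable_rV.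
- exact: continuous_bounded_image.
Qed.

(* Affine change of variables in integrals *)
End continuous_integrable.

Section integral_affine.
Variables (R : realType) (n : nat).
Local Notation leb := (lebesgue_rV R n).
Local Open Scope ereal_scope.
Implicit Types (D : set 'rV[R]_n) (A : 'M[R]_n).

Lemma measurable_affine_preimage m (A : 'M[R]_(n, m)) b (D : set 'rV[R]_m) :
  measurable D -> measurable (affine_map A b @^-1` D).
Proof.
by move=> mD; rewrite -[X in measurable X]setTI; exact: measurable_affine_map.
Qed.

Lemma ge0_integral_affine_in A b D (f : 'rV[R]_n -> \bar R) :
  A \in unitmx -> measurable D -> measurable_fun D f ->
  (forall x, D x -> 0 <= f x) ->
  `|\det A|%:E * \int[leb]_(w in affine_map A b @^-1` D) f (affine_map A b w) =
  \int[leb]_(x in D) f x.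
Proof.
move=> Au mD mf f0; rewrite [RHS]integral_mkcond -(ge0_integral_affine b Au).
- rewrite integral_mkcond; congr (_ * _); exact: eq_integral.
- by apply/(measurable_restrictT _ _).1.
- by move=> x; rewrite patchE; case: ifPn => //; rewrite inE; exact: f0.
Qed.

Lemma integral_affine A b D (f : 'rV[R]_n -> \bar R) :
  A \in unitmx -> measurable D -> leb.-integrable D f ->
  `|\det A|%:E * \int[leb]_(w in affine_map A b @^-1` D) f (affine_map A b w) =
  \int[leb]_(x in D) f x.
Proof.
move=> Au mD fi; have mf := measurable_int _ fi.
have dgt0 : (0 < `|\det A|)%R by rewrite normr_gt0 -unitfE -unitmxE.
have Ep := ge0_integral_affine_in b Au mD (measurable_funepos mf)
  (fun x _ => funepos_ge0 _ x).
have En := ge0_integral_affine_in b Au mD (measurable_funeneg mf)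
  (fun x _ => funeneg_ge0 _ x).
rewrite [RHS]integralE -Ep -En integralE.
rewrite muleBr//.
  by congr (_ * _ - _ * _); apply: eq_integral => w _; rewrite ?funeposE ?funenegE.
(* Distributing the factor over the difference requires a finite negative part; it is finite because
   [En] relates it to that of the integrable [f]. *)
apply: fin_num_adde_defl; rewrite fin_numN ge0_fin_numE; last first.
  by apply: integral_ge0 => x _; exact: funeneg_ge0.
rewrite (@eq_integral _ _ _ leb _ (fun w => f^\- (affine_map A b w))); last first.
  by move=> w _; rewrite !funenegE.
have := integral_funeneg_lt_pinfty mD fi; rewrite -En.
by rewrite -lte_pdivlMl// gt0_muley// lte_fin invr_gt0.
Qed.

End integral_affine.

Lemma coord_affine_continuous (R : realType) n m (A : 'M[R]_(n, m)) b j :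
  continuous (fun w => affine_map A b w ord0 j).
Proof.
rewrite (_ : (fun _ => _) = (fun w => (w *m col j A) ord0 ord0 + b ord0 j)).
  move=> w; apply: continuousD; last exact: cst_continuous.
  exact: continuous_linear_form.
by apply/funext => w; rewrite !mxE; congr (_ + _); apply: eq_bigr => i _;
  rewrite !mxE.
Qed.

(** * Barycentric coordinates, faces and affine interpolation on a simplex *)

Section barycentric.
Variables (R : realType) (d : nat).
Local Notation leb := (lebesgue_rV R d).
Implicit Types (p : 'I_d.+1 -> 'rV[R]_d) (w x : 'rV[R]_d).

(** Rows [(1, p i)]. The coordinates of [(1, w)] in this basis are the barycentric coordinates of
    [w]: the leading 1 encodes that the weights sum to 1. *)
Definition vertex_mx p : 'M[R]_(1 + d) :=
  \matrix_(i < 1 + d) row_mx (1%:M : 'rV_1) (p i).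

Definition bary p w : 'I_d.+1 -> R :=
  fun i => (row_mx (1%:M : 'rV_1) w *m invmx (vertex_mx p)) ord0 i.

Definition interp m p (f : 'I_d.+1 -> 'rV[R]_m) w : 'rV[R]_m :=
  \sum_i bary p w i *: f i.

(** Acts on [(1, w)]: the first row is the translation of the interpolant, the remaining rows are
    its linear part. *)
Definition interp_mx m p (f : 'I_d.+1 -> 'rV[R]_m) : 'M[R]_(1 + d, m) :=
  invmx (vertex_mx p) *m \matrix_(i < 1 + d) f i.

Lemma interp_affine m p (f : 'I_d.+1 -> 'rV[R]_m) w :
  interp p f w = affine_map (dsubmx (interp_mx p f)) (usubmx (interp_mx p f)) w.
Proof.
rewrite /affine_map /interp addrC -[usubmx _]mul1mx -mul_row_col vsubmxK.
rewrite /interp_mx mulmxA mulmx_sum_row; apply: eq_bigr => i _.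
by rewrite rowK.
Qed.

Lemma continuous_bary p i : continuous (fun w => bary p w i).
Proof.
rewrite (_ : (fun _ => _) = (fun w => interp p (fun j => (i == j)%:R%:M) w
  ord0 (ord0 : 'I_1))); last first.
  apply/funext => w; rewrite /interp summxE (bigD1 i)//= !mxE eqxx mulr1.
  rewrite big1 ?addr0// => j /negbTE ji.
  by rewrite !mxE eq_sym ji mul0rn mulr0.
under [X in continuous X]funext do rewrite interp_affine.
exact: coord_affine_continuous.
Qed.

Lemma bary_linear p i w : bary p w i =
  (w *m @dsubmx _ 1 d 1 (col i (invmx (vertex_mx p)))) ord0 ord0 +
  invmx (vertex_mx p) ord0 i.
Proof.
rewrite /bary -[X in row_mx _ _ *m X](@vsubmxK _ 1 d _) mul_row_col mul1mx.
rewrite mxE addrC !mxE; congr (_ + _); last by congr (invmx _ _ _); exact/val_inj.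
by apply: eq_bigr => j _; rewrite !mxE.
Qed.

Lemma affine_map_comb (I : finType) n m (A : 'M[R]_(n, m)) b (c : I -> R)
    (y : I -> 'rV[R]_n) : \sum_i c i = 1 ->
  affine_map A b (\sum_i c i *: y i) = \sum_i c i *: affine_map A b (y i).
Proof.
move=> c1; rewrite /affine_map mulmx_suml -[b in LHS]scale1r -c1 scaler_suml.
by rewrite -big_split; apply: eq_bigr => i _; rewrite scalerDr scalemxAl.
Qed.

Lemma interp_comb (I : finType) m p (f : 'I_d.+1 -> 'rV[R]_m) (c : I -> R)
    (y : I -> 'rV[R]_d) : \sum_i c i = 1 ->
  interp p f (\sum_i c i *: y i) = \sum_i c i *: interp p f (y i).
Proof.
move=> c1; rewrite interp_affine affine_map_comb//.
by apply: eq_bigr => i _; rewrite interp_affine.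
Qed.

Lemma bary_comb (I : finType) p (c : I -> R) (y : I -> 'rV[R]_d) j :
  \sum_i c i = 1 ->
  bary p (\sum_i c i *: y i) j = \sum_i c i * bary p (y i) j.
Proof.
move=> c1; rewrite bary_linear mulmx_suml summxE -[X in _ + X]mul1r -c1 mulr_suml.
rewrite -big_split; apply: eq_bigr => i _ /=.
by rewrite bary_linear mulrDr -scalemxAl !mxE.
Qed.

Section independent.
Variable p : 'I_d.+1 -> 'rV[R]_d.
Hypothesis ip : affinely_independent p.

Let row_vertex (c : 'rV[R]_(1 + d)) :
  c *m vertex_mx p = row_mx (\sum_i c ord0 i)%:M (\sum_i c ord0 i *: p i).
Proof.
rewrite mulmx_sum_row; under eq_bigr do rewrite rowK scale_row_mx scalemx1.
apply/rowP => j; rewrite summxE; case: (split_ordP j) => k ->.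
  under eq_bigr do rewrite row_mxEl.
  by rewrite row_mxEl (ord1 k) !mxE; apply: eq_bigr => i _; rewrite !mxE.
under eq_bigr do rewrite row_mxEr.
by rewrite row_mxEr summxE.
Qed.

Lemma vertex_mx_unit : vertex_mx p \in unitmx.
Proof.
rewrite -row_free_unit -kermx_eq0; apply/rowV0P => c /sub_kermxP.
rewrite row_vertex -[X in _ = X](@row_mx0 _ 1 1 d) => /eq_row_mx[/matrixP s0 s1].
apply/rowP => i; rewrite mxE; apply: (ip _ s1).
by have := s0 ord0 ord0; rewrite !mxE eqxx mulr1n.
Qed.

Let baryE w : row_mx (\sum_i bary p w i)%:M (\sum_i bary p w i *: p i) =
  row_mx (1%:M : 'rV_1) w.
Proof. by rewrite -row_vertex mulmxKV// vertex_mx_unit. Qed.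

Lemma sum_bary w : \sum_i bary p w i = 1.
Proof.
have /eq_row_mx[/matrixP /(_ ord0 ord0) + _] := baryE w.
by rewrite !mxE eqxx !mulr1n.
Qed.

Lemma bary_combination w : \sum_i bary p w i *: p i = w.
Proof. by have /eq_row_mx[] := baryE w. Qed.

Lemma bary_unique w (c : 'I_d.+1 -> R) :
  \sum_i c i = 1 -> \sum_i c i *: p i = w -> c =1 bary p w.
Proof.
move=> c1 cw i; pose C : 'rV[R]_(1 + d) := \row_j c j.
have CE : C *m vertex_mx p = row_mx (1%:M : 'rV_1) w.
  rewrite row_vertex; apply: (congr2 (@row_mx R 1 1 d)).
    by congr (_%:M); rewrite -c1; apply: eq_bigr => j _; rewrite mxE.
  by rewrite -cw; apply: eq_bigr => j _; rewrite mxE.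
by rewrite /bary -CE mulmxK ?vertex_mx_unit// mxE.
Qed.

Lemma bary_vertex i j : bary p (p i) j = (i == j)%:R.
Proof.
apply/esym/(bary_unique (w := p i) (c := fun j => (i == j)%:R)).
  by rewrite (bigD1 i)//= eqxx big1 ?addr0// => k /negbTE; rewrite eq_sym => ->.
rewrite (bigD1 i)//= eqxx scale1r big1 ?addr0// => k /negbTE.
by rewrite eq_sym => ->; rewrite scale0r.
Qed.

Lemma interp_vertex m (f : 'I_d.+1 -> 'rV[R]_m) i : interp p f (p i) = f i.
Proof.
rewrite /interp (bigD1 i)//= bary_vertex eqxx scale1r big1 ?addr0// => k.
by rewrite bary_vertex eq_sym => /negbTE ->; rewrite scale0r.
Qed.

Lemma faceP (I : {set 'I_d.+1}) w : face p I w <->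
  (forall i, 0 <= bary p w i) /\ (forall i, i \notin I -> bary p w i = 0).
Proof.
split=> [[c [c0 cI c1 wE]]|[b0 bI]].
  have cE := bary_unique c1 (esym wE).
  by split=> i; rewrite -cE; [exact: c0|exact: cI].
by exists (bary p w); split; rewrite ?sum_bary ?bary_combination.
Qed.

Lemma simplexP w : simplex p w <-> forall i, 0 <= bary p w i.
Proof.
rewrite /simplex faceP; split=> [[]//|b0]; split => // i.
by rewrite inE.
Qed.

Definition open_simplex : set 'rV[R]_d := [set w | forall i, 0 < bary p w i].

Lemma open_simplexW : open_simplex `<=` simplex p.
Proof. by move=> w wp; apply/simplexP => i; exact/ltW/wp. Qed.

Lemma open_open_simplex : open open_simplex.
Proof.
rewrite openE => w wp.
suff : \forall x \near w, forall i, 0 < bary p x i by [].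
have := @filter_forall _ _ (fun i (x : 'rV[R]_d) => 0 < bary p x i) (nbhs w).
apply => i.
have : open ((fun w => bary p w i) @^-1` [set x | 0 < x]).
  by have /continuousP := @continuous_bary p i; apply; exact: open_gt.
by rewrite openE; apply; exact: wp.
Qed.

Lemma closed_simplex : closed (simplex p).
Proof.
rewrite (_ : simplex p =
    \bigcap_(i in [set: 'I_d.+1]) ((fun w => bary p w i) @^-1` [set x | 0 <= x])).
  apply: closed_bigI => i _.
  have /continuous_closedP := @continuous_bary p i; apply; exact: closed_ge.
apply/seteqP; split => w; first by move/simplexP => H i _; exact: H.
by move=> H; apply/simplexP => i; exact: H.
Qed.

Lemma bounded_simplex : bounded_set (simplex p).
Proof.
exists (\sum_i `|p i|); split; first by rewrite num_real.
move=> M pM x /simplexP x0; apply: le_trans (ltW pM).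
rewrite -(bary_combination x); apply: (le_trans (ler_norm_sum _ _ _)).
apply: ler_sum => i _; rewrite normrZ ler_piMl// ger0_norm//.
rewrite -(sum_bary x) (bigD1 i)//= lerDl sumr_ge0// => j _; exact: x0.
Qed.

Lemma measurable_bary0 i : measurable [set w | bary p w i = 0].
Proof.
rewrite (_ : [set _ | _] = (fun w => bary p w i) @^-1` [set 0])//.
rewrite -[X in measurable X]setTI.
by apply: continuous_measurable_rV => //; exact: continuous_bary.
Qed.

Lemma measurable_simplex : measurable (simplex p).
Proof.
rewrite -[simplex p]setCK; apply: measurableC; apply: open_measurable_mx.
by rewrite openC; exact: closed_simplex.
Qed.

Lemma measurable_open_simplex : measurable open_simplex.
Proof. by apply: open_measurable_mx; exact: open_open_simplex. Qed.

Lemma bounded_open_simplex : bounded_set open_simplex.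
Proof.
have [M [Mr HM]] := bounded_simplex; exists M; split => // N MN x /open_simplexW.
exact: HM.
Qed.

Hypothesis d_gt0 : (0 < d)%N.

Lemma lebesgue_rV_bary0 i : leb [set w | bary p w i = 0] = 0%E.
Proof.
pose a := @dsubmx _ 1 d 1 (col i (invmx (vertex_mx p))).
rewrite (_ : [set _ | _] = [set w | (w *m a) ord0 ord0 =
    - invmx (vertex_mx p) ord0 i]); last first.
  apply/seteqP; split => w /=; rewrite bary_linear; last by move=> ->; rewrite addNr.
  by move/eqP; rewrite addr_eq0 => /eqP.
apply: lebesgue_rV_hyperplane; apply/eqP => a0.
have E w w' : bary p w i = bary p w' i.
  by rewrite !bary_linear -/a a0 !mulmx0 !mxE.
(* As [d > 0] there is a second vertex; without a linear part the coordinate would take the values 1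
   at [p i] and 0 at [p j] at once. *)
have [j ji] : exists j, j != i.
  have [->|] := eqVneq i ord0; last by rewrite eq_sym; exists ord0.
  by exists (inord 1); rewrite -val_eqE /= inordK.
have := E (p j) (p i); rewrite !bary_vertex eqxx (negbTE ji) => /esym/eqP.
by rewrite oner_eq0.
Qed.

Lemma lebesgue_rV_boundary : leb (simplex p `\` open_simplex) = 0%E.
Proof.
have [mU U0] := null_bigcup_fin
  (fun i => conj (measurable_bary0 i) (lebesgue_rV_bary0 i)).
apply: (subset_measure0 _ mU _ U0).
  by apply: measurableD; [exact: measurable_simplex|exact: measurable_open_simplex].
move=> w [/simplexP w0 /existsNP[i wi]]; exists i => //=.
by apply/eqP; move: wi; rewrite lt0r w0 andbT => /negP; rewrite negbK.
Qed.

End independent.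

(** Extremality of vertices: a vertex that is a convex combination of points of its simplex
    coincides with every point that has positive weight. *)
Lemma face_vertex_sub p q (I J : {set 'I_d.+1}) :
  affinely_independent p -> affinely_independent q ->
  face p I = face q J -> forall i, i \in I -> exists2 j, j \in J & p i = q j.
Proof.
move=> ip iq pq i iI.
have pi : face p I (p i).
  apply/(faceP ip); split=> j; rewrite bary_vertex ?ler0n// => jI.
  by rewrite (_ : i == j = false)//; apply: contraNF jI => /eqP <-.
have := pi; rewrite pq => /(faceP iq)[b0 bJ].
have qj j : j \in J -> face p I (q j).
  move=> jJ; rewrite pq; apply/(faceP iq); split=> k.
    by rewrite bary_vertex.
  move=> kJ; rewrite bary_vertex//.
  by rewrite (_ : j == k = false)//; apply: contraNF kJ => /eqP <-.
(* The weights of [p i] in [q] average [bary p _ i <= 1] to [1]. *)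
have E : \sum_j bary q (p i) j * (1 - bary p (q j) i) = 0.
  under eq_bigr do rewrite mulrBr mulr1.
  rewrite sumrB sum_bary//.
  rewrite -(bary_comb p _ _ (sum_bary iq _)) bary_combination//.
  by rewrite bary_vertex// eqxx subrr.
have b1 j : j \in J -> bary p (q j) i <= 1.
  move=> /qj/(faceP ip)[q0 _]; rewrite -(sum_bary ip (q j)) (bigD1 i)//=.
  by rewrite lerDl sumr_ge0.
have [j jJ bj] : exists2 j, j \in J & bary q (p i) j != 0.
  apply: contrapT => nj.
  have := sum_bary iq (p i); rewrite big1 => [/esym/eqP|j _]; first by rewrite oner_eq0.
  have [jJ|/bJ//] := boolP (j \in J).
  by apply/eqP; apply: contra_notT nj => bj; exists j.
exists j => //.
have terms0 k : 0 <= bary q (p i) k * (1 - bary p (q k) i).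
  have [kJ|/bJ ->] := boolP (k \in J); last by rewrite mul0r.
  by rewrite mulr_ge0// subr_ge0 b1.
move: E => /eqP; rewrite psumr_eq0// => /allP /(_ j (mem_index_enum _)) /=.
rewrite mulf_eq0 (negbTE bj) subr_eq0 /= => /eqP bij.
(* The [i]-th coordinate of [q j] is 1, so the others, being nonnegative with sum 0, all vanish. *)
rewrite -(bary_combination ip (q j)) (bigD1 i)//= -bij scale1r big1 ?addr0// => k ki.
have /(faceP ip)[q0 _] := qj _ jJ.
have : \sum_(l | l != i) bary p (q j) l = 0.
  have := sum_bary ip (q j); rewrite (bigD1 i)//= -bij => /(canRL (addKr _)).
  by rewrite addNr.
move/eqP; rewrite psumr_eq0// => /allP /(_ k (mem_index_enum _)).
by rewrite ki /= => /eqP ->; rewrite scale0r.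
Qed.

Lemma vertex_inj p : affinely_independent p -> injective p.
Proof.
move=> ip i j pij; have := bary_vertex ip i i; rewrite {1}pij bary_vertex// eqxx.
by case: eqVneq => // _ /esym/eqP; rewrite oner_eq0.
Qed.

(** On a face only the vertices of that face have nonzero weight, and they are vertices of both
    simplices. This is what makes piecewise interpolation continuous. *)
Lemma interp_face_eq m p q (I J : {set 'I_d.+1}) (f : 'rV[R]_d -> 'rV[R]_m) w :
  affinely_independent p -> affinely_independent q ->
  face p I = face q J -> face p I w ->
  interp p (f \o p) w = interp q (f \o q) w.
Proof.
move=> ip iq pq pw.
have [_ bI] := (faceP ip I w).1 pw.
rewrite -[in RHS](bary_combination ip w) interp_comb ?sum_bary//.
apply: eq_bigr => i _; have [iI|/bI ->] := boolP (i \in I); last by rewrite !scale0r.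
by have [j _ pij] := face_vertex_sub ip iq pq iI; rewrite /= pij interp_vertex.
Qed.

End barycentric.

(** * Functions given piecewise on a finite disjoint family *)

Section piecewise.
Context d (T : measurableType d) (R : realType).
Variable mu : {measure set T -> \bar R}.
Variables (I : finType) (E : I -> set T).

(** Written as a sum so that measurability and integrability pass from the terms; when the [E i] are
    disjoint, at most one term is nonzero. *)
Definition pw (g : I -> T -> R) (x : T) : R := \sum_i (g i \_ (E i)) x.

Lemma pw_out g x : (forall i, ~ E i x) -> pw g x = 0.
Proof. by move=> Ex; rewrite /pw big1// => i _; rewrite patchE memNset. Qed.

Lemma pw_in g i x : trivIset setT E -> E i x -> pw g x = g i x.
Proof.
move=> tE Eix; rewrite /pw (bigD1 i)//= patchE mem_set// big1 ?addr0// => j ji.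
rewrite patchE memNset// => Ejx; move/eqP: ji; apply.
by apply: tE => //; exists x.
Qed.

Lemma pw_comp (phi : R -> R) g x : phi 0 = 0 -> trivIset setT E ->
  phi (pw g x) = pw (fun i => phi \o g i) x.
Proof.
move=> phi0 tE; have [[i Ei]|nE] := pselect (exists i, E i x).
  by rewrite !(pw_in _ tE Ei).
by rewrite !pw_out// => i Ei; apply: nE; exists i.
Qed.

Lemma pw_ge0 g x : (forall i, E i x -> 0 <= g i x) -> 0 <= pw g x.
Proof.
move=> g0; apply: sumr_ge0 => i _; rewrite patchE; case: ifPn => //.
by rewrite inE; exact: g0.
Qed.

Hypothesis mE : forall i, measurable (E i).

Let patch_integrable (g : I -> T -> R) i :
  mu.-integrable (E i) (EFin \o g i) ->
  mu.-integrable setT (EFin \o (g i \_ (E i))).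
Proof.
by move=> /(integrable_mkcond _ (mE i)); rewrite restrict_EFin.
Qed.

Lemma integrable_pw g : (forall i, mu.-integrable (E i) (EFin \o g i)) ->
  mu.-integrable setT (EFin \o pw g).
Proof.
move=> gi; rewrite (_ : _ \o _ =
    fun x => (\sum_(i <- index_enum I) (EFin \o (g i \_ (E i))) x)%E).
  by apply: integrable_sum => // i _; exact: patch_integrable.
by apply/funext => x; rewrite /= /pw sumEFin.
Qed.

Lemma integral_pw g : (forall i, mu.-integrable (E i) (EFin \o g i)) ->
  (\int[mu]_x (pw g x)%:E)%E = (\sum_i \int[mu]_(x in E i) g i x)%:E.
Proof.
move=> gi; under eq_integral do rewrite /pw -sumEFin.
rewrite (@integral_sum _ _ _ _ _ _ _ (fun i => EFin \o (g i \_ (E i))))//; last first.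
  by move=> i; exact: patch_integrable.
rewrite -sumEFin; apply: eq_bigr => i _.
rewrite -restrict_EFin -integral_mkcond fineK//.
exact: integrable_fin_num.
Qed.

Lemma integral_pw_on (D : set T) (F : T -> R) g :
  (forall i, mu.-integrable (E i) (EFin \o g i)) ->
  trivIset setT E ->
  D = \bigcup_(i in [set: I]) E i ->
  (forall i x, E i x -> F x = g i x) ->
  (\int[mu]_(x in D) (F x)%:E)%E = (\sum_i \int[mu]_(x in E i) g i x)%:E.
Proof.
move=> gi tE DE FE; rewrite -integral_pw// integral_mkcond.
apply: eq_integral => x _; rewrite restrict_EFin; congr EFin; rewrite patchE.
case: ifPn => [|/negP]; rewrite DE inE.
  by move=> [i _ Ei]; rewrite (pw_in _ tE Ei) (FE i).
move=> nE.
by rewrite pw_out// => i Ei; apply: nE; exists i.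
Qed.

End piecewise.

(** * Open cells of a simplicial decomposition *)

Section decomposition.
Variables (R : realType) (d : nat) (K : set 'rV[R]_d).
Variable S : simplicial_decomposition K.
Hypothesis d_gt0 : (0 < d)%N.
Local Notation leb := (lebesgue_rV R d).
Local Notation I := 'I_(sd_size S).
Local Notation cell := (@cell R d K S).

Definition icell (m : I) : set 'rV[R]_d := open_simplex (sd_vertex m).

Lemma icellW m : icell m `<=` cell m.
Proof. exact/open_simplexW/sd_indep. Qed.

(** A common face through an interior point of [m] is all of [m]. Its [d + 1] vertices then inject
    into the vertices of a face of [m'], so that face is all of [m'] and the two cells coincide. *)
Lemma icell_cell_disjoint m m' w : m != m' -> icell m w -> ~ cell m' w.
Proof.
move=> mm' im cm'; have [A [B [AE BE]]] := sd_common_face m m'.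
have im_indep := @sd_indep _ _ _ S m; have im'_indep := @sd_indep _ _ _ S m'.
have AT : A = [set: 'I_d.+1]%SET.
  apply/setP => i; rewrite inE; apply: contrapT => /negP iA.
  have : face (sd_vertex m) A w by rewrite -AE; split => //; exact: icellW.
  move=> /(faceP im_indep)[_ /(_ i)]; rewrite iA => /(_ isT) w0.
  by have := im i; rewrite w0 ltxx.
have [/eqP BT|BT] := boolP (B == [set: 'I_d.+1]%SET).
  have := sd_distinct mm'; apply.
  by rewrite AT in AE; rewrite BT in BE; exact: etrans (esym AE) BE.
have AB : face (sd_vertex m) A = face (sd_vertex m') B by rewrite -AE.
have /choice[s sP] i : exists j, j \in B /\ sd_vertex m i = sd_vertex m' j.
  have [|j] := face_vertex_sub im_indep im'_indep AB (i := i); first by rewrite AT inE.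
  by exists j.
have s_inj : injective s.
  move=> i j sij; apply: (vertex_inj im_indep).
  by rewrite (sP i).2 (sP j).2 sij.
move/negP: BT; apply; apply/eqP/setP => j; rewrite inE.
have [g _ sg] := injF_bij s_inj.
by rewrite -(sg j); exact: (sP _).1.
Qed.

Lemma trivIset_icell : trivIset setT icell.
Proof.
move=> m m' _ _ [w [im im']]; apply/eqP/negP => /negP mm'.
exact: (icell_cell_disjoint mm' im (icellW im')).
Qed.

Definition skeleton : set 'rV[R]_d :=
  \bigcup_(m in [set: I]) (cell m `\` icell m).

Lemma measurable_icell m : measurable (icell m).
Proof. exact: measurable_open_simplex. Qed.

Lemma bounded_icell m : bounded_set (icell m).
Proof. by apply: bounded_open_simplex; exact: sd_indep. Qed.

Lemma measurable_cell m : measurable (cell m).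
Proof. by apply: measurable_simplex; exact: sd_indep. Qed.

Let skeleton_null_ : measurable skeleton /\ leb skeleton = 0%E.
Proof.
apply: (null_bigcup_fin (mu := leb)) => m; split.
  by apply: measurableD; [exact: measurable_cell|exact: measurable_icell].
by apply: lebesgue_rV_boundary => //; exact: sd_indep.
Qed.

Lemma measurable_skeleton : measurable skeleton.
Proof. exact: skeleton_null_.1. Qed.

Lemma skeleton_null : leb skeleton = 0%E.
Proof. exact: skeleton_null_.2. Qed.

Lemma setD_skeleton : K `\` skeleton = \bigcup_(m in [set: I]) icell m.
Proof.
apply/seteqP; split => w.
  move=> [Kw nw]; have : (\bigcup_(m in [set: I]) cell m) w by rewrite sd_cover.
  move=> [m _ cm]; exists m => //; apply: contrapT => im.
  by apply: nw; exists m.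
move=> [m _ im]; split.
  by rewrite -(sd_cover S); exists m => //; exact: icellW.
move=> [m' _ [cm' im']]; have [mm'|mm'] := eqVneq m m'; last first.
  exact: (icell_cell_disjoint mm' im).
by apply: im'; rewrite -mm'.
Qed.

(** Each [g m] is continuous on the whole space, so its integrability on the bounded cell is
    automatic, and [F] matters only off the skeleton. *)
Lemma integral_cells (F : 'rV[R]_d -> R) (g : I -> 'rV[R]_d -> R) :
  (forall m, continuous (g m)) -> (forall m w, icell m w -> F w = g m w) ->
  (\int[leb]_(w in K) (F w)%:E)%E = (\sum_m \int[leb]_(w in icell m) g m w)%:E.
Proof.
move=> gc Fg; rewrite (integral_setD_null _ _ measurable_skeleton skeleton_null).
apply: integral_pw_on => //.
- exact: measurable_icell.
- by move=> m; apply: continuous_integrable => //;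
    [exact: measurable_icell|exact: bounded_icell].
- exact: trivIset_icell.
- exact: setD_skeleton.
Qed.

Variable rhobar : 'rV[R]_d -> R.

Definition cell_average (m : I) : R :=
  (fine (leb (cell m)))^-1 * \int[leb]_(x in cell m) rhobar x.

Lemma discrete_densityE m w : icell m w ->
  discrete_density S rhobar w = cell_average m.
Proof.
move=> im; rewrite /discrete_density; case: pickP => [m' /asboolP cm'|/(_ m)].
  have [->//|mm'] := eqVneq m m'.
  by have := icell_cell_disjoint mm' im cm'.
by move=> /negP; rewrite asboolE => /(_ (icellW im)).
Qed.

Lemma cell_average_ge0 m : (forall x, 0 <= rhobar x) -> 0 <= cell_average m.
Proof.
move=> r0; apply: mulr_ge0; last by apply: Rintegral_ge0.
by rewrite invr_ge0 fine_ge0.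
Qed.

End decomposition.

(** * Image cells and the push-forward density *)

Section affine_pieces.
Variables (R : realType) (d : nat) (K : set 'rV[R]_d).
Variable S : simplicial_decomposition K.
Hypothesis d_gt0 : (0 < d)%N.
Local Notation leb := (lebesgue_rV R d).
Local Notation I := 'I_(sd_size S).
Local Notation cell := (@cell R d K S).
Local Notation icell := (@icell R d K S).

Variables (A : I -> 'M[R]_d) (b : I -> 'rV[R]_d).

Definition ginv (m : I) : 'rV[R]_d -> 'rV[R]_d :=
  affine_map (invmx (A m)) (- (b m *m invmx (A m))).

(** The image of the open cell, written as a preimage under the inverse affine map, which makes its
    measurability immediate. *)
Definition imcell (m : I) : set 'rV[R]_d := ginv m @^-1` icell m.

Hypothesis detA : forall m, 0 < \det (A m).

Let uA m : A m \in unitmx.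
Proof. by rewrite unitmxE unitfE gt_eqF. Qed.

Lemma ginvK m : cancel (affine_map (A m) (b m)) (ginv m).
Proof. by move=> w; rewrite /ginv /affine_map mulmxDl mulmxK// addrK. Qed.

Lemma ginvKr m : cancel (ginv m) (affine_map (A m) (b m)).
Proof. by move=> w; rewrite /ginv /affine_map mulmxDl mulNmx !mulmxKV// subrK. Qed.

Lemma imcell_preimage m : affine_map (A m) (b m) @^-1` imcell m = icell m.
Proof. by apply/seteqP; split => w; rewrite /imcell /= ginvK. Qed.

Lemma measurable_imcell m : measurable (imcell m).
Proof. by apply: measurable_affine_preimage; exact: measurable_icell. Qed.

Lemma continuous_affine_map n p (B : 'M[R]_(n, p)) c : continuous (affine_map B c).
Proof. exact: continuous_affine. Qed.

Lemma bounded_imcell m : bounded_set (imcell m).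
Proof.
have : [bounded `|affine_map (A m) (b m) w| | w in icell m].
  apply: continuous_bounded_image; first exact: bounded_icell.
  move=> w; apply: continuous_comp; last exact: norm_continuous.
  exact: continuous_affine_map.
move=> [M [Mr HM]]; exists M; split => // N MN x imx.
by have := HM _ MN _ imx; rewrite /= normr_id ginvKr.
Qed.

Lemma integrable_imcell m f : continuous f ->
  leb.-integrable (imcell m) (EFin \o f).
Proof.
by apply: continuous_integrable; [exact: measurable_imcell|exact: bounded_imcell].
Qed.

Lemma integrable_icell m f : continuous f ->
  leb.-integrable (icell m) (EFin \o f).
Proof.
by apply: continuous_integrable; [exact: measurable_icell|exact: bounded_icell].
Qed.

Lemma Rintegral_imcell m f : continuous f ->
  \int[leb]_(x in imcell m) f x =
  \det (A m) * \int[leb]_(w in icell m) f (affine_map (A m) (b m) w).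
Proof.
move=> fc; rewrite /Rintegral.
rewrite -(integral_affine (b m) (uA m) (measurable_imcell m)); last exact: integrable_imcell.
rewrite imcell_preimage fineM ?gtr0_norm//.
apply: integrable_fin_num; first exact: measurable_icell.
apply: (@integrable_icell m (fun w => f (affine_map (A m) (b m) w))) => w.
by apply: continuous_comp; [exact: continuous_affine_map|exact: fc].
Qed.

Variable G : 'rV[R]_d -> 'rV[R]_d.
Hypothesis GE : forall m w, cell m w -> G w = affine_map (A m) (b m) w.
Hypothesis G_inj : set_inj K G.

Lemma cell_sub m : cell m `<=` K.
Proof. by move=> w cw; rewrite -(sd_cover S); exists m. Qed.

Lemma G_ginv m x : imcell m x -> G (ginv m x) = x.
Proof. by move=> /icellW cx; rewrite (GE cx) ginvKr. Qed.

(** Injectivity of [G] enters here: where image cells overlapped, the push-forward density would be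
    a sum of several constants. *)
Lemma trivIset_imcell : trivIset setT imcell.
Proof.
move=> m m' _ _ [x [xm xm']]; apply: trivIset_icell => //.
exists (ginv m x); split => //; rewrite (_ : ginv m x = ginv m' x)//.
apply: G_inj; rewrite ?inE; [exact/(@cell_sub m)/icellW|exact/(@cell_sub m')/icellW|].
by rewrite !G_ginv.
Qed.

Variables (r : I -> R) (rr rho : 'rV[R]_d -> R).
Hypothesis r_ge0 : forall m, 0 <= r m.
Hypothesis rrE : forall m w, icell m w -> rr w = r m.
Hypothesis rho_push : push_density K G rr rho.

Lemma pw_restrict d' (T : measurableType d') (J : finType) (E : J -> set T) g
  (D : set T) : ((pw E g : T -> R) \_ D) = pw (fun i => D `&` E i) g.
Proof.
apply/funext => x; rewrite /pw patchE; case: ifPn => xD.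
  apply: eq_bigr => i _; rewrite !patchE in_setI xD//.
by rewrite big1// => i _; rewrite patchE in_setI (negbTE xD).
Qed.

(** Both functions have the same integral over every measurable [D]: the volume of the part of an
    image cell in [D] is [det (A m)] times that of its preimage in the cell. Hence they agree almost
    everywhere. *)
Lemma push_density_pw : exists N, [/\ measurable N, leb N = 0%E &
  forall x, ~ N x -> rho x = pw imcell (fun m _ => r m / \det (A m)) x].
Proof.
have [mrho rho0 rhoE] := rho_push.
have cc (c : R) : continuous (fun _ : 'rV[R]_d => c) by exact: cst_continuous.
have : ae_eq leb setT
    (EFin \o (pw imcell (fun m _ => r m / \det (A m)))) (EFin \o rho).
  apply: integral_ae_eq => //.
  - apply: integrable_pw; first exact: measurable_imcell.
    by move=> m; exact: integrable_imcell.
  - exact/measurable_EFinP.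
  move=> D _ mD; rewrite rhoE//.
  have mDi m : measurable (D `&` imcell m).
    by apply: measurableI => //; exact: measurable_imcell.
  have mDc m : measurable (icell m `&` affine_map (A m) (b m) @^-1` D).
    by apply: measurableI; [exact: measurable_icell|exact: measurable_affine_preimage].
  rewrite integral_mkcond restrict_EFin pw_restrict integral_pw//; last first.
    move=> m; apply: (@integrableS _ _ _ _ (imcell m)) => //.
      exact: measurable_imcell.
    exact: integrable_imcell.
  rewrite (integral_setD_null _ _ (measurable_skeleton S d_gt0) (skeleton_null S d_gt0)).
  rewrite (@integral_pw_on _ _ _ _ _
      (fun m => icell m `&` affine_map (A m) (b m) @^-1` D) mDc _ _ (fun m _ => r m)).
  - congr EFin; apply: eq_bigr => m _.
    rewrite !Rintegral_cst// -mulrA; congr (_ * _).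
    have := congr1 fine (lebesgue_rV_affine (b m) (uA m) (mDi m)).
    rewrite preimage_setI imcell_preimage setIC gtr0_norm// fineM//; last first.
      rewrite ge0_fin_numE//; apply: le_lt_trans (bounded_set_lty
        (measurable_icell m) (@bounded_icell _ _ _ S m)).
      by apply: le_measure; rewrite ?inE//; exact: measurable_icell.
    move=> /(canRL (mulKf (lt0r_neq0 (detA m)))) E.
    exact: (esym E).
  - move=> m; apply: (@integrableS _ _ _ _ (icell m)) => //.
      exact: measurable_icell.
    exact: integrable_icell.
  - by apply: trivIset_setIr; exact: trivIset_icell.
  - rewrite -setIDA -setIDAC setD_skeleton// setI_bigcupl; apply: eq_bigcupr => m _.
    apply/seteqP; split => w [iw Dw]; split => //; move: Dw => /=;
      by rewrite (GE (icellW iw)).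
  - by move=> m x [im _]; exact: rrE.
move=> [N [mN N0 HN]]; exists N; split => // x Nx.
apply: contrapT => H; apply: Nx; apply: HN => /= /(_ Logic.I) [] E.
by apply: H.
Qed.

End affine_pieces.

(** * Derivatives at a point, uniform Taylor expansions, the determinant *)

Section calculus_facts.
Variable R : realType.

(** Differentiability as an error estimate without division, the form in which estimates under the
    integral sign can be inserted. *)
Lemma is_derive0P (f : R -> R) (l : R) :
  is_derive (0 : R) 1 f l <->
  (forall e, 0 < e -> \forall s \near (0 : R), `|f s - f 0 - s * l| <= e * `|s|).
Proof.
split.
  move=> /is_derive1_caratheodory[g [gE gc <-]] e e0.
  have : \forall s \near (0 : R), `|g 0 - g s| < e.
    by move/cvgrPdist_lt : gc; exact.
  apply: filterS => s gs; rewrite gE subr0 mulrC -mulrBr normrM mulrC.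
  by apply: ler_wpM2r => //; rewrite distrC ltW.
move=> fE; apply/is_derive1_caratheodory.
exists (fun s => if s == 0 then l else (f s - f 0) / s); split; last by rewrite eqxx.
  move=> z; rewrite subr0; case: eqP => [->|/eqP z0]; first by rewrite subrr mulr0.
  by rewrite divfK.
apply/cvgrPdist_le => e e0 /=; rewrite eqxx.
near=> s; case: eqP => [_|/eqP s0]; first by rewrite subrr normr0 ltW.
rewrite distrC -[l](mulKf s0) [X in _ - X]mulrC -mulrBl normrM normfV.
by rewrite ler_pdivrMr ?normr_gt0//; near: s; exact: fE.
Unshelve. all: by end_near. Qed.

Lemma is_derive_min0 (f : R -> R) (l : R) : is_derive (0 : R) 1 f l ->
  (\forall s \near (0 : R), f 0 <= f s) -> l = 0.
Proof.
move=> /is_derive0P fl fmin; apply/eqP; rewrite -normr_le0; apply/ler_addgt0Pl => e e0.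
rewrite addr0; have : \forall s \near (0 : R), `|f s - f 0 - s * l| <= e * `|s| /\ f 0 <= f s.
  by apply: filterS2 (fl _ e0) fmin.
move=> /nbhs_ballP[dl /= dl0 H].
(* A step against the sign of the slope, of half the radius on which the estimates hold. *)
pose s := - Num.sg l * (dl / 2).
have [->|l0] := eqVneq l 0; first by rewrite normr0 ltW.
have sn : `|s| = dl / 2.
  by rewrite normrM normrN normr_sg l0 mul1r ger0_norm// divr_ge0// ltW.
have sl : s * l = - (`|s| * `|l|) by rewrite sn /s mulNr mulNr mulrAC -normrEsg mulrC.
have [] := H s; first by rewrite /ball /= sub0r normrN sn ltr_pdivrMr// mulr_natr mulr2n ltrDl.
rewrite sl opprK => /(le_trans (ler_norm _)) fs f0s.
have sp : 0 < `|s| by rewrite sn divr_gt0.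
by rewrite -(ler_pM2r sp) mulrC (le_trans _ fs)// lerDr subr_ge0.
Qed.

Lemma MVT_any (f df : R -> R) (a b : R) :
  (forall x : R, is_derive x 1 f (df x)) ->
  exists c, `|c - a| <= `|b - a| /\ f b - f a = df c * (b - a).
Proof.
move=> fd; have fc x y : {within `[x, y], continuous f}.
  apply: continuous_subspaceT => z; have [dz _] := fd z.
  by apply: differentiable_continuous; exact/derivable1_diffP.
have [ab|ba] := leP a b.
  have [c + E] := MVT_segment ab (fun x _ => fd x) (fc _ _).
  rewrite in_itv /= => /andP[ac cb]; exists c; split => //.
  by rewrite !ger0_norm ?subr_ge0// lerB.
have [c + E] := MVT_segment (ltW ba) (fun x _ => fd x) (fc _ _).
rewrite in_itv /= => /andP[bc ca]; exists c; split.
  by rewrite distrC (distrC b) !ger0_norm ?subr_ge0// ?lerB// ltW.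
by rewrite -[LHS]opprB E -mulrN opprB.
Qed.

Lemma is_derive_line (X : normedModType R) (f : X -> R) (x v : X) (s : R) :
  (forall y, derivable f y v) ->
  is_derive s 1 (fun s => f (x + s *: v)) ('D_v f (x + s *: v)).
Proof.
move=> fd.
have E : (fun h : R => h^-1 *: (f (x + (h *: 1 + s) *: v) - f (x + s *: v))) =
    (fun h => h^-1 *: (f (h *: v + (x + s *: v)) - f (x + s *: v))).
  apply/funext => h; congr (_ *: (f _ - _)).
  by rewrite scalerDl [h *: 1]mulr1 addrCA addrA.
apply: DeriveDef; last by rewrite /derive /= E.
by rewrite /derivable /= E; exact: fd.
Qed.

(** The coordinates of [y] are added one at a time, with the one-dimensional mean value theorem on
    each edge, so only partial derivatives appear. *)
Lemma coord_mean_value d (f : 'rV[R]_d -> R) (x y : 'rV[R]_d) :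
  (forall i z, derivable f z (delta_mx ord0 i)) ->
  exists z : 'I_d -> 'rV[R]_d, (forall i, `|z i - x| <= `|y|) /\
    f (x + y) - f x = \sum_i y ord0 i * 'D_(delta_mx ord0 i) f (z i).
Proof.
move=> fd.
(* A staircase path from [x] to [x + y]; in the sup norm it stays within [|y|] of [x]. *)
pose X k : 'rV[R]_d := x + \row_i (if (i < k)%N then y ord0 i else 0).
have X0 : X 0%N = x by rewrite /X (_ : \row__ _ = 0) ?addr0//; apply/rowP => i; rewrite !mxE.
have Xd : X d = x + y by congr (_ + _); apply/rowP => i; rewrite !mxE ltn_ord.
have XS (i : 'I_d) : X i.+1 = X i + y ord0 i *: delta_mx ord0 i.
  rewrite /X -addrA; congr (_ + _); apply/rowP => j; rewrite !mxE eqxx /= ltnS leq_eqVlt.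
  have [<-|ji] := eqVneq j i; first by rewrite eqxx /= ltnn add0r mulr1.
  by rewrite (negbTE (_ : (j : nat) != i))//= mulr0 addr0.
have /choice[z zP] (i : 'I_d) : exists z : 'rV[R]_d, `|z - x| <= `|y| /\
    f (X i.+1) - f (X i) = y ord0 i * 'D_(delta_mx ord0 i) f z.
  have [c [cle E]] := MVT_any 0 (y ord0 i)
    (fun s => is_derive_line (X i) s (fd i)).
  exists (X i + c *: delta_mx ord0 i); split; last first.
    by rewrite XS mulrC; move: E; rewrite scale0r addr0 subr0.
  rewrite !subr0 in cle.
  have [_] := rV_norm_le (X i + c *: delta_mx ord0 i - x) (normr_ge0 y); apply => j.
  rewrite /X !mxE eqxx /= addrAC [x _ _ + _]addrC addrK.
  have [->|ji] := eqVneq j i.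
    by rewrite ltnn add0r mulr1 (le_trans cle)// rV_norm_coord.
  by rewrite mulr0 addr0; case: ifP => _; rewrite ?normr0// rV_norm_coord.
exists z; split; first by move=> i; exact: (zP i).1.
rewrite -Xd -[in f x]X0 -(telescope_sumr (fun k => f (X k)) (leq0n d)).
rewrite big_mkord; apply: eq_bigr => i _; exact: (zP i).2.
Qed.

Lemma coord_taylor1 d (f : 'rV[R]_d -> R) (x y : 'rV[R]_d) (w : R) :
  (forall i z, derivable f z (delta_mx ord0 i)) ->
  (forall i z, `|z - x| <= `|y| ->
    `|'D_(delta_mx ord0 i) f z - 'D_(delta_mx ord0 i) f x| <= w) ->
  `|f (x + y) - f x - \sum_i y ord0 i * 'D_(delta_mx ord0 i) f x| <=
    d%:R * w * `|y|.
Proof.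
move=> fd fw; have [z [zx ->]] := coord_mean_value x y fd.
rewrite -sumrB; apply: (le_trans (ler_norm_sum _ _ _)).
rewrite (_ : d%:R * _ * _ = \sum_(i < d) `|y| * w); last first.
  by rewrite sumr_const card_ord -mulr_natl; ring.
apply: ler_sum => i _; rewrite -mulrBr normrM.
by apply: ler_pM => //; [exact: rV_norm_coord|exact: fw].
Qed.

(** Only [x] is confined to [C]; the nearby point [y] may lie outside. This covers pairs of points
    across the edge of a support. *)
Lemma compact_unif (X : normedModType R) (C : set X) (g : X -> R) (e : R) :
  compact C -> continuous g -> 0 < e ->
  exists2 dl, 0 < dl & forall x y, C x -> `|y - x| < dl -> `|g y - g x| < e.
Proof.
move=> /compact_near_coveringP cC gc e0.
have : \forall dl \near 0^'+, C `<=` [set x | forall y, `|y - x| < dl -> `|g y - g x| < e].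
  apply: cC => x Cx.
  have e2 : 0 < e / 2 by rewrite divr_gt0.
  have /nbhs_ballP[r /= r0 rB] : \forall y \near x, `|g x - g y| < e / 2.
    by have /cvgrPdist_lt := gc x; exact.
  exists (ball x (r / 2), [set dl | 0 < dl < r / 2]) => /=.
    split; first by apply: nbhsx_ballx; rewrite divr_gt0.
    near=> t => /=; apply/andP; split; near: t; first exact: nbhs_right_gt.
    by apply: nbhs_right_lt; rewrite divr_gt0.
  move=> [x' dl] /= [xx' /andP[dl0 dlr]] y yx'.
  rewrite (splitr e) -(subrKA (g x)) (le_lt_trans (ler_normD _ _))// ltrD//.
    rewrite distrC; apply: rB; rewrite -ball_normE /ball_ /=.
    rewrite (splitr r) -(subrKA x') (le_lt_trans (ler_normD _ _))// ltrD//.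
      by move: xx'; rewrite -ball_normE.
    by rewrite distrC (lt_trans yx').
  apply: rB; apply: le_ball xx'; rewrite ler_pdivrMr// mulr_natr mulr2n lerDl.
  exact: ltW.
move=> H; have : \forall dl \near 0^'+, 0 < dl /\
    C `<=` [set x | forall y, `|y - x| < dl -> `|g y - g x| < e].
  by near=> t; split; near: t => //; exact: nbhs_right_gt.
move=> /filter_ex[dl [dl0 HC]]; exists dl => // x y Cx; exact: HC.
Unshelve. all: by end_near. Qed.

(** First-order expansion with gradient [g], uniform over [x] in a bounded set: what is required to
    differentiate under an integral over a cell. *)
Definition unif_diff d (f : 'rV[R]_d -> R) (g : 'I_d -> 'rV[R]_d -> R) : Prop :=
  forall M e, 0 < e -> exists2 dl, 0 < dl & forall x y : 'rV[R]_d,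
    `|x| <= M -> `|y| <= dl ->
    `|f (x + y) - f x - \sum_i y ord0 i * g i x| <= e * `|y|.

Lemma closed_ball0_compact d (M : R) : compact [set x : 'rV[R]_d | `|x| <= M].
Proof.
apply: bounded_closed_compact.
  exists M; split; first by rewrite num_real.
  by move=> y My x /= /le_trans; apply; exact: ltW.
rewrite (_ : [set _ | _] = (fun x : 'rV[R]_d => `|x|) @^-1` [set x | x <= M])//.
by apply: preimage_closed; [move=> x _; exact: norm_continuous|exact: closed_le].
Qed.

Lemma C1_unif_diff d (f : 'rV[R]_d -> R) : Ck 1 f ->
  unif_diff f (fun i => 'D_(delta_mx ord0 i) f).
Proof.
move=> [fc fd] M e e0.
have gc i : continuous ('D_(delta_mx ord0 i : 'rV[R]_d) f).
  by have [_ []] := fd (delta_mx ord0 i).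
have d1 : 0 < d%:R + 1 :> R by rewrite ltr_wpDl.
have e1 : 0 < e / (d%:R + 1) by rewrite divr_gt0.
have HC i : exists dl, 0 < dl /\ forall x y : 'rV[R]_d, `|x| <= M -> `|y - x| < dl ->
    `|'D_(delta_mx ord0 i) f y - 'D_(delta_mx ord0 i) f x| < e / (d%:R + 1).
  have [dl dl0 H] := compact_unif (@closed_ball0_compact d M) (gc i) e1.
  by exists dl.
have /choice[dl dlP] := HC.
have : \forall r \near 0^'+, forall i, r < dl i.
  have := @filter_forall _ _ (fun i (r : R) => r < dl i) (0^'+).
  by apply => i; apply: nbhs_right_lt; exact: (dlP i).1.
move=> Hr; have : \forall r \near 0^'+, 0 < r /\ forall i, r < dl i.
  by apply: filterS2 Hr (nbhs_right_gt 0).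
move=> /filter_ex[r [r0 rdl]]; exists r => // x y xM yr.
apply: (le_trans (coord_taylor1 (w := e / (d%:R + 1)) _ _)).
- by move=> i z; exact: (fd _).1.
- move=> i z zx; apply/ltW/(dlP i).2 => //.
  by apply: le_lt_trans (rdl i); exact: le_trans yr.
- apply: ler_wpM2r => //; rewrite mulrA ler_pdivrMr// mulrC.
  by apply: ler_wpM2l; [exact: ltW|rewrite lerDl].
Qed.

Lemma dotv_unif_diff d :
  unif_diff (fun x : 'rV[R]_d => dotv x x) (fun i x => 2 * x ord0 i).
Proof.
move=> M e e0; exists (e / (d%:R + 1)); first by rewrite divr_gt0// ltr_wpDl.
move=> x y _ ye; rewrite /dotv -!sumrB.
rewrite (eq_bigr (fun i => y ord0 i ^+ 2)); last first.
  by move=> i _; rewrite !mxE; ring.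
apply: (le_trans (ler_norm_sum _ _ _)).
apply: (@le_trans _ _ (\sum_(i < d) `|y| * `|y|)).
  by apply: ler_sum => i _; rewrite expr2 normrM; apply: ler_pM => //; exact: rV_norm_coord.
rewrite sumr_const card_ord -[_ *+ d]mulr_natl mulrA; apply: ler_wpM2r => //.
have := ye; rewrite ler_pdivlMr ?ltr_wpDl// mulrC => /(le_trans _); apply.
by apply: ler_wpM2r => //; rewrite lerDl.
Qed.

(** The function [det (1 + s C)] is the characteristic polynomial of [- C] with its coefficients
    reversed, so its linear coefficient is the one of degree [n - 1] there, which is the trace of
    [C]. *)
Lemma is_derive_det1 n (C : 'M[R]_n) : (0 < n)%N ->
  is_derive (0 : R) 1 (fun s => \det (1%:M + s *: C)) (\tr C).
Proof.
move=> n0; pose p := char_poly (- C).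
pose q : {poly R} := \poly_(j < n.+1) p`_(n - j).
have pE t : p.[t] = \det (t%:M + C).
  rewrite /p /char_poly -horner_evalE -det_map_mx; congr (\det _).
  apply/matrixP => i j; rewrite !mxE /= /horner_eval hornerD hornerN hornerC.
  by rewrite hornerMn hornerX opprK.
have fE : (fun s => \det (1%:M + s *: C)) = horner q.
  apply/funext => s; rewrite horner_poly.
  have [->|s0] := eqVneq s 0.
    rewrite scale0r addr0 det1 big_ord_recl expr0 mulr1 big1 ?addr0 ?subn0.
      have /monicP := char_poly_monic (- C).
      by rewrite lead_coefE size_char_poly.
    by move=> i _; rewrite /= exprS mul0r mulr0.
  have -> : 1%:M + s *: C = s *: (s^-1%:M + C).
    by rewrite scalerDr scale_scalar_mx mulfV.
  rewrite detZ -pE horner_coef size_char_poly mulr_sumr.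
  rewrite [RHS](reindex_inj rev_ord_inj); apply: eq_bigr => i _.
  have iE : (rev_ord i : nat) = (n - i)%N by rewrite /= subSS.
  have le_in : (i <= n)%N by rewrite -ltnS.
  rewrite iE subKn// mulrCA; congr (_ * _).
  by rewrite exprVn -{1}(subnK le_in) exprD mulfK// expf_neq0.
rewrite fE; have -> : \tr C = q^`().[0]; last exact: is_derive_poly.
rewrite horner_coef0 coef_deriv mulr1n coef_poly ltnS n0 subn1.
by rewrite char_poly_trace// raddfN opprK.
Qed.

End calculus_facts.

(** * Differentiation under the integral over a bounded set *)

Section Rintegral_facts.
Variables (R : realType) (d : nat).
Local Notation leb := (lebesgue_rV R d).
Implicit Types (D : set 'rV[R]_d) (f : 'rV[R]_d -> R).

Lemma Rintegral_bound D f (B : R) : measurable D -> (leb D < +oo)%E ->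
  leb.-integrable D (EFin \o f) -> (forall w, D w -> `|f w| <= B) ->
  `|\int[leb]_(w in D) f w| <= B * fine (leb D).
Proof.
move=> mD Doo fi fB; apply: (le_trans (le_normr_Rintegral mD fi)).
rewrite -Rintegral_cst//; apply: le_Rintegral => //.
  exact: integrable_norm.
apply: measurable_bounded_integrable => //; exists `|B|; split; first by rewrite num_real.
by move=> M BM x _; exact: ltW.
Qed.

Lemma bounded_setP D : bounded_set D ->
  exists2 M, 0 < M & forall w, D w -> `|w| <= M.
Proof.
move=> [M [_ HM]]; exists (`|M| + 1); first by rewrite ltr_wpDl.
by move=> w Dw; apply: HM => //; rewrite ltr_pwDr// ler_norm.
Qed.

Lemma bounded_affine_image n (A : 'M[R]_(d, n)) b D : bounded_set D ->
  exists2 M, 0 < M & forall w, D w -> `|affine_map A b w| <= M.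
Proof.
move=> bD; have : [bounded `|affine_map A b w| | w in D].
  apply: continuous_bounded_image => // w.
  by apply: continuous_comp; [exact: continuous_affine_map|exact: norm_continuous].
move=> [M [_ HM]]; exists (`|M| + 1); first by rewrite ltr_wpDl.
move=> w Dw; have := HM (`|M| + 1) _ w Dw; rewrite /= normr_id; apply.
by rewrite ltr_pwDr// ler_norm.
Qed.

Lemma is_derive_Rintegral_comp n D (A B : 'M[R]_(d, n)) a b
    (f : 'rV[R]_n -> R) (g : 'I_n -> 'rV[R]_n -> R) :
  measurable D -> bounded_set D -> continuous f -> (forall i, continuous (g i)) ->
  unif_diff f g ->
  is_derive (0 : R) 1
    (fun s => \int[leb]_(w in D) f (affine_map A a w + s *: affine_map B b w))
    (\int[leb]_(w in D) \sum_i affine_map B b w ord0 i * g i (affine_map A a w)).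
Proof.
move=> mD bD fc gc fg; apply/is_derive0P => e e0.
have [Ma Ma0 HMa] := bounded_affine_image A a bD.
have [Mb Mb0 HMb] := bounded_affine_image B b bD.
have Doo := bounded_set_lty mD bD.
have v0 : 0 <= fine (leb D) by rewrite fine_ge0.
(* The displacement is at most [|s| Mb] on [D], so integrating an error [e1 |s| Mb] gives at most
   [e |s|]; the summand 1 covers a null [D]. *)
pose e1 := e / (Mb * (fine (leb D) + 1)).
have e10 : 0 < e1 by rewrite divr_gt0// mulr_gt0// ltr_wpDl.
have [dl dl0 H] := fg Ma e1 e10.
have cont s : continuous (fun w => f (affine_map A a w + s *: affine_map B b w)).
  rewrite (_ : (fun _ => _) =
      (fun w => f (affine_map (A + s *: B) (a + s *: b) w))); last first.
    apply/funext => w; rewrite /affine_map; congr f.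
    by rewrite mulmxDr -scalemxAr scalerDr addrACA.
  move=> w; apply: continuous_comp; [exact: continuous_affine_map|exact: fc].
have contg : continuous
    (fun w => \sum_i affine_map B b w ord0 i * g i (affine_map A a w)).
  apply: continuous_sum => i w; apply: continuousM.
    exact: coord_affine_continuous.
  by apply: continuous_comp; [exact: continuous_affine_map|exact: gc].
have intf s := continuous_integrable mD bD (cont s).
have intg := continuous_integrable mD bD contg.
have intsg s : leb.-integrable D (EFin \o (fun w =>
    s * \sum_i affine_map B b w ord0 i * g i (affine_map A a w))).
  by have := integrableZl mD s intg; exact: eq_integrable.
have intd s : leb.-integrable D (EFin \o (fun w =>
    f (affine_map A a w + s *: affine_map B b w) -
    f (affine_map A a w + 0 *: affine_map B b w))).
  by have := integrableB mD (intf s) (intf 0); exact: eq_integrable.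
apply/nbhs_ballP; exists (dl / Mb); first by rewrite /= divr_gt0.
move=> s; rewrite -ball_normE /ball_ /= sub0r normrN => sdl.
rewrite -RintegralZl// -RintegralB// -RintegralB//.
apply: (le_trans (Rintegral_bound (B := e1 * (`|s| * Mb)) _ _ _ _)) => //.
  by have := integrableB mD (intd s) (intsg s); exact: eq_integrable.
  move=> w Dw; have := H (affine_map A a w) (s *: affine_map B b w) (HMa _ Dw).
  rewrite normrZ => Hw; rewrite scale0r addr0 mulr_sumr.
  under [X in _ - X]eq_bigr => i _ do rewrite mulrA.
  have sMb : `|s| * `|affine_map B b w| <= `|s| * Mb.
    by apply: ler_wpM2l => //; exact: HMb.
  have Hw' : `|s| * `|affine_map B b w| <= dl.
    by apply: (le_trans sMb); rewrite -ler_pdivlMr// ltW.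
  apply: le_trans (_ : e1 * (`|s| * `|affine_map B b w|) <= _); last first.
    by apply: ler_wpM2l => //; exact: ltW.
  have := Hw Hw'; congr (_ <= _); congr (`|_ - _|).
  by apply: eq_bigr => i _; rewrite !mxE.
have key (x : R) : 0 <= x ->
    e / (Mb * (x + 1)) * (`|s| * Mb) * x = e * `|s| * (x / (x + 1)).
  by move=> x0; field; rewrite !gt_eqF// ltr_wpDl.
rewrite /e1 key//.
rewrite -[leRHS]mulr1; apply: ler_wpM2l; first by rewrite mulr_ge0// ltW.
by rewrite ler_pdivrMr ?ltr_wpDl// mul1r lerDl.
Qed.

End Rintegral_facts.

(** * The Jacobian of a locally affine map *)

Section energy_formula.
Variable R : realType.

(** The remainder of the linear approximation vanishes identically near [w], and the differential is
    unique. *)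
Lemma jacobian_near_affine d (G : 'rV[R]_d -> 'rV[R]_d) (A : 'M[R]_d) b
    (U : set 'rV[R]_d) w : open U -> U w ->
  (forall x, U x -> G x = affine_map A b x) -> 'J G w = A.
Proof.
move=> oU Uw GE.
have dE : 'd G w = mulmxr A :> ('rV[R]_d -> 'rV[R]_d).
  apply: diff_unique.
    move=> x; have := @continuous_affine R d d A 0 x.
    by under eq_fun do rewrite addr0.
  apply/eqaddoP => e e0.
  have : \forall x \near w, U x by move: oU; rewrite openE; exact.
  move=> /nbhs_ballP[r /= r0 rU]; apply/nbhs_ballP; exists r => // x xr.
  have Uxw : U (x + w).
    apply: rU; rewrite -ball_normE /ball_ /= opprD addrCA subrr addr0.
    by move: xr; rewrite -ball_normE /ball_ /= sub0r.
  rewrite /= !fctE /= (GE _ Uxw) (GE _ Uw) /affine_map mulmxDl.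
  rewrite (_ : _ - _ = 0) ?normr0 ?mulr_ge0 ?(ltW e0)//.
  by apply/eqP; rewrite subr_eq0 -addrA addrC.
rewrite /jacobian dE; apply/row_matrixP => i.
by rewrite !rowE mul_rV_lin1.
Qed.

End energy_formula.

(** * The pressure as a derivative *)

Section entropy_density_facts.
Variables (R : realType) (h : R -> R).
Hypothesis h_ok : entropy_density h.

(** With [s] the Jacobian determinant, [s h(r / s)] is the internal energy per unit volume of the
    cell, and its slope is [h(u) - u h'(u)] at [u = r / s]. The case [r = 0] is separate because [h]
    is differentiable in the two-sided sense only at positive arguments. *)
Lemma is_derive_scaled_density (r x : R) : 0 <= r -> 0 < x ->
  is_derive x 1 (fun s => s * h (r / s)) (- pressure h (r / x)).
Proof.
rewrite le_eqVlt => /predU1P[<-|r0] x0.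
  have -> : (fun s => s * h (0 / s)) = cst 0.
    by apply/funext => s; rewrite mul0r ed_h0// mulr0.
  rewrite mul0r /pressure mul0r ed_h0// subr0 oppr0; exact: is_derive_cst.
have rx0 : 0 < r / x by rewrite divr_gt0.
have dh : is_derive (r / x) 1 h ('D_1 h (r / x)).
  by apply/derivableP; have := @ed_smooth _ _ h_ok 0 _ rx0.
have dV : is_derive x 1 (fun s : R => r * s^-1) (r * (- x ^- 2)).
  have dx : is_derive x 1 (fun s : R => s^-1) (- x ^- 2 *: 1).
    by apply: (@is_deriveV R id) => //; rewrite gt_eqF.
  by apply: is_derive_eq; rewrite [_ *: 1]mulr1.
have dc := @is_derive1_comp R h (fun s => r / s) x _ _ dh dV.
have dm := is_deriveM (is_derive_id x (1 : R)) dc.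
apply: (is_derive_eq dm); rewrite /pressure derive1E /=.
have sE (a b : R) : a *: b = a * b by [].
by rewrite !sE; field; rewrite gt_eqF.
Qed.

Lemma pressure0 : pressure h 0 = 0.
Proof. by rewrite /pressure mul0r ed_h0// subrr. Qed.

(* [P(r) = r h'(r) - h(r)] is the gap at [0] between [h] and its tangent at [r]. *)
Lemma pressure_ge0 r : 0 <= r -> 0 <= pressure h r.
Proof.
rewrite le_eqVlt => /predU1P[<-|r0]; first by rewrite pressure0.
have dh : is_derive r 1 h ('D_1 h r) by apply/derivableP; have := @ed_smooth _ _ h_ok 0 _ r0.
have da : is_derive (0 : R) 1 (fun t : R => r - t * r) (- r).
  apply/is_derive0P => e e0; apply/nbhs_ballP; exists 1 => //= t _.
  by rewrite (_ : _ - _ = 0) ?normr0 ?mulr_ge0 ?(ltW e0)//; ring.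
have dc : is_derive (0 : R) 1 (h \o (fun t : R => r - t * r)) ('D_1 h r * - r).
  by apply: is_derive1_comp; rewrite mul0r subr0.
rewrite /pressure derive1E subr_ge0; apply/ler_addgt0Pr => e e0.
have /is_derive0P/(_ e e0)/nbhs_ballP[dl /= dl0 H] := dc.
(* Small enough for the derivative estimate at 0, and at most 1 so that [r - t r] is a convex
   combination of 0 and [r]. *)
pose t := Num.min (dl / 2) 1.
have t0 : 0 < t by rewrite lt_min divr_gt0 ?ltr01.
have t1 : t <= 1 by rewrite ge_min lexx orbT.
have := H t; rewrite /ball /= sub0r normrN gtr0_norm// mul0r subr0 => Ht.
have {Ht}Ht : `|h (r - t * r) - h r - t * ('D_1 h r * - r)| <= e * t.
  by apply: Ht; rewrite /t gt_min ltr_pdivrMr// mulr_natr mulr2n ltrDl dl0.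
have hc : h (r - t * r) <= h r - t * h r.
  have := ed_convex h_ok (Itv01 (ltW t0) t1) (x := 0) (y := r).
  rewrite !inE /= !in_itv /= !andbT lexx (ltW r0) => /(_ isT isT).
  move=> hc; apply: (le_trans (le_trans _ hc)).
    rewrite le_eqVlt; apply/orP; left; apply/eqP; congr h.
    by change (r - t * r = t * 0 + (1 - t) * r); ring.
  change (t * h 0 + (1 - t) * h r <= h r - t * h r); rewrite ed_h0//.
  by rewrite mulr0 add0r mulrBl mul1r.
rewrite -(ler_pM2r t0); move: Ht; rewrite ler_norml => /andP[+ _].
lra.
Qed.

End entropy_density_facts.

(** * Energy and distance as finite sums over cells *)

Section energy_formula.
Variables (R : realType) (d : nat) (K : set 'rV[R]_d).
Variable S : simplicial_decomposition K.
Hypothesis d_gt0 : (0 < d)%N.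
Local Notation leb := (lebesgue_rV R d).
Local Notation I := 'I_(sd_size S).
Local Notation cell := (@cell R d K S).
Local Notation icell := (@icell R d K S).
Variables (h : R -> R) (V : 'rV[R]_d -> R).
Hypothesis h_ok : entropy_density h.
Hypothesis Vc : continuous V.
Variables (r : I -> R) (rr : 'rV[R]_d -> R).
Hypothesis r_ge0 : forall m, 0 <= r m.
Hypothesis rrE : forall m w, icell m w -> rr w = r m.

Definition affine_on (G : 'rV[R]_d -> 'rV[R]_d) (A : I -> 'M[R]_d) b :=
  forall m w, cell m w -> G w = affine_map (A m) (b m) w.

Lemma jacobian_icell G A b m w : affine_on G A b -> icell m w -> 'J G w = A m.
Proof.
move=> GE im; apply: (@jacobian_near_affine _ _ _ _ (b m) (icell m)) => //.
  exact: open_open_simplex.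
by move=> x /icellW; exact: GE.
Qed.

(** The form [s h(r / s)] replaces [htilde (s / r) r]; the two agree for [r = 0] as well, since
    [h 0 = 0]. *)
Definition cell_energy (A : I -> 'M[R]_d) (b : I -> 'rV[R]_d) m : R :=
  fine (leb (icell m)) * (\det (A m) * h (r m / \det (A m))) +
  r m * \int[leb]_(w in icell m) V (affine_map (A m) (b m) w).

Definition cell_dist (A B : I -> 'M[R]_d) (a b : I -> 'rV[R]_d) m : R :=
  r m * \int[leb]_(w in icell m)
    dotv (affine_map (A m - B m) (a m - b m) w)
         (affine_map (A m - B m) (a m - b m) w).

Let continuous_V_affine (c s : R) (A : 'M[R]_d) b :
  continuous (fun w => c + s * V (affine_map A b w)).
Proof.
move=> w; apply: (@continuousD _ _ _ (fun=> c)
  (fun w => s * V (affine_map A b w))); first exact: cst_continuous.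
apply: (@continuousM _ _ (fun=> s) (fun w => V (affine_map A b w))).
  exact: cst_continuous.
by apply: continuous_comp; [exact: continuous_affine_map|exact: Vc].
Qed.

Lemma energyE G A b : affine_on G A b -> (forall m, 0 < \det (A m)) ->
  energy K h V rr G = (\sum_m cell_energy A b m)%:E.
Proof.
move=> GE detA; rewrite /energy.
rewrite (integral_cells d_gt0 (S := S) (g := fun m w =>
  \det (A m) * h (r m / \det (A m)) + r m * V (affine_map (A m) (b m) w))).
- congr EFin; apply: eq_bigr => m _; rewrite RintegralD.
  + rewrite Rintegral_cst; last exact: measurable_icell.
    rewrite RintegralZl; [|exact: measurable_icell|].
      by rewrite /cell_energy mulrC.
    apply: integrable_icell => w.
    by apply: continuous_comp; [exact: continuous_affine_map|exact: Vc].
  + exact: measurable_icell.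
  + by apply: integrable_icell; exact: cst_continuous.
  + apply: integrable_icell => w; apply: continuousM; first exact: cst_continuous.
    by apply: continuous_comp; [exact: continuous_affine_map|exact: Vc].
- by move=> m; exact: continuous_V_affine.
move=> m w im; rewrite (jacobian_icell GE im) (rrE im) (GE _ _ (icellW im)).
rewrite mulrDl [V _ * _]mulrC; congr (_ + _); rewrite /htilde invf_div.
have [->|r0] := eqVneq (r m) 0; first by rewrite mulr0 mul0r ed_h0// mulr0.
by rewrite mulrAC divfK.
Qed.

Lemma continuous_dotv n : continuous (fun x : 'rV[R]_n => dotv x x).
Proof.
apply: continuous_sum => i w; apply: continuousM; exact: coord_continuous.
Qed.

Lemma dotv_ge0 n (x : 'rV[R]_n) : 0 <= dotv x x.
Proof. by apply: sumr_ge0 => i _; rewrite -expr2 sqr_ge0. Qed.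

Lemma enorm_sqr n (x : 'rV[R]_n) : enorm x ^+ 2 = dotv x x.
Proof. by rewrite /enorm sqr_sqrtr// dotv_ge0. Qed.

Lemma affine_mapB n m (A B : 'M[R]_(n, m)) a b w :
  affine_map A a w - affine_map B b w = affine_map (A - B) (a - b) w.
Proof. by rewrite /affine_map mulmxBr opprD addrACA. Qed.

Lemma distE G A a F B b : affine_on G A a -> affine_on F B b ->
  (\int[leb]_(w in K) (enorm (G w - F w) ^+ 2 * rr w)%:E)%E =
  (\sum_m cell_dist A B a b m)%:E.
Proof.
move=> GE FE; have cdot m : continuous (fun w =>
    dotv (affine_map (A m - B m) (a m - b m) w)
         (affine_map (A m - B m) (a m - b m) w)).
  move=> w; apply: (@continuous_comp _ _ _ (affine_map _ _) (fun x => dotv x x)).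
    exact: continuous_affine_map.
  exact: continuous_dotv.
rewrite (integral_cells d_gt0 (S := S) (g := fun m w => r m *
    dotv (affine_map (A m - B m) (a m - b m) w)
         (affine_map (A m - B m) (a m - b m) w))).
- congr EFin; apply: eq_bigr => m _; rewrite RintegralZl//.
    exact: measurable_icell.
  exact: integrable_icell.
- move=> m w; apply: (@continuousM _ _ (fun=> r m) _ w); last exact: cdot.
  exact: cst_continuous.
move=> m w im; rewrite (rrE im) (GE _ _ (icellW im)) (FE _ _ (icellW im)).
by rewrite affine_mapB enorm_sqr mulrC.
Qed.

(** Minimality is stated in the extended reals; with finite values on both sides it becomes an
    inequality of real functions, accessible to differentiation. *)
Lemma energy_tauE tau G A a F B b :
  affine_on G A a -> affine_on F B b -> (forall m, 0 < \det (A m)) ->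
  energy_tau K tau h V rr G F =
  ((2 * tau)^-1 * (\sum_m cell_dist A B a b m) + \sum_m cell_energy A a m)%:E.
Proof.
by move=> GE FE detA; rewrite /energy_tau (distE GE FE) (energyE GE detA).
Qed.

End energy_formula.

(** * Derivation rules in pointwise form *)

Section derive_pointwise.
Variables (R : realType) (x : R).

Lemma is_derive_fun_sum n (f : 'I_n -> R -> R) (l : 'I_n -> R) :
  (forall i, is_derive x 1 (f i) (l i)) ->
  is_derive x 1 (fun s => \sum_i f i s) (\sum_i l i).
Proof.
move=> fl; have := is_derive_sum fl.
by rewrite (_ : \sum_(i < n) f i = (fun s => \sum_i f i s))//; apply/funext => s;
  rewrite fct_sumE.
Qed.

Lemma is_derive_fun_add (f g : R -> R) (l k : R) : is_derive x 1 f l ->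
  is_derive x 1 g k -> is_derive x 1 (fun s => f s + g s) (l + k).
Proof. by move=> fl gk; exact: (is_deriveD fl gk). Qed.

Lemma is_derive_fun_scale (c : R) (f : R -> R) (l : R) : is_derive x 1 f l ->
  is_derive x 1 (fun s => c * f s) (c * l).
Proof. by move=> fl; exact: (is_deriveZ c fl). Qed.

End derive_pointwise.

(** * Gluing affine pieces; nodal interpolation *)

Section gluing.
Variables (R : realType) (d : nat) (K : set 'rV[R]_d).
Variable S : simplicial_decomposition K.
Local Notation I := 'I_(sd_size S).
Local Notation cell := (@cell R d K S).
Local Notation affine_on := (@affine_on R d K S).

(** Pasting along the finite cover of [K] by closed cells. *)
Lemma affine_on_continuous G A b : affine_on G A b -> {within K, continuous G}.
Proof.
move=> GE.
have KE : K = \big[setU/set0]_(m <- index_enum I) cell m.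
  rewrite -[LHS](sd_cover S) -bigcup_seq; apply: eq_bigcupl.
  by split=> i //= _; exact: mem_index_enum.
suff [_ H] : closed (\big[setU/set0]_(m <- index_enum I) cell m) /\
    {within \big[setU/set0]_(m <- index_enum I) cell m, continuous G}.
  by rewrite -KE in H.
apply: (big_ind (fun D : set 'rV[R]_d => closed D /\ {within D, continuous G})).
- by split; [exact: closed0|exact: continuous_subspace0].
- move=> D E [cD Dc] [cE Ec]; split; first exact: closedU.
  exact: withinU_continuous.
move=> m _; split; first by apply: closed_simplex; exact: sd_indep.
apply: (@subspace_eq_continuous _ _ _ (affine_map (A m) (b m))).
  by move=> w; rewrite inE => /GE.
by apply: continuous_subspaceT; exact: continuous_affine_map.
Qed.

Definition interp_A (F : 'rV[R]_d -> 'rV[R]_d) (m : I) : 'M[R]_d :=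
  @dsubmx _ 1 d d (interp_mx (sd_vertex m) (F \o sd_vertex m)).

Definition interp_b (F : 'rV[R]_d -> 'rV[R]_d) (m : I) : 'rV[R]_d :=
  @usubmx _ 1 d d (interp_mx (sd_vertex m) (F \o sd_vertex m)).

Definition nodal_interp (F : 'rV[R]_d -> 'rV[R]_d) (w : 'rV[R]_d) : 'rV[R]_d :=
  if [pick m : I | `[< cell m w >]] is Some m
  then interp (sd_vertex m) (F \o sd_vertex m) w else 0.

(** The cell picked at [w] does not matter: two cells containing [w] share a face through it, on
    which their interpolants agree. *)
Lemma nodal_interp_affine F : affine_on (nodal_interp F) (interp_A F) (interp_b F).
Proof.
move=> m w cm; rewrite /interp_A /interp_b -interp_affine /nodal_interp.
case: pickP => [m' /asboolP cm'|/(_ m)]; last by rewrite asboolT.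
have [A [B [AE BE]]] := sd_common_face m' m.
apply: (interp_face_eq F (@sd_indep _ _ _ S m') (@sd_indep _ _ _ S m) (etrans (esym AE) BE)).
by rewrite -AE.
Qed.

Lemma interp_A_b_vertex F m i :
  affine_map (interp_A F m) (interp_b F m) (sd_vertex m i) = F (sd_vertex m i).
Proof.
by rewrite /interp_A /interp_b -interp_affine interp_vertex//; exact: sd_indep.
Qed.

End gluing.

(** * The Euler-Lagrange equation in reference coordinates *)

Section euler_lagrange.
Variables (R : realType) (d : nat) (K : set 'rV[R]_d).
Variable S : simplicial_decomposition K.
Hypothesis d_gt0 : (0 < d)%N.
Local Notation leb := (lebesgue_rV R d).
Local Notation I := 'I_(sd_size S).
Local Notation cell := (@cell R d K S).
Local Notation icell := (@icell R d K S).
Local Notation affine_on := (@affine_on R d K S).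
Variables (h : R -> R) (V : 'rV[R]_d -> R).
Hypothesis h_ok : entropy_density h.
Hypothesis V_C1 : Ck 1 V.
Variables (r : I -> R) (rr : 'rV[R]_d -> R).
Hypothesis r_ge0 : forall m, 0 <= r m.
Hypothesis rrE : forall m w, icell m w -> rr w = r m.

Let dV i : 'rV[R]_d -> R := 'D_(delta_mx ord0 i) V.

Let Vc : continuous V. Proof. by case: V_C1. Qed.

Let dVc i : continuous (dV i).
Proof. by have [_ H] := V_C1; have [_ []] := H (delta_mx ord0 i). Qed.

Let affine_mapD_scale n p (A B : 'M[R]_(n, p)) a b s w :
  affine_map (A + s *: B) (a + s *: b) w = affine_map A a w + s *: affine_map B b w.
Proof. by rewrite /affine_map mulmxDr -scalemxAr scalerDr addrACA. Qed.

Lemma is_derive_det (A B : 'M[R]_d) : A \in unitmx ->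
  is_derive (0 : R) 1 (fun s => \det (A + s *: B)) (\det A * \tr (invmx A *m B)).
Proof.
move=> uA; have := is_derive_fun_scale (\det A) (is_derive_det1 (invmx A *m B) d_gt0).
rewrite (_ : (fun _ => _) = (fun s => \det (A + s *: B)))//; apply/funext => s.
by rewrite -det_mulmx mulmxDr mulmx1 -scalemxAr mulmxA mulmxV// mul1mx.
Qed.

Variables (A : I -> 'M[R]_d) (b : I -> 'rV[R]_d).
Hypothesis detA : forall m, 0 < \det (A m).
Variables (As B : I -> 'M[R]_d) (bs e : I -> 'rV[R]_d).

Let uA m : A m \in unitmx.
Proof. by rewrite unitmxE unitfE gt_eqF. Qed.

(** The contribution of one cell to the derivative along [(A + s B, b + s e)]: the momentum, minus
    pressure times divergence, plus the potential force. *)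
Definition first_variation tau m : R :=
  r m * (tau^-1 * \int[leb]_(w in icell m)
    dotv (affine_map (B m) (e m) w) (affine_map (A m - As m) (b m - bs m) w))
  - fine (leb (icell m)) * \det (A m) * pressure h (r m / \det (A m)) *
    \tr (invmx (A m) *m B m)
  + r m * \int[leb]_(w in icell m)
    dotv (affine_map (B m) (e m) w) (grad V (affine_map (A m) (b m) w)).

Let is_derive_cell_energy m : is_derive (0 : R) 1
  (fun s => cell_energy h V r (fun m => A m + s *: B m) (fun m => b m + s *: e m) m)
  (- (fine (leb (icell m)) * \det (A m) * pressure h (r m / \det (A m)) *
     \tr (invmx (A m) *m B m))
   + r m * \int[leb]_(w in icell m)
     dotv (affine_map (B m) (e m) w) (grad V (affine_map (A m) (b m) w))).
Proof.
rewrite /cell_energy; apply: is_derive_fun_add.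
  have dd := is_derive_det (B m) (uA m).
  have dt : is_derive (\det (A m + 0 *: B m)) 1 (fun s => s * h (r m / s))
      (- pressure h (r m / \det (A m))).
    by rewrite scale0r addr0; exact: is_derive_scaled_density.
  have := is_derive_fun_scale (fine (leb (icell m))) (is_derive1_comp dt dd).
  by move=> /is_derive_eq; apply; ring.
apply: is_derive_fun_scale.
have := is_derive_Rintegral_comp (A m) (B m) (b m) (e m)
  (measurable_icell m) (@bounded_icell _ _ _ S m) Vc dVc (C1_unif_diff V_C1).
under [X in is_derive _ _ X _]eq_fun => s do
  under eq_Rintegral do rewrite -affine_mapD_scale.
move=> /is_derive_eq; apply; apply: eq_Rintegral => w _.
rewrite /dotv; by apply: eq_bigr => i _; congr (_ * _); rewrite mxE.
Qed.

Let is_derive_cell_dist m : is_derive (0 : R) 1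
  (fun s => cell_dist r (fun m => A m + s *: B m) As (fun m => b m + s *: e m) bs m)
  (2 * (r m * \int[leb]_(w in icell m)
    dotv (affine_map (B m) (e m) w) (affine_map (A m - As m) (b m - bs m) w))).
Proof.
rewrite [_ * (_ * _)]mulrCA /cell_dist; apply: is_derive_fun_scale.
have dc : continuous (fun x : 'rV[R]_d => dotv x x) by exact: continuous_dotv.
have gc (i : 'I_d) : continuous (fun x : 'rV[R]_d => 2 * x ord0 i).
  have c2 : continuous (fun _ : 'rV[R]_d => 2 : R) by exact: cst_continuous.
  move=> x; exact: (continuousM (c2 x) (@coord_continuous _ _ _ ord0 i x)).
have := is_derive_Rintegral_comp (A m - As m) (B m) (b m - bs m) (e m)
  (measurable_icell m) (@bounded_icell _ _ _ S m) dc gc (@dotv_unif_diff R d).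
under [X in is_derive _ _ X _]eq_fun => s do
  under eq_Rintegral do rewrite -affine_mapD_scale addrAC [b m - _ + _]addrAC.
move=> /is_derive_eq; apply; rewrite -RintegralZl; first last.
- apply: integrable_icell => w; apply: continuous_sum => i {}w.
  by apply: continuousM; exact: coord_affine_continuous.
- exact: measurable_icell.
apply: eq_Rintegral => w _; rewrite /dotv mulr_sumr.
by apply: eq_bigr => i _; rewrite mulrCA.
Qed.

Lemma euler_lagrange tau G Gs eta : 0 < tau ->
  affine_on G A b -> affine_on Gs As bs -> affine_on eta B e ->
  is_minimizer S (fun G' => energy_tau K tau h V rr G' Gs) G ->
  \sum_m first_variation tau m = 0.
Proof.
move=> tau0 GE GsE etaE [_ Gmin].
pose As_ s m := A m + s *: B m; pose bs_ s m := b m + s *: e m.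
pose J s := (2 * tau)^-1 * (\sum_m cell_dist r (As_ s) As (bs_ s) bs m) +
  \sum_m cell_energy h V r (As_ s) (bs_ s) m.
have dJ : is_derive (0 : R) 1 J (\sum_m first_variation tau m).
  have := is_derive_fun_add
    (is_derive_fun_scale (2 * tau)^-1 (is_derive_fun_sum is_derive_cell_dist))
    (is_derive_fun_sum is_derive_cell_energy).
  move=> /is_derive_eq; apply; rewrite mulr_sumr -big_split; apply: eq_bigr => m _.
  by rewrite /first_variation /=; field; rewrite gt_eqF.
apply: (is_derive_min0 dJ).
(* Positivity of finitely many determinants is an open condition, so small perturbations of either
   sign are admissible competitors. *)
have pos : \forall s \near (0 : R), forall m, 0 < \det (As_ s m).
  have := @filter_forall _ _ (fun m s => 0 < \det (As_ s m)) (nbhs (0 : R)).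
  apply => m; have [dd _] := is_derive_det (B m) (uA m).
  have /differentiable_continuous := (derivable1_diffP _ _).1 dd.
  move=> /cvgr_gt; apply; rewrite scale0r addr0; exact: detA.
apply: filterS pos => s sp.
have GsEta : affine_on (fun w => G w + s *: eta w) (As_ s) (bs_ s).
  by move=> m w cm; rewrite (GE _ _ cm) (etaE _ _ cm) affine_mapD_scale.
have adm : admissible S (fun w => G w + s *: eta w).
  split; first exact: affine_on_continuous GsEta.
  by move=> m; exists (As_ s m), (bs_ s m); split; [exact: sp|exact: GsEta].
have GE0 : affine_on G (As_ 0) (bs_ 0).
  by move=> m w cm; rewrite (GE _ _ cm) /As_ /bs_ !scale0r !addr0.
have := Gmin _ adm; rewrite -lee_fin.
rewrite (energy_tauE d_gt0 h_ok Vc rrE tau GE0 GsE); last first.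
  by move=> m; rewrite /As_ scale0r addr0.
by rewrite (energy_tauE d_gt0 h_ok Vc rrE tau GsEta GsE).
Qed.

End euler_lagrange.

(** * Euclidean norm, diameter and inradius *)

Section euclidean_facts.
Variables (R : realType) (d : nat).
Implicit Types (u x y : 'rV[R]_d) (D : set 'rV[R]_d).

Lemma norm_le_enorm u : `|u| <= enorm u.
Proof.
have [_] := rV_norm_le u (sqrtr_ge0 (dotv u u)); apply => i.
rewrite -sqrtr_sqr ler_wsqrtr// /dotv (bigD1 i)//= -expr2 lerDl.
by apply: sumr_ge0 => j _; rewrite -expr2 sqr_ge0.
Qed.

Lemma enorm_le_norm u : enorm u <= d%:R * `|u|.
Proof.
rewrite -[leRHS]ger0_norm ?mulr_ge0// -sqrtr_sqr ler_wsqrtr//.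
apply: (@le_trans _ _ (\sum_(i < d) `|u| ^+ 2)).
  apply: ler_sum => i _; rewrite -expr2 -real_normK ?num_real// lerXn2r ?nnegrE//.
  exact: rV_norm_coord.
rewrite sumr_const card_ord -[_ *+ d]mulr_natl exprMn ler_wpM2r ?sqr_ge0//.
by rewrite -natrX ler_nat; case: (d) => // n; rewrite leq_pmulr.
Qed.

Lemma enormZ (c : R) u : enorm (c *: u) = `|c| * enorm u.
Proof.
rewrite /enorm -sqrtr_sqr -sqrtrM ?sqr_ge0//; congr Num.sqrt.
by rewrite /dotv mulr_sumr; apply: eq_bigr => i _; rewrite !mxE; ring.
Qed.

Lemma enorm_delta i : enorm (delta_mx ord0 i : 'rV[R]_d) = 1.
Proof.
rewrite /enorm /dotv (bigD1 i)//= !mxE !eqxx mulr1 big1 ?addr0 ?sqrtr1// => j ji.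
by rewrite !mxE (negbTE ji) andbF mulr0.
Qed.

Let diam_ub D : bounded_set D ->
  has_ubound [set enorm (z.1 - z.2) | z in D `*` D].
Proof.
move=> /bounded_setP[M M0 HM]; exists (d%:R * (M + M)) => _ [[x y] /= [Dx Dy] <-].
apply: (le_trans (enorm_le_norm _)); apply: ler_wpM2l => //.
by apply: (le_trans (ler_normB _ _)); apply: lerD; exact: HM.
Qed.

Lemma enorm_le_diameter D x y : bounded_set D -> D x -> D y ->
  enorm (x - y) <= diameter D.
Proof.
by move=> bD Dx Dy; apply: ub_le_sup; [exact: diam_ub|exists (x, y)].
Qed.

(** The supremum defining the inradius is not shown to be attained; a ball of more than half that
    radius is enough and costs a factor 2 in the shape constant. *)
Lemma inradius_ball D : (0 < d)%N -> bounded_set D -> 0 < inradius D ->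
  exists2 s, inradius D < 2 * s &
    exists x, [set y | enorm (y - x) <= s] `<=` D.
Proof.
move=> d0 bD i0.
have hs : has_sup [set s | 0 <= s /\ exists x, [set y | enorm (y - x) <= s] `<=` D].
  (* A set without supremum gets the default value 0, which a positive inradius excludes. *)
  apply: contrapT => /sup_out; rewrite -/(inradius D) => E.
  by rewrite E ltxx in i0.
have [s [s0 sD] ls] := sup_adherent (divr_gt0 i0 (ltr0Sn R 1)) hs.
exists s => //; rewrite -/(inradius D) in ls.
by move: ls; lra.
Qed.

End euclidean_facts.

(** * Error of affine interpolation on a simplex *)

Section interpolation_error.
Variables (R : realType) (d : nat) (q : 'I_d.+1 -> 'rV[R]_d).
Variables (xi : 'rV[R]_d -> 'rV[R]_d) (C : 'M[R]_d) (e : 'rV[R]_d).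
Let xi_ l x : R := xi x ord0 l.
Hypothesis xi_derivable : forall l i z, derivable (xi_ l) z (delta_mx ord0 i).
Hypothesis nodal : forall i, affine_map C e (q i) = xi (q i).
Variables (x : 'rV[R]_d) (c : 'I_d.+1 -> R) (dl w : R).
Hypotheses (c_ge0 : forall i, 0 <= c i) (c_sum : \sum_i c i = 1).
Hypothesis xE : x = \sum_i c i *: q i.
Hypothesis q_near : forall i, `|q i - x| <= dl.
Hypothesis w_ge0 : 0 <= w.
Hypothesis modulus : forall l i z, `|z - x| <= dl ->
  `|'D_(delta_mx ord0 i) (xi_ l) z - 'D_(delta_mx ord0 i) (xi_ l) x| <= w.

Let tangent l i : R := xi_ l x +
  \sum_k (q i - x) ord0 k * 'D_(delta_mx ord0 k) (xi_ l) x.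

Let tangent_error l i : `|xi_ l (q i) - tangent l i| <= d%:R * w * dl.
Proof.
have xq : x + (q i - x) = q i by rewrite addrC subrK.
rewrite /tangent opprD addrA -[in xi_ l (q i)]xq.
apply: le_trans (coord_taylor1 (w := w) (fun i z => @xi_derivable l i z) _) _.
  by move=> k z zx; apply: modulus; exact: (le_trans zx).
by apply: ler_wpM2l => //; rewrite mulr_ge0.
Qed.

(** Taylor expansion of all nodal values at the same point [x], for arbitrary weights. The weights
    of [x] itself give the error of the value, differences of weights give the error of a slope. *)
Let comb l (a : 'I_d.+1 -> R) :
  \sum_i a i * xi_ l (q i) - (\sum_i a i) * xi_ l x -
   \sum_k (\sum_i a i *: (q i - x)) ord0 k * 'D_(delta_mx ord0 k) (xi_ l) x =
  \sum_i a i * (xi_ l (q i) - tangent l i).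
Proof.
under [RHS]eq_bigr do rewrite /tangent mulrBr mulrDr.
rewrite sumrB big_split /= opprD addrA mulr_suml; congr (_ - _).
under eq_bigr do rewrite summxE mulr_suml.
rewrite exchange_big; apply: eq_bigr => i _ /=; rewrite mulr_sumr.
by apply: eq_bigr => k _; rewrite !mxE mulrA.
Qed.

Let comb_error l (a : 'I_d.+1 -> R) :
  `|\sum_i a i * (xi_ l (q i) - tangent l i)| <= (\sum_i `|a i|) * (d%:R * w * dl).
Proof.
apply: (le_trans (ler_norm_sum _ _ _)); rewrite mulr_suml.
by apply: ler_sum => i _; rewrite normrM; apply: ler_wpM2l => //; exact: tangent_error.
Qed.

Let affine_comb l (a : 'I_d.+1 -> R) : \sum_i a i = 1 ->
  affine_map C e (\sum_i a i *: q i) ord0 l = \sum_i a i * xi_ l (q i).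
Proof.
move=> a1; rewrite affine_map_comb// summxE.
by apply: eq_bigr => i _; rewrite nodal mxE.
Qed.

(** With the weights of [x] the first-order term cancels, and only an average of the Taylor
    remainders is left. *)
Lemma interp_value_error l : `|affine_map C e x ord0 l - xi x ord0 l| <= d%:R * w * dl.
Proof.
rewrite {1}xE affine_comb//; have := comb l c.
have -> : \sum_i c i *: (q i - x) = 0.
  under eq_bigr do rewrite scalerBr.
  by rewrite sumrB -scaler_suml c_sum scale1r -xE subrr.
rewrite [X in _ - _ - X]big1 => [|k _]; last by rewrite mxE mul0r.
rewrite c_sum mul1r subr0 /xi_ => ->; apply: (le_trans (comb_error l c)).
by under eq_bigr do rewrite ger0_norm//; rewrite c_sum mul1r.
Qed.

Variables (y : 'rV[R]_d) (s kappa : R).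
Hypothesis s_gt0 : 0 < s.
Hypothesis ball_sub : [set z | enorm (z - y) <= s] `<=` simplex q.
Hypothesis dl_s : dl <= kappa * s.

(** The slope is read off along a segment of length [2 s] inside the simplex. The weights [t] are
    the differences of those of its ends: they sum to 0 and their absolute values to at most 2.
    Division by [2 s] turns the remainder [dl] into [dl / s], at most [kappa]. *)
Let interp_partial_error j l :
  `|C j l - 'D_(delta_mx ord0 j) (xi_ l) x| <= d%:R * w * kappa.
Proof.
have pt (u : R) : `|u| <= s -> simplex q (y + u *: delta_mx ord0 j).
  by move=> us; apply: ball_sub => /=; rewrite addrC addKr enormZ enorm_delta mulr1.
have [a [a0 _ a1 aE]] : simplex q (y + s *: delta_mx ord0 j).
  by apply: pt; rewrite gtr0_norm.
have [a' [a'0 _ a'1 a'E]] : simplex q (y + (- s) *: delta_mx ord0 j).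
  by apply: pt; rewrite normrN gtr0_norm.
pose t i := a i - a' i.
have t0 : \sum_i t i = 0 by rewrite sumrB a1 a'1 subrr.
have tq : \sum_i t i *: (q i - x) = (2 * s) *: delta_mx ord0 j.
  under eq_bigr do rewrite scalerBr.
  rewrite sumrB -scaler_suml t0 scale0r subr0.
  under eq_bigr do rewrite scalerBl.
  rewrite sumrB -aE -a'E scaleNr opprD opprK addrACA subrr add0r -scalerDl.
  by congr (_ *: _); ring.
have tC : \sum_i t i * xi_ l (q i) = 2 * s * C j l.
  under eq_bigr do rewrite mulrBl.
  rewrite sumrB -!affine_comb// -aE -a'E /affine_map !mulmxDl -!scalemxAl -rowE !mxE.
  by ring.
have t2 : \sum_i `|t i| <= 2.
  rewrite (_ : 2 = \sum_i (a i + a' i)); last by rewrite big_split /= a1 a'1.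
  by apply: ler_sum => i _; rewrite (le_trans (ler_normB _ _))// !ger0_norm.
have := comb l t; rewrite tC t0 mul0r subr0 tq (bigD1 j)//= [X in _ - (_ + X)]big1 => [|k kj].
  rewrite addr0 !mxE !eqxx mulr1 -mulrBr => E.
  have := comb_error l t; rewrite -E normrM gtr0_norm ?mulr_gt0//.
  have dw0 : 0 <= d%:R * w by rewrite mulr_ge0.
  have dl0 : 0 <= dl by exact: le_trans (q_near ord0).
  move=> /le_trans => H; rewrite -(ler_pM2l (_ : 0 < 2 * s)) ?mulr_gt0//.
  apply: H; apply: (@le_trans _ _ (2 * (d%:R * w * dl))).
    by apply: ler_wpM2r => //; rewrite mulr_ge0.
  rewrite (_ : 2 * s * _ = 2 * (d%:R * w * (kappa * s))); last by ring.
  by rewrite ler_pM2l//; apply: ler_wpM2l.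
by rewrite !mxE (negbTE kj) andbF mulr0 mul0r.
Qed.

Lemma interp_trace_error :
  `|\tr C - \sum_l 'D_(delta_mx ord0 l) (fun z => xi z ord0 l) x| <=
  d%:R * (d%:R * w * kappa).
Proof.
rewrite /mxtrace -sumrB; apply: (le_trans (ler_norm_sum _ _ _)).
rewrite mulr_natl -[X in _ *+ X](card_ord d) -sumr_const.
by apply: ler_sum => l _; exact: interp_partial_error.
Qed.

End interpolation_error.

(** * Continuity rules in pointwise form *)

Section continuous_pointwise.
Variables (R : realType) (T : topologicalType).
Implicit Types f g : T -> R.

Lemma continuous_fun_add f g : continuous f -> continuous g ->
  continuous (fun x => f x + g x).
Proof. by move=> fc gc x; apply: cvgD; [exact: fc|exact: gc]. Qed.

Lemma continuous_fun_sub f g : continuous f -> continuous g ->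
  continuous (fun x => f x - g x).
Proof. by move=> fc gc x; apply: cvgB; [exact: fc|exact: gc]. Qed.

Lemma continuous_fun_mul f g : continuous f -> continuous g ->
  continuous (fun x => f x * g x).
Proof. by move=> fc gc x; apply: cvgM; [exact: fc|exact: gc]. Qed.

Lemma continuous_fun_scale (c : R) f : continuous f ->
  continuous (fun x => c * f x).
Proof. by move=> fc x; apply: cvgM; [exact: cvg_cst|exact: fc]. Qed.

End continuous_pointwise.

(** * One time step seen on the image cells *)

Section transported_step.
Variables (R : realType) (d : nat) (K : set 'rV[R]_d).
Variable S : simplicial_decomposition K.
Hypothesis d_gt0 : (0 < d)%N.
Local Notation leb := (lebesgue_rV R d).
Local Notation I := 'I_(sd_size S).
Local Notation cell := (@cell R d K S).
Local Notation icell := (@icell R d K S).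
Local Notation affine_on := (@affine_on R d K S).
Local Notation imcell := (@imcell R d K S).
Variables (h : R -> R) (V : 'rV[R]_d -> R).
Hypothesis h_ok : entropy_density h.
Hypothesis V_C1 : Ck 1 V.
Hypothesis V_ge0 : forall x, 0 <= V x.
Variables (r : I -> R) (rr : 'rV[R]_d -> R).
Hypothesis r_ge0 : forall m, 0 <= r m.
Hypothesis rrE : forall m w, icell m w -> rr w = r m.
Variables (A : I -> 'M[R]_d) (b : I -> 'rV[R]_d) (G : 'rV[R]_d -> 'rV[R]_d).
Hypothesis detA : forall m, 0 < \det (A m).
Hypothesis GE : affine_on G A b.

Let uA m : A m \in unitmx.
Proof. by rewrite unitmxE unitfE gt_eqF. Qed.

Definition image_density m : R := r m / \det (A m).
Local Notation rho_ := image_density.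

Lemma image_density_ge0 m : 0 <= rho_ m.
Proof. by rewrite divr_ge0// ltW. Qed.

Let detrho m : \det (A m) * rho_ m = r m.
Proof. by rewrite mulrC divfK// gt_eqF. Qed.

Let Vc : continuous V. Proof. by case: V_C1. Qed.

Lemma continuous_dV i : continuous ('D_(delta_mx ord0 i : 'rV[R]_d) V).
Proof. by have [_ H] := V_C1; have [_ []] := H (delta_mx ord0 i). Qed.

Lemma continuous_dotv2 (T : topologicalType) (f g : T -> 'rV[R]_d) :
  (forall i, continuous (fun x => f x ord0 i)) ->
  (forall i, continuous (fun x => g x ord0 i)) ->
  continuous (fun x => dotv (f x) (g x)).
Proof.
move=> fc gc; apply: continuous_sum => i x; apply: continuousM; [exact: fc|exact: gc].
Qed.

Lemma continuous_gradV i : continuous (fun x => grad V x ord0 i).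
Proof.
rewrite (_ : (fun _ => _) = 'D_(delta_mx ord0 i) V); first exact: continuous_dV.
by apply/funext => x; rewrite mxE.
Qed.

Section energy_identities.

Lemma cell_energy_ge0 m : 0 <= cell_energy h V r A b m.
Proof.
rewrite /cell_energy; apply: addr_ge0; apply: mulr_ge0 => //.
- by rewrite fine_ge0.
- by rewrite mulr_ge0 ?(ltW (detA m))// ed_ge0// divr_ge0// ltW.
- exact: Rintegral_ge0.
Qed.

Let continuous_density_energy m : continuous (fun x => h (rho_ m) + V x * rho_ m).
Proof.
apply: continuous_fun_add; first exact: cst_continuous.
by apply: continuous_fun_mul => //; exact: cst_continuous.
Qed.

(** Change of variables on each image cell; off the image cells the density vanishes almost
    everywhere, and with [h 0 = 0] so does the integrand. *)
Lemma entropyE rho : set_inj K G -> push_density K G rr rho ->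
  entropy h V rho = (\sum_m cell_energy h V r A b m)%:E.
Proof.
move=> G_inj rho_push.
have [N [mN N0 HN]] := push_density_pw d_gt0 detA GE rrE rho_push.
have tI := trivIset_imcell detA GE G_inj.
rewrite /entropy (eq_integral_off_null (N := N)
  (g := fun x => (pw (imcell A b) (fun m x => h (rho_ m) + V x * rho_ m) x)%:E))//.
  rewrite integral_pw; [|exact: measurable_imcell|]; last first.
    move=> m; exact: integrable_imcell.
  congr EFin; apply: eq_bigr => m _.
  rewrite Rintegral_imcell//.
  have cV : continuous (fun w => V (affine_map (A m) (b m) w)).
    by move=> w; apply: continuous_comp; [exact: continuous_affine_map|exact: Vc].
  have iV := @integrable_icell _ _ _ S m _ cV.
  rewrite RintegralD; [|exact: measurable_icell| |]; last 2 first.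
  - by apply: integrable_icell; exact: cst_continuous.
  - apply: integrable_icell.
    by apply: continuous_fun_mul => //; exact: cst_continuous.
  rewrite Rintegral_cst; last exact: measurable_icell.
  rewrite RintegralZr//; last exact: measurable_icell.
  rewrite /cell_energy -/(rho_ m) -[r m](detrho m); ring.
move=> x _ /HN ->; congr EFin.
have [[m imx]|nx] := pselect (exists m, imcell A b m x).
  by rewrite !(pw_in _ tI imx).
rewrite !pw_out ?mulr0 ?addr0 ?ed_h0// => m imx; apply: nx; by exists m.
Qed.

End energy_identities.

Variables (As : I -> 'M[R]_d) (bs : I -> 'rV[R]_d) (Gs : 'rV[R]_d -> 'rV[R]_d).
Hypothesis GsE : affine_on Gs As bs.
Variable tau : R.
Hypothesis tau_gt0 : 0 < tau.

(** The affine formula of cell [m], extended to the whole space so that it is continuous everywhere;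
    it is the velocity only on the image of that cell. *)
Definition velocity m (x : 'rV[R]_d) : 'rV[R]_d :=
  tau^-1 *: (x - affine_map (As m) (bs m) (ginv A b m x)).

Lemma velocity_affine m w : velocity m (affine_map (A m) (b m) w) =
  tau^-1 *: affine_map (A m - As m) (b m - bs m) w.
Proof. by rewrite /velocity ginvK// affine_mapB. Qed.

Lemma continuous_velocity m i : continuous (fun x => velocity m x ord0 i).
Proof.
have c1 := @coord_continuous R 1 d ord0 i.
have c2 : continuous (fun x => affine_map (As m) (bs m) (ginv A b m x) ord0 i).
  move=> x; apply: (@continuous_comp _ _ _ (ginv A b m)
    (fun y => affine_map (As m) (bs m) y ord0 i)); first exact: continuous_affine_map.
  exact: coord_affine_continuous.
rewrite (_ : (fun _ => _) = (fun x : 'rV[R]_d => tau^-1 *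
  (x ord0 i - affine_map (As m) (bs m) (ginv A b m x) ord0 i))).
  by apply: continuous_fun_scale; exact: continuous_fun_sub.
by apply/funext => x; rewrite /velocity !mxE.
Qed.

Lemma induced_velocity_imcell v m x : induced_velocity K tau Gs G v ->
  imcell A b m x -> v x = velocity m x.
Proof.
move=> vE imx; have cx := icellW imx.
have := vE (ginv A b m x) (cell_sub cx).
by rewrite (G_ginv detA GE imx) (GsE cx) => ->.
Qed.

Lemma cell_dist_imcell m : cell_dist r A As b bs m =
  tau ^+ 2 * \int[leb]_(x in imcell A b m) (rho_ m * dotv (velocity m x) (velocity m x)).
Proof.
have cv : continuous (fun x => dotv (velocity m x) (velocity m x)).
  by apply: continuous_dotv2 => i; exact: continuous_velocity.
have ci := @integrable_imcell _ _ _ S A b detA m _ cv.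
rewrite RintegralZl//; last exact: measurable_imcell.
rewrite Rintegral_imcell// [rho_ m * _]mulrA [rho_ m * _]mulrC detrho mulrCA /cell_dist.
congr (_ * _).
have cu : continuous (fun w => dotv (affine_map (A m - As m) (b m - bs m) w)
    (affine_map (A m - As m) (b m - bs m) w)).
  by apply: continuous_dotv2 => i; exact: coord_affine_continuous.
have iu := @integrable_icell _ _ _ S m _ cu.
rewrite [in RHS](@eq_Rintegral _ _ _ _ _ (fun w => tau ^- 2 *
    dotv (affine_map (A m - As m) (b m - bs m) w)
    (affine_map (A m - As m) (b m - bs m) w))); last first.
  move=> w _; rewrite velocity_affine /dotv mulr_sumr; apply: eq_bigr => i _.
  by rewrite !mxE; field; rewrite gt_eqF.
rewrite RintegralZl//; last exact: measurable_icell.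
by rewrite mulrA mulfV ?mul1r// expf_neq0// gt_eqF.
Qed.

(** The previous map is a competitor at distance 0 from itself. The displacement is [tau] times the
    velocity, whence the factor [(2 tau)^-1 tau^2 = tau / 2]. *)
Lemma energy_decrease : (forall m, 0 < \det (As m)) ->
  is_minimizer S (fun G' => energy_tau K tau h V rr G' Gs) G ->
  admissible S Gs ->
  tau / 2 * (\sum_m \int[leb]_(x in imcell A b m)
    (rho_ m * dotv (velocity m x) (velocity m x)))
  + \sum_m cell_energy h V r A b m <= \sum_m cell_energy h V r As bs m.
Proof.
move=> detAs [_ Gmin] Gsa; have := Gmin _ Gsa; rewrite -lee_fin.
rewrite (energy_tauE d_gt0 h_ok Vc rrE tau GE GsE)//.
rewrite (energy_tauE d_gt0 h_ok Vc rrE tau GsE GsE)//.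
have -> : \sum_m cell_dist r As As bs bs m = 0.
  rewrite big1// => m _; rewrite /cell_dist !subrr.
  rewrite (@eq_Rintegral _ _ _ _ _ (cst 0)); last first.
    by move=> w _; rewrite /dotv big1// => i _; rewrite /affine_map mulmx0 add0r mxE mul0r.
  by rewrite Rintegral_cst ?mul0r ?mulr0//; exact: measurable_icell.
rewrite mulr0 add0r.
under eq_bigr do rewrite cell_dist_imcell.
rewrite -mulr_sumr mulrA (_ : (2 * tau)^-1 * tau ^+ 2 = tau / 2)//.
by field; rewrite gt_eqF.
Qed.

End transported_step.

(** * The momentum balance on the image and its perturbation *)

Section weak_form.
Variables (R : realType) (d : nat) (K : set 'rV[R]_d).
Variable S : simplicial_decomposition K.
Hypothesis d_gt0 : (0 < d)%N.
Local Notation leb := (lebesgue_rV R d).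
Local Notation I := 'I_(sd_size S).
Local Notation cell := (@cell R d K S).
Local Notation icell := (@icell R d K S).
Local Notation affine_on := (@affine_on R d K S).
Local Notation imcell := (@imcell R d K S).
Variables (h : R -> R) (V : 'rV[R]_d -> R).
Hypothesis h_ok : entropy_density h.
Hypothesis V_C1 : Ck 1 V.
Variables (r : I -> R) (rr : 'rV[R]_d -> R).
Hypothesis r_ge0 : forall m, 0 <= r m.
Hypothesis rrE : forall m w, icell m w -> rr w = r m.
Variables (A : I -> 'M[R]_d) (b : I -> 'rV[R]_d) (G : 'rV[R]_d -> 'rV[R]_d).
Hypothesis detA : forall m, 0 < \det (A m).
Hypothesis GE : affine_on G A b.
Local Notation rho_ := (image_density r A).
Variables (As : I -> 'M[R]_d) (bs : I -> 'rV[R]_d) (Gs : 'rV[R]_d -> 'rV[R]_d).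
Hypothesis GsE : affine_on Gs As bs.
Variable tau : R.
Hypothesis tau_gt0 : 0 < tau.
Hypothesis G_min :
  is_minimizer S (fun G' => energy_tau K tau h V rr G' Gs) G.
Local Notation vel := (velocity A b As bs tau).

Let uA m : A m \in unitmx.
Proof. by rewrite unitmxE unitfE gt_eqF. Qed.

Let detrho m : \det (A m) * rho_ m = r m.
Proof. by rewrite /image_density mulrC divfK// gt_eqF. Qed.

Variables (xi : 'rV[R]_d -> 'rV[R]_d).
Let xi_ l x : R := xi x ord0 l.
Let dxi l i : 'rV[R]_d -> R := 'D_(delta_mx ord0 i) (xi_ l).
Hypothesis xi_derivable : forall l i z, derivable (xi_ l) z (delta_mx ord0 i).
Hypothesis xi_cont : forall l, continuous (xi_ l).
Hypothesis dxi_cont : forall l i, continuous (dxi l i).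

(** Linear part of the interpolating field in image coordinates: first back to the cell by [A^-1],
    then through the nodal interpolant. Its trace is the divergence of that field. *)
Definition pulled_A m := invmx (A m) *m interp_A (S := S) (xi \o G) m.

Definition pulled_b m := interp_b (S := S) (xi \o G) m - b m *m pulled_A m.

Let zeta m := affine_map (pulled_A m) (pulled_b m).

Lemma pulled_affine m w :
  affine_map (pulled_A m) (pulled_b m) (affine_map (A m) (b m) w) =
  affine_map (interp_A (S := S) (xi \o G) m) (interp_b (S := S) (xi \o G) m) w.
Proof.
rewrite /affine_map /pulled_b mulmxDl /pulled_A -!mulmxA mulKVmx//.
by rewrite addrACA subrr addr0.
Qed.

(** The test field [y] and its divergence [t] are separate arguments, so one formula serves both the
    piecewise affine interpolant and the smooth field. *)
Definition weak_integrand (y : I -> 'rV[R]_d -> 'rV[R]_d)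
    (t : I -> 'rV[R]_d -> R) m x : R :=
  rho_ m * dotv (y m x) (vel m x) + rho_ m * dotv (y m x) (grad V x) -
  pressure h (rho_ m) * t m x.

Lemma continuous_weak_integrand (y : I -> 'rV[R]_d -> 'rV[R]_d)
    (t : I -> 'rV[R]_d -> R) m :
  (forall l, continuous (fun x => y m x ord0 l)) ->
  continuous (t m) -> continuous (weak_integrand y t m).
Proof.
move=> yc tc; apply: continuous_fun_sub; last exact: continuous_fun_scale.
apply: continuous_fun_add; apply: continuous_fun_scale; apply: continuous_dotv2 => // i.
  exact: continuous_velocity.
exact: continuous_gradV.
Qed.

Let continuous_zeta m l : continuous (fun x => zeta m x ord0 l).
Proof. exact: coord_affine_continuous. Qed.

Lemma first_variation_imcell m :
  first_variation h V r A b As (interp_A (S := S) (xi \o G)) bs (interp_b (S := S) (xi \o G)) tau m =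
  \int[leb]_(x in imcell A b m)
    weak_integrand zeta (fun m _ => \tr (pulled_A m)) m x.
Proof.
rewrite Rintegral_imcell//; last first.
  by apply: continuous_weak_integrand => [l|]; [exact: continuous_zeta|exact: cst_continuous].
set B := interp_A (S := S) (xi \o G); set e := interp_b (S := S) (xi \o G).
pose u w := dotv (affine_map (B m) (e m) w) (affine_map (A m - As m) (b m - bs m) w).
pose g w := dotv (affine_map (B m) (e m) w) (grad V (affine_map (A m) (b m) w)).
have uc : continuous u by apply: continuous_dotv2 => i; exact: coord_affine_continuous.
have gc : continuous g.
  apply: continuous_dotv2 => i; first exact: coord_affine_continuous.
  move=> w; apply: (@continuous_comp _ _ _ (affine_map (A m) (b m))
    (fun x => grad V x ord0 i)); first exact: continuous_affine_map.
  exact: continuous_gradV.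
rewrite (@eq_Rintegral _ _ _ _ _ (fun w => rho_ m * (tau^-1 * u w) + rho_ m * g w -
    pressure h (rho_ m) * \tr (pulled_A m))); last first.
  move=> w _; rewrite /weak_integrand /zeta pulled_affine velocity_affine//.
  rewrite (_ : dotv _ (tau^-1 *: _) = tau^-1 * u w)//.
  rewrite /u /dotv mulr_sumr; apply: eq_bigr => i _.
  by rewrite [X in _ * X = _]mxE mulrCA.
have mI := measurable_icell m.
have iu := @integrable_icell _ _ _ S m _ (continuous_fun_scale (c := tau^-1) uc).
have ig := @integrable_icell _ _ _ S m _ gc.
have iu' := @integrable_icell _ _ _ S m _ (continuous_fun_scale (c := rho_ m)
  (continuous_fun_scale (c := tau^-1) uc)).
have ig' := @integrable_icell _ _ _ S m _ (continuous_fun_scale (c := rho_ m) gc).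
have iug := @integrable_icell _ _ _ S m _ (continuous_fun_add
  (continuous_fun_scale (c := rho_ m) (continuous_fun_scale (c := tau^-1) uc))
  (continuous_fun_scale (c := rho_ m) gc)).
have ic : leb.-integrable (icell m)
    (EFin \o (fun _ => pressure h (rho_ m) * \tr (pulled_A m))).
  by apply: integrable_icell; exact: cst_continuous.
rewrite RintegralB// RintegralD// !RintegralZl//; last 2 first.
- exact: integrable_icell.
- by apply: integrable_icell; exact: cst_continuous.
rewrite Rintegral_cst// /first_variation -/B -/e -/(rho_ m) -[r m](detrho m).
rewrite /pulled_A -/B; ring.
Qed.

Lemma weak_form : \sum_m \int[leb]_(x in imcell A b m)
  weak_integrand zeta (fun m _ => \tr (pulled_A m)) m x = 0.
Proof.
under eq_bigr do rewrite -first_variation_imcell.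
apply: (euler_lagrange d_gt0 h_ok V_C1 r_ge0 rrE detA tau_gt0 GE GsE
  (@nodal_interp_affine _ _ _ S (xi \o G)) G_min).
Qed.

Variables (chi : 'rV[R]_d -> R) (w : R).
Hypothesis chi_cont : continuous chi.
Hypothesis value_error : forall m x l, imcell A b m x ->
  `|zeta m x ord0 l - xi x ord0 l| <= w * chi x.
Hypothesis trace_error : forall m x, imcell A b m x ->
  `|\tr (pulled_A m) - \sum_l dxi l l x| <= w * chi x.

(** The weight [chi] keeps the error near the support of the test field, where the pressure and
    [grad V] can be bounded. *)
Definition error_integrand m x : R :=
  (rho_ m * \sum_l `|vel m x ord0 l| + rho_ m * \sum_l `|grad V x ord0 l| +
   pressure h (rho_ m)) * chi x.

Lemma continuous_error_integrand m : continuous (error_integrand m).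
Proof.
apply: continuous_fun_mul => //.
apply: continuous_fun_add; last exact: cst_continuous.
have nc (f : 'I_d -> 'rV[R]_d -> R) : (forall l, continuous (f l)) ->
    continuous (fun x => \sum_l `|f l x|).
  move=> fc; apply: continuous_sum => l x.
  by apply: continuous_comp; [exact: fc|exact: norm_continuous].
apply: continuous_fun_add; apply: continuous_fun_scale; apply: nc => l.
  exact: continuous_velocity.
exact: continuous_gradV.
Qed.

Lemma weak_form_error :
  `|\sum_m \int[leb]_(x in imcell A b m)
     weak_integrand (fun _ => xi) (fun _ x => \sum_l dxi l l x) m x| <=
  w * \sum_m \int[leb]_(x in imcell A b m) error_integrand m x.
Proof.
have c1 m : continuous (weak_integrand (fun _ => xi) (fun _ x => \sum_l dxi l l x) m).
  by apply: continuous_weak_integrand => //; apply: continuous_sum => l; exact: dxi_cont.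
have c2 m : continuous (weak_integrand zeta (fun m _ => \tr (pulled_A m)) m).
  by apply: continuous_weak_integrand => [l|]; [exact: continuous_zeta|exact: cst_continuous].
(* Subtracting the exact balance of the interpolant leaves only [zeta - xi] and the difference of
   the divergences, with the nonnegative coefficients density and pressure. *)
rewrite -[X in `|X|]subr0 -[X in `|_ - X|]weak_form -sumrB mulr_sumr.
apply: (le_trans (ler_norm_sum _ _ _)); apply: ler_sum => m _.
have mI := measurable_imcell A b m.
have i1 := @integrable_imcell _ _ _ S A b detA m _ (c1 m).
have i2 := @integrable_imcell _ _ _ S A b detA m _ (c2 m).
have i12 := @integrable_imcell _ _ _ S A b detA m _ (continuous_fun_sub (c1 m) (c2 m)).
have ie := @integrable_imcell _ _ _ S A b detA m _ (@continuous_error_integrand m).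
rewrite -RintegralB// -RintegralZl//.
apply: (le_trans (le_normr_Rintegral mI i12)); apply: le_Rintegral => //.
- exact: integrable_norm.
- by apply: integrable_imcell => //; apply: continuous_fun_scale; exact: continuous_error_integrand.
move=> x mx; rewrite /weak_integrand /error_integrand.
have dotB (y z u : 'rV[R]_d) : dotv y u - dotv z u = \sum_l (y ord0 l - z ord0 l) * u ord0 l.
  by rewrite /dotv -sumrB; apply: eq_bigr => l _; rewrite mulrBl.
have dot_error (u : 'rV[R]_d) :
    `|dotv (xi x) u - dotv (zeta m x) u| <= w * chi x * \sum_l `|u ord0 l|.
  rewrite dotB (le_trans (ler_norm_sum _ _ _))// mulr_sumr; apply: ler_sum => l _.
  by rewrite normrM ler_wpM2r// distrC value_error.
have rho0 := image_density_ge0 r_ge0 detA m.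
have P0 := pressure_ge0 h_ok rho0.
set t := \tr (pulled_A m); set dv := \sum_l dxi l l x.
set Y := xi x; set Z := zeta m x.
rewrite (_ : _ - _ = rho_ m * (dotv Y (vel m x) - dotv Z (vel m x)) +
  rho_ m * (dotv Y (grad V x) - dotv Z (grad V x)) +
  pressure h (rho_ m) * (t - dv)); last by ring.
rewrite (_ : w * _ = rho_ m * (w * chi x * \sum_l `|vel m x ord0 l|) +
  rho_ m * (w * chi x * \sum_l `|grad V x ord0 l|) +
  pressure h (rho_ m) * (w * chi x)); last by ring.
apply: (le_trans (ler_normD _ _)); apply: lerD; last first.
  by rewrite normrM ger0_norm// ler_wpM2l//; exact: trace_error.
apply: (le_trans (ler_normD _ _)); apply: lerD;
  by rewrite normrM ger0_norm// ler_wpM2l.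
Qed.

End weak_form.

(** * Interpolation error on shape-regular image simplices *)

Section interpolation_on_image.
Variables (R : realType) (d : nat) (K : set 'rV[R]_d).
Variable S : simplicial_decomposition K.
Hypothesis d_gt0 : (0 < d)%N.
Local Notation I := 'I_(sd_size S).
Local Notation cell := (@cell R d K S).
Local Notation affine_on := (@affine_on R d K S).
Local Notation imcell := (@imcell R d K S).
Variables (A : I -> 'M[R]_d) (b : I -> 'rV[R]_d) (G : 'rV[R]_d -> 'rV[R]_d).
Hypothesis detA : forall m, 0 < \det (A m).
Hypothesis GE : affine_on G A b.
Variables (xi : 'rV[R]_d -> 'rV[R]_d).
Let xi_ l x : R := xi x ord0 l.
Let dxi l i : 'rV[R]_d -> R := 'D_(delta_mx ord0 i) (xi_ l).
Hypothesis xi_derivable : forall l i z, derivable (xi_ l) z (delta_mx ord0 i).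
Variables (chi : 'rV[R]_d -> R) (dl C w : R).
Hypothesis chi_ge0 : forall x, 0 <= chi x.
Hypothesis w_ge0 : 0 <= w.
Hypothesis dl_le1 : dl <= 1.
Hypothesis modulus : forall l i z z', `|z - z'| <= dl -> `|dxi l i z - dxi l i z'| <= w.
(* [chi] is at least 1 on the [dl]-neighbourhood of the support of [dxi]. *)
Hypothesis chi_ge1 : forall x, 1 <= chi x \/
  forall l i z, `|z - x| <= dl -> dxi l i z = 0.
Hypothesis diam_le : forall m, diameter (G @` cell m) <= dl.
Hypothesis shape : forall m, diameter (G @` cell m) <= C * inradius (G @` cell m).

Let q (m : I) i := G (sd_vertex m i).

Let vertex_cell m i : cell m (sd_vertex m i).
Proof.
have im := @sd_indep _ _ _ S m.
by apply/(simplexP im) => j; rewrite bary_vertex.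
Qed.

Let image_comb m x : (G @` cell m) x -> exists c : 'I_d.+1 -> R,
  [/\ forall i, 0 <= c i, \sum_i c i = 1 & x = \sum_i c i *: q m i].
Proof.
have im := @sd_indep _ _ _ S m.
move=> [y cy <-]; exists (bary (sd_vertex m) y); split.
- by apply/(simplexP im).
- exact: sum_bary.
rewrite (GE cy) -[in LHS](bary_combination im y) affine_map_comb ?sum_bary//.
by apply: eq_bigr => i _; rewrite /q (GE (vertex_cell m i)).
Qed.

Let image_bounded m : bounded_set (G @` cell m).
Proof.
have im := @sd_indep _ _ _ S m.
have [M M0 HM] := bounded_affine_image (A m) (b m) (bounded_simplex im).
exists M; split; first by rewrite num_real.
by move=> N MN _ [y cy <-]; rewrite (GE cy); exact: le_trans (HM _ cy) (ltW MN).
Qed.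

Lemma inradius_ge0 (D : set 'rV[R]_d) : 0 <= inradius D.
Proof.
rewrite /inradius; set E := (X in sup X).
have [hs|/sup_out -> //] := pselect (has_sup E).
have [[s Es] ub] := hs; apply: (le_trans Es.1); exact: ub_le_sup.
Qed.

(** Two distinct vertices stay distinct under the invertible affine piece. By shape regularity this
    forces the inradius, and the constant [C], to be positive. *)
Let diameter_gt0 m : 0 < diameter (G @` cell m).
Proof.
have im := @sd_indep _ _ _ S m.
pose j : 'I_d.+1 := inord 1.
have j0 : j != ord0 by rewrite -val_eqE /= inordK.
apply: (@lt_le_trans _ _ (enorm (q m j - q m ord0))); last first.
  apply: enorm_le_diameter => //.
    by exists (sd_vertex m j) => //; exact: vertex_cell.
  by exists (sd_vertex m ord0) => //; exact: vertex_cell.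
apply: lt_le_trans (norm_le_enorm _); rewrite normr_gt0 subr_eq0.
apply: contra_neq j0 => qE; apply: (vertex_inj im).
apply: (can_inj (ginvK b detA m)).
by rewrite -(GE (vertex_cell m j)) -(GE (vertex_cell m ord0)).
Qed.

Local Notation zeta m := (affine_map (pulled_A A G xi m) (pulled_b A b G xi m)).

(** The value error is at most [d w], the diameter being at most 1; the trace error is at most
    [d (d w) (2 C)]. The constant is the sum of both, so one bound serves for either. *)
Let errors m x : imcell A b m x ->
  (forall l, `|zeta m x ord0 l - xi x ord0 l| <=
    d%:R * (1 + d%:R * (2 * C)) * w * chi x) /\
  `|\tr (pulled_A A G xi m) - \sum_l dxi l l x| <=
    d%:R * (1 + d%:R * (2 * C)) * w * chi x.
Proof.
move=> imx; pose D := G @` cell m.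
have cx := icellW imx.
have Dx : D x by exists (ginv A b m x) => //; rewrite (G_ginv detA GE imx).
have D0 : 0 < diameter D by exact: diameter_gt0.
have CI : 0 < C * inradius D by apply: lt_le_trans D0 _; exact: shape.
have i0 : 0 < inradius D.
  rewrite lt_neqAle inradius_ge0 andbT; apply/eqP => E.
  by rewrite -E mulr0 ltxx in CI.
have C0 : 0 < C by rewrite -(pmulr_lgt0 _ i0).
have [s s_gt [y Hy]] := inradius_ball d_gt0 (@image_bounded m) i0.
have s0 : 0 < s by move: (lt_trans i0 s_gt); rewrite pmulr_rgt0.
have [c [c0 c1 cE]] := image_comb Dx.
(* Where [chi x < 1] the derivatives of [xi] vanish near [x], so their oscillation is 0; elsewhere
   [w <= w chi x]. This is how the weight enters the error. *)
pose w' := if 1 <= chi x then w else 0.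
have w'0 : 0 <= w' by rewrite /w'; case: ifP.
have nodal i : zeta m (q m i) = xi (q m i).
  rewrite /q (GE (vertex_cell m i)) (pulled_affine _ _ detA) interp_A_b_vertex /=.
  by rewrite (GE (vertex_cell m i)).
have q_near i : `|q m i - x| <= diameter D.
  apply: (le_trans (norm_le_enorm _)).
  apply: enorm_le_diameter => //; first exact: image_bounded.
  by exists (sd_vertex m i) => //; exact: vertex_cell.
have mod' l i z : `|z - x| <= diameter D -> `|dxi l i z - dxi l i x| <= w'.
  move=> zx; have zdl : `|z - x| <= dl by apply: (le_trans zx); exact: diam_le.
  rewrite /w'; case: ifPn => [_|chi1]; first exact: modulus.
  have [|Z] := chi_ge1 x; first by rewrite (negbTE chi1).
  have dl0 : 0 <= dl by exact: le_trans zdl.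
  by rewrite !Z// ?subrr ?normr0.
(* The inscribed ball has radius [s] above half the inradius, so [2 C] plays the role of [kappa]. *)
have kE : diameter D <= 2 * C * s.
  apply: (le_trans (shape m)); rewrite -/D (_ : 2 * C * s = C * (2 * s)); last by ring.
  by rewrite ler_pM2l// ltW.
have ball_sub : [set z | enorm (z - y) <= s] `<=` simplex (q m).
  move=> z /Hy/image_comb[a [a0 a1 aE]]; exists a; split => // i.
  by rewrite inE.
have dw : d%:R * w' <= d%:R * w * chi x.
  rewrite -mulrA ler_wpM2l// /w'; case: ifPn => [chi1|_]; last by rewrite mulr_ge0.
  by rewrite ler_peMr.
have dle1 : diameter D <= 1 by exact: le_trans (diam_le m) dl_le1.
have dC : 0 <= d%:R * (2 * C) by rewrite mulr_ge0// mulr_ge0// ltW.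
have dwc0 : 0 <= d%:R * w * chi x by rewrite !mulr_ge0.
split=> [l|].
  apply: (le_trans (interp_value_error xi_derivable nodal c0 c1 cE q_near w'0 mod' l)).
  apply: (@le_trans _ _ (d%:R * w')).
    by rewrite ler_piMr// mulr_ge0.
  apply: (le_trans dw).
  rewrite (_ : d%:R * (_ + _) * w * chi x =
    d%:R * w * chi x + d%:R * (2 * C) * (d%:R * w * chi x)); last by ring.
  by rewrite lerDl mulr_ge0.
apply: (le_trans (interp_trace_error xi_derivable nodal q_near w'0 mod' s0 ball_sub kE)).
apply: (@le_trans _ _ (d%:R * (2 * C) * (d%:R * w * chi x))).
  rewrite (_ : _ * _ = d%:R * (2 * C) * (d%:R * w')); last by ring.
  by rewrite ler_wpM2l.
rewrite (_ : d%:R * (1 + _) * w * chi x =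
  d%:R * w * chi x + d%:R * (2 * C) * (d%:R * w * chi x)); last by ring.
by rewrite lerDr.
Qed.

Lemma pulled_value_error m x l : imcell A b m x ->
  `|zeta m x ord0 l - xi x ord0 l| <= d%:R * (1 + d%:R * (2 * C)) * w * chi x.
Proof. by move=> /errors[]. Qed.

Lemma pulled_trace_error m x : imcell A b m x ->
  `|\tr (pulled_A A G xi m) - \sum_l dxi l l x| <=
  d%:R * (1 + d%:R * (2 * C)) * w * chi x.
Proof. by move=> /errors[]. Qed.

End interpolation_on_image.

(** * Functions piecewise constant in time *)

Section piecewise_constant_in_time.
Variables (R : realType) (d : nat).
Local Notation leb := (lebesgue_rV R d).
Local Notation mu := (@lebesgue_measure R \x lebesgue_rV R d)%E.

Definition nice (F : 'rV[R]_d -> R) : Prop :=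
  [/\ measurable_fun setT F, (exists B, forall x, `|F x| <= B) &
      leb.-integrable setT (EFin \o F)].

Lemma pw_nice (I : finType) (E : I -> set 'rV[R]_d) (g : I -> 'rV[R]_d -> R) :
  (forall i, measurable (E i)) -> (forall i, bounded_set (E i)) ->
  (forall i, continuous (g i)) -> nice (pw E g).
Proof.
move=> mE bE gc.
have gi : leb.-integrable setT (EFin \o pw E g).
  by apply: integrable_pw => // i; exact: continuous_integrable.
split => //; first by apply/measurable_EFinP; exact: measurable_int gi.
have /choice[B HB] i : exists B, forall x, E i x -> `|g i x| <= B.
  have [B [_ HB]] := continuous_bounded_image (bE i) (gc i).
  by exists (`|B| + 1) => x Ex; apply: HB => //; rewrite ltr_pwDr// ler_norm.
exists (\sum_i `|B i|) => x; apply: (le_trans (ler_norm_sum _ _ _)).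
apply: ler_sum => i _; rewrite patchE; case: ifPn => [|_]; last by rewrite normr0.
by rewrite inE => /HB /le_trans; apply; exact: ler_norm.
Qed.

Variable tau : R.
Hypothesis tau_gt0 : 0 < tau.

(** The index used by [interpolation]. The absolute value gives negative times an index too, so
    [in_time] is defined on all of space-time. *)
Definition step_index (t : R) : nat := `|Num.ceil (t / tau)|%N.

Definition in_time (X : Type) (F : nat -> 'rV[R]_d -> X)
    (z : measurableTypeR R * 'rV[R]_d) : X := F (step_index z.1) z.2.

Lemma step_index_gt0 t : 0 < t -> (0 < step_index t)%N.
Proof.
move=> t0; have /andP[_ c2] := ceil_itv (t / tau).
rewrite /step_index absz_gt0 gt_eqF// -(ltr0z R).
by apply: lt_le_trans c2; rewrite divr_gt0.
Qed.

Lemma step_index_le t M : `|t| <= M -> (step_index t)%:R <= M / tau + 1.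
Proof.
move=> tM; have tx : `|t / tau| <= M / tau.
  by rewrite normrM [`|tau^-1|]gtr0_norm ?invr_gt0// ler_wpM2r// invr_ge0 ltW.
have /andP[c1 c2] := ceil_itv (t / tau).
rewrite /step_index natr_absz intr_norm ler_norml.
move: tx; rewrite ler_norml => /andP[h1 h2].
move: c1; rewrite intrD => c1.
by apply/andP; split; lra.
Qed.

(** Two half-open intervals, for the ceilings [n] and [- n]. *)
Lemma measurable_step_index n :
  measurable ([set t | step_index t = n] : set (measurableTypeR R)).
Proof.
have mc (c : int) : measurable ([set t | Num.ceil (t / tau) = c] : set (measurableTypeR R)).
  rewrite (_ : [set _ | _] = `](c - 1)%:~R * tau, c%:~R * tau]%classic)//.
  apply/seteqP; split => t /=; rewrite in_itv /= -ltr_pdivlMr// -ler_pdivrMr//.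
    by move=> <-; exact: ceil_itv.
  exact: ceil_def.
rewrite (_ : [set _ | _] = [set t | Num.ceil (t / tau) = n%:Z] `|`
    [set t | Num.ceil (t / tau) = - n%:Z]); first by apply: measurableU.
apply/seteqP; split => t /=; rewrite /step_index.
  by move=> <-; case: (Num.ceil _) => m; [left|right; rewrite NegzE].
by move=> [->|->]; rewrite ?abszN absz_nat.
Qed.

Lemma measurable_in_time (F : nat -> 'rV[R]_d -> R) :
  (forall n, measurable_fun setT (F n)) -> measurable_fun setT (in_time F).
Proof.
move=> mF _ Y mY; rewrite setTI.
rewrite (_ : in_time F @^-1` Y =
    \bigcup_n ([set t | step_index t = n] `*` (F n @^-1` Y))); last first.
  apply/seteqP; split => [[t x] /= FY|[t x] [n _ [/= <- FY]]//].
  by exists (step_index t).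
apply: bigcupT_measurable => n; apply: measurableX; first exact: measurable_step_index.
by rewrite -[X in measurable X]setTI; exact: mF.
Qed.

Lemma integrable_bounded_box (f : measurableTypeR R * 'rV[R]_d -> R) (B M : R) :
  measurable_fun setT f -> (forall z, `|f z| <= B) ->
  (forall z, f z != 0 -> `|z.1| <= M /\ `|z.2| <= M) ->
  mu.-integrable setT (EFin \o f).
Proof.
move=> mf fB f0; pose Q : set (measurableTypeR R * 'rV[R]_d) :=
  `[- M, M]%classic `*` [set x | `|x| <= M].
have mball : measurable [set x : 'rV[R]_d | `|x| <= M].
  rewrite -[X in measurable X]setCK; apply: measurableC; apply: open_measurable_mx.
  by rewrite openC; apply: compact_closed; [exact: norm_hausdorff|exact: closed_ball0_compact].
have mQ : measurable Q by apply: measurableX.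
have Qoo : (mu Q < +oo)%E.
  rewrite /Q product_measure1E//; apply: lte_mul_pinfty => //.
    rewrite [X in X \is a fin_num](lebesgue_measure_itv `[- M, M]) /=.
    by case: ifP => _; rewrite -?EFinB.
  by apply: bounded_set_lty => //; exists M; split; [rewrite num_real|
    move=> N MN x /= /le_trans; apply; exact: ltW].
have fi : mu.-integrable Q (EFin \o f).
  apply: measurable_bounded_integrable => //; first exact: measurable_funTS.
  by exists B; split; [rewrite num_real|move=> N BN z _; exact: le_trans (fB z) (ltW BN)].
move/(integrable_mkcond _ mQ): fi; apply: eq_integrable => // z _.
rewrite patchE; case: ifPn => // /negP; rewrite inE => nQ.
congr EFin; apply/esym/eqP; apply: contrapT => /negP /f0[z1 z2]; apply: nQ.
by split => //=; rewrite in_itv /= -ler_norml.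
Qed.

Definition compactly_supported (phi : R * 'rV[R]_d -> R) : Prop :=
  continuous phi /\ exists C, compact C /\ forall z, ~ C z -> phi z = 0.

Lemma compactly_supported_bounded phi : compactly_supported phi ->
  exists B M, (forall z, `|phi z| <= B) /\
    (forall z, phi z != 0 -> `|z.1| <= M /\ `|z.2| <= M).
Proof.
move=> [pc [C [cC C0]]].
have [M [_ HM]] := compact_bounded cC.
have cpC : compact (phi @` C) by apply: continuous_compact => //; exact: continuous_subspaceT.
have [B [_ HB]] := compact_bounded cpC.
exists (`|B| + 1), (`|M| + 1).
have lt1 (x : R) : x < `|x| + 1 by rewrite ltr_pwDr// ler_norm.
split=> z.
  have [Cz|/C0 ->] := pselect (C z); last by rewrite normr0.
  by apply: (HB _ (lt1 B)); exists z.
move=> pz; have Cz : C z by apply: contrapT => /C0; apply/eqP.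
have := HM _ (lt1 M) _ Cz; rewrite /= prod_normE => H.
by split; apply: le_trans H; rewrite le_max lexx ?orbT.
Qed.

(** Only finitely many steps meet a bounded time interval, so bounds that depend on the step
    suffice. *)
Lemma in_time_bounded (F : nat -> 'rV[R]_d -> R) M : (forall n, nice (F n)) ->
  exists B, forall z, `|z.1| <= M -> `|in_time F z| <= B.
Proof.
move=> nF.
have /choice[B HB] n : exists B, forall x, `|F n x| <= B by case: (nF n).
have [N MN] : exists N : nat, M / tau + 1 < N%:R.
  exists (Num.bound `|M / tau + 1|).
  exact: le_lt_trans (ler_norm _) (archi_boundP (normr_ge0 _)).
exists (\sum_(n < N) `|B n|) => z zM; rewrite /in_time.
have lN : (step_index z.1 < N)%N.
  by rewrite -(ltr_nat R); apply: le_lt_trans MN; exact: step_index_le.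
rewrite (bigD1 (Ordinal lN))//=; apply: (le_trans (HB _ _)).
by apply: (le_trans (ler_norm _)); rewrite lerDl sumr_ge0.
Qed.

Lemma integrable_in_time (F : nat -> 'rV[R]_d -> R) phi :
  (forall n, nice (F n)) -> compactly_supported phi ->
  mu.-integrable setT (EFin \o (fun z => in_time F z * phi z)).
Proof.
move=> nF cphi; have [B [M [HB HM]]] := compactly_supported_bounded cphi.
have [B' HB'] := @in_time_bounded F M nF.
apply: (@integrable_bounded_box _ (`|B'| * `|B|) M).
- apply: measurable_funM; last by apply: continuous_measurable_prod; case: cphi.
  by apply: measurable_in_time => n; case: (nF n).
- move=> z; have [pz|pz] := eqVneq (phi z) 0; first by rewrite pz mulr0 normr0 mulr_ge0.
  rewrite normrM ler_pM//; last exact: (le_trans (HB z) (ler_norm _)).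
  by apply: le_trans (HB' _ (HM _ pz).1) (ler_norm _).
- by move=> z; rewrite mulf_eq0 negb_or => /andP[_]; exact: HM.
Qed.

(** Agreement is asked from step 1 on, where velocities start. Among times [t >= 0], step 0 occupies
    only [t = 0]; this slice and the spatial null sets spread over all times are null in
    space-time. *)
Lemma integral_in_time_eq (D : set (measurableTypeR R * 'rV[R]_d))
    (f F : nat -> 'rV[R]_d -> R) (N : nat -> set 'rV[R]_d) phi :
  (forall n, measurable (N n)) -> (forall n, leb (N n) = 0%E) ->
  (forall n x, ~ N n.+1 x -> f n.+1 x = F n.+1 x) ->
  (forall z, D z -> 0 <= z.1) ->
  (\int[mu]_(z in D) (in_time f z * phi z)%:E =
   \int[mu]_(z in D) (in_time F z * phi z)%:E)%E.
Proof.
move=> mN N0 fF D0.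
pose Z : set (measurableTypeR R * 'rV[R]_d) := [set 0] `*` setT.
pose Y := \bigcup_n ([set: measurableTypeR R] `*` N n).
have m0 : measurable ([set 0] : set (measurableTypeR R)).
  exact: measurable_set1.
have mZ : measurable Z by exact: measurableX.
have mYn n : measurable ([set: measurableTypeR R] `*` N n).
  by apply: measurableX; [exact: measurableT|exact: mN].
have mY : measurable Y by exact: bigcupT_measurable.
have Z0 : mu Z = 0%E.
  rewrite /Z product_measure1E//.
  by rewrite [X in (X * _)%E](lebesgue_measure_set1 0) mul0e.
have Y0 : mu Y = 0%E.
  apply/(negligibleP _ mY); apply: negligible_bigcup => n.
  have Yn0 : mu ([set: measurableTypeR R] `*` N n) = 0%E.
    by rewrite product_measure1E// N0 mule0.
  exact/(negligibleP _ (mYn n)).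
apply: (eq_integral_off_null (N := Z `|` Y)).
- exact: measurableU.
- by rewrite measureU0.
move=> [t x] /D0 /= t0 /not_orP[nZ nY]; congr (_ * _)%:E; rewrite /in_time /=.
have {}t0 : 0 < t.
  by rewrite lt_neqAle t0 andbT eq_sym; apply/eqP => tE; apply: nZ; split.
case E : (step_index t) (step_index_gt0 t0) => [//|n] _; apply: fF => Nx.
by apply: nY; exists n.+1.
Qed.

End piecewise_constant_in_time.

(** * All time steps of one discretization *)

Section one_discretization.
Variables (R : realType) (d : nat) (K : set 'rV[R]_d).
Variable S : simplicial_decomposition K.
Hypothesis d_gt0 : (0 < d)%N.
Local Notation leb := (lebesgue_rV R d).
Local Notation I := 'I_(sd_size S).
Local Notation cell := (@cell R d K S).
Local Notation icell := (@icell R d K S).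
Local Notation affine_on := (@affine_on R d K S).
Local Notation imcell := (@imcell R d K S).
Variables (h : R -> R) (V : 'rV[R]_d -> R).
Hypothesis h_ok : entropy_density h.
Hypothesis V_C1 : Ck 1 V.
Hypothesis V_ge0 : forall x, 0 <= V x.
Variables (r : I -> R) (rr : 'rV[R]_d -> R).
Hypothesis r_ge0 : forall m, 0 <= r m.
Hypothesis rrE : forall m w, icell m w -> rr w = r m.
Variables (A : nat -> I -> 'M[R]_d) (b : nat -> I -> 'rV[R]_d).
Variable G : nat -> 'rV[R]_d -> 'rV[R]_d.
Hypothesis detA : forall n m, 0 < \det (A n m).
Hypothesis GE : forall n, affine_on (G n) (A n) (b n).
Hypothesis G_inj : forall n, set_inj K (G n).
Variable tau : R.
Hypothesis tau_gt0 : 0 < tau.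
Hypothesis G_adm : forall n, admissible S (G n).
Hypothesis G_min : forall n,
  is_minimizer S (fun G' => energy_tau K tau h V rr G' (G n)) (G n.+1).
Variables (rho : nat -> 'rV[R]_d -> R) (v : nat -> 'rV[R]_d -> 'rV[R]_d).
Hypothesis rho_push : forall n, push_density K (G n) rr (rho n).
Hypothesis v_induced : forall n, induced_velocity K tau (G n) (G n.+1) (v n.+1).

Local Notation im n := (imcell (A n) (b n)).
Local Notation dens n := (image_density r (A n)).
(* [vel n] is only meaningful for [n > 0]. *)
Local Notation vel n := (velocity (A n) (b n) (A n.-1) (b n.-1) tau).

Definition step_density n := pw (im n) (fun m _ => dens n m).
Definition step_pressure n := pw (im n) (fun m _ => pressure h (dens n m)).
Definition step_momentum l n := pw (im n) (fun m x => dens n m * vel n m x ord0 l).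
Definition step_kinetic n :=
  pw (im n) (fun m x => dens n m * dotv (vel n m x) (vel n m x)).

Let tI n : trivIset setT (im n).
Proof. exact: (trivIset_imcell (detA n) (@GE n) (@G_inj n)). Qed.

Let nice_im n (g : I -> 'rV[R]_d -> R) :
  (forall m, continuous (g m)) -> nice (pw (im n) g).
Proof.
by apply: pw_nice => m; [exact: measurable_imcell|exact: bounded_imcell].
Qed.

Let continuous_vel2 n m : continuous (fun x => dotv (vel n m x) (vel n m x)).
Proof. by apply: continuous_dotv2 => i; exact: continuous_velocity. Qed.

Lemma step_density_nice n : nice (step_density n).
Proof. by apply: nice_im => m; exact: cst_continuous. Qed.

Lemma step_pressure_nice n : nice (step_pressure n).
Proof. by apply: nice_im => m; exact: cst_continuous. Qed.

Lemma step_momentum_nice l n : nice (step_momentum l n).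
Proof.
by apply: nice_im => m; apply: continuous_fun_scale; exact: continuous_velocity.
Qed.

Lemma step_kinetic_nice n : nice (step_kinetic n).
Proof. by apply: nice_im => m; exact: continuous_fun_scale. Qed.

Let dens_ge0 n m : 0 <= dens n m.
Proof. exact: image_density_ge0. Qed.

Lemma step_density_ge0 n x : 0 <= step_density n x.
Proof. exact: pw_ge0. Qed.

Lemma step_pressure_ge0 n x : 0 <= step_pressure n x.
Proof. by apply: pw_ge0 => m _; exact: pressure_ge0. Qed.

Lemma step_kinetic_ge0 n x : 0 <= step_kinetic n x.
Proof. by apply: pw_ge0 => m _; rewrite mulr_ge0// dotv_ge0. Qed.

Lemma step_density_ae : exists N : nat -> set 'rV[R]_d,
  [/\ forall n, measurable (N n), forall n, leb (N n) = 0%E &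
      forall n x, ~ N n x -> rho n x = step_density n x].
Proof.
have /choice[N HN] n : exists N, [/\ measurable N, leb N = 0%E &
    forall x, ~ N x -> rho n x = step_density n x].
  exact: (push_density_pw d_gt0 (detA n) (@GE n) rrE (rho_push n)).
by exists N; split => n; case: (HN n).
Qed.

Lemma pressure_step_density n x : pressure h (step_density n x) = step_pressure n x.
Proof. by rewrite /step_density pw_comp// pressure0. Qed.

(** Off the image cells [v] is arbitrary, but there the piecewise density is 0. *)
Lemma velocity_step_density l n x :
  v n.+1 x ord0 l * step_density n.+1 x = step_momentum l n.+1 x.
Proof.
have [[m mx]|nx] := pselect (exists m, im n.+1 m x).
  rewrite /step_density /step_momentum !(pw_in _ (@tI n.+1) mx) mulrC; congr (_ * _).
  by rewrite (induced_velocity_imcell (detA n.+1) (@GE n.+1) (@GE n) (v_induced n) mx).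
by rewrite /step_density /step_momentum !pw_out ?mulr0// => m mx; apply: nx; exists m.
Qed.

Lemma step_momentum_le l n x :
  `|step_momentum l n x| <= step_density n x + step_kinetic n x.
Proof.
have [[m mx]|nx] := pselect (exists m, im n m x); last first.
  have out m : ~ im n m x by move=> mx; apply: nx; exists m.
  by rewrite /step_density /step_momentum /step_kinetic !(pw_out _ out) normr0 addr0.
rewrite /step_density /step_momentum /step_kinetic !(pw_in _ (@tI n) mx).
rewrite normrM ger0_norm// -[X in _ <= X + _]mulr1 -mulrDr ler_wpM2l//.
set u := vel n m x; rewrite /dotv (bigD1 l)//=.
have s0 : 0 <= \sum_(i < d | i != l) u ord0 i * u ord0 i.
  by apply: sumr_ge0 => i _; rewrite -expr2 sqr_ge0.
(* Expanding the square gives [2 |u_l| <= 1 + u_l^2], more than is needed. *)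
have := sqr_ge0 (`|u ord0 l| - 1).
have : `|u ord0 l| ^+ 2 = u ord0 l * u ord0 l by rewrite real_normK ?num_real// expr2.
rewrite sqrrB1 => -> ; have := normr_ge0 (u ord0 l); lra.
Qed.

Lemma mass_conserved n : (\int[leb]_x (rho n x)%:E = \int[leb]_x (rho 0%N x)%:E)%E.
Proof.
have [_ _ H] := rho_push n; have [_ _ H0] := rho_push 0%N.
by rewrite H// H0// !preimage_setT.
Qed.

Lemma integral_step_density n :
  (\int[leb]_x (step_density n x)%:E = \int[leb]_x (rho 0%N x)%:E)%E.
Proof.
rewrite -(mass_conserved n); have [N [mN N0 NE]] := step_density_ae.
by apply: (eq_integral_off_null (mN n) (N0 n)) => x _ nx; rewrite NE.
Qed.

Let energy_of n := \sum_m cell_energy h V r (A n) (b n) m.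

Let integral_step_kinetic n : \int[leb]_x step_kinetic n x =
  \sum_m \int[leb]_(x in im n m) (dens n m * dotv (vel n m x) (vel n m x)).
Proof.
rewrite /Rintegral integral_pw//; first by move=> m; exact: measurable_imcell.
move=> m; apply: integrable_imcell => //; exact: continuous_fun_scale.
Qed.

Lemma kinetic_sum_le N : ((tau / 2 * \sum_(n < N) \int[leb]_x step_kinetic n.+1 x)%:E
  <= entropy h V (rho 0%N))%E.
Proof.
rewrite (entropyE d_gt0 h_ok V_C1 rrE (detA 0%N) (@GE 0%N) (@G_inj 0%N) (rho_push 0%N)).
rewrite lee_fin -/(energy_of 0%N).
(* The induction keeps the energy of the current step, so that the sum telescopes; being
   nonnegative, this energy is dropped at the end. *)
suff : tau / 2 * \sum_(n < N) \int[leb]_x step_kinetic n.+1 x + energy_of N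
    <= energy_of 0%N.
  apply: le_trans; rewrite lerDl; apply: sumr_ge0 => m _; exact: cell_energy_ge0.
elim: N => [|n IH]; first by rewrite big_ord0 mulr0 add0r.
apply: le_trans IH; rewrite big_ord_recr/= mulrDr -addrA lerD2l.
rewrite integral_step_kinetic.
exact: (energy_decrease d_gt0 h_ok V_C1 rrE (detA n.+1) (@GE n.+1) (@GE n) tau_gt0
  (detA n) (G_min n) (G_adm n)).
Qed.

Definition momentum_balance n (xi dxi : 'I_d -> 'rV[R]_d -> R) x : R :=
  \sum_l step_momentum l n x * xi l x +
  step_density n x * (\sum_l grad V x ord0 l * xi l x) -
  step_pressure n x * \sum_l dxi l x.

Definition momentum_size n (chi : 'rV[R]_d -> R) x : R :=
  (\sum_l `|step_momentum l n x| + step_density n x * \sum_l `|grad V x ord0 l| +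
   step_pressure n x) * chi x.

Section weak_estimate.
Variables (n : nat) (xi : 'I_d -> 'rV[R]_d -> R).
Let dxi l i : 'rV[R]_d -> R := 'D_(delta_mx ord0 i) (xi l).
Hypothesis xi_derivable : forall l i z, derivable (xi l) z (delta_mx ord0 i).
Hypothesis xi_cont : forall l, continuous (xi l).
Hypothesis dxi_cont : forall l i, continuous (dxi l i).
Variables (chi : 'rV[R]_d -> R) (dl C w : R).
Hypothesis chi_cont : continuous chi.
Hypothesis chi_ge0 : forall x, 0 <= chi x.
Hypothesis w_ge0 : 0 <= w.
Hypothesis dl_le1 : dl <= 1.
Hypothesis modulus : forall l i z z', `|z - z'| <= dl -> `|dxi l i z - dxi l i z'| <= w.
Hypothesis chi_ge1 : forall x, 1 <= chi x \/
  forall l i z, `|z - x| <= dl -> dxi l i z = 0.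
Hypothesis diam_le : forall m, diameter (G n.+1 @` cell m) <= dl.
Hypothesis shape : forall m,
  diameter (G n.+1 @` cell m) <= C * inradius (G n.+1 @` cell m).

Let xiv x : 'rV[R]_d := \row_l xi l x.

Let xivE l : (fun x => xiv x ord0 l) = xi l.
Proof. by apply/funext => x; rewrite mxE. Qed.

(** Both integrands vanish off the image cells, so the cellwise sums become integrals over the whole
    space, ready to be integrated in time. *)
Lemma weak_estimate :
  (`|\int[leb]_x (momentum_balance n.+1 xi (fun l => dxi l l) x)%:E| <=
  (d%:R * (1 + d%:R * (2 * C)) * w)%:E * \int[leb]_x (momentum_size n.+1 chi x)%:E)%E.
Proof.
have xd l i z : derivable (fun x => xiv x ord0 l) z (delta_mx ord0 i).
  by rewrite xivE.
have xc l : continuous (fun x => xiv x ord0 l) by rewrite xivE.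
have dxc l i : continuous ('D_(delta_mx ord0 i) (fun x => xiv x ord0 l)).
  by rewrite xivE; exact: dxi_cont.
have md l i z z' : `|z - z'| <= dl ->
    `|'D_(delta_mx ord0 i) (fun x => xiv x ord0 l) z -
      'D_(delta_mx ord0 i) (fun x => xiv x ord0 l) z'| <= w.
  by rewrite xivE; exact: modulus.
have c1 x : 1 <= chi x \/ forall l i z, `|z - x| <= dl ->
    'D_(delta_mx ord0 i) (fun x => xiv x ord0 l) z = 0.
  have [|H] := chi_ge1 x; [by left|right => l i z zx; rewrite xivE; exact: H].
have H := weak_form_error d_gt0 h_ok V_C1 r_ge0 rrE (detA n.+1) (@GE n.+1) (@GE n)
  tau_gt0 (G_min n) (@xc) (@dxc) (@chi_cont)
  (fun m x l mx => pulled_value_error d_gt0 (detA n.+1) (@GE n.+1) xd chi_ge0 w_ge0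
    dl_le1 md c1 diam_le shape l mx)
  (fun m x mx => pulled_trace_error d_gt0 (detA n.+1) (@GE n.+1) xd chi_ge0 w_ge0
    dl_le1 md c1 diam_le shape mx).
have iE (g : I -> 'rV[R]_d -> R) : (forall m, continuous (g m)) ->
    (\int[leb]_x (pw (im n.+1) g x)%:E =
     (\sum_m \int[leb]_(x in im n.+1 m) g m x)%:E)%E.
  move=> gc; rewrite integral_pw//; first by move=> m; exact: measurable_imcell.
  by move=> m; exact: integrable_imcell.
have E1 : momentum_balance n.+1 xi (fun l => dxi l l) =
    pw (im n.+1) (weak_integrand h V r (A n.+1) (b n.+1) (A n) (b n) tau
      (fun _ => xiv)
      (fun _ x => \sum_l 'D_(delta_mx ord0 l) (fun z => xiv z ord0 l) x)).
  apply/funext => x; have [[m mx]|nx] := pselect (exists m, im n.+1 m x); last first.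
    have out m : ~ im n.+1 m x by move=> mx; apply: nx; exists m.
    rewrite /momentum_balance /step_momentum /step_density /step_pressure.
    rewrite (eq_bigr (fun=> 0)) => [|l _]; last by rewrite (pw_out _ out) mul0r.
    by rewrite !(pw_out _ out) big1_eq !mul0r addr0 subrr.
  rewrite /momentum_balance /step_momentum /step_density /step_pressure.
  rewrite !(pw_in _ (@tI n.+1) mx) /weak_integrand /dotv.
  congr (_ + _ - _ * _).
  - rewrite mulr_sumr; apply: eq_bigr => l _.
    by rewrite (pw_in _ (@tI n.+1) mx) -mulrA; congr (_ * _); rewrite mulrC;
    congr (_ * _); rewrite /xiv mxE.
  - by congr (_ * _); apply: eq_bigr => l _; rewrite mulrC; congr (_ * _); rewrite /xiv mxE.
  - by apply: eq_bigr => l _; rewrite xivE.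
have E2 : momentum_size n.+1 chi =
    pw (im n.+1) (error_integrand h V r (A n.+1) (b n.+1) (A n) (b n) tau chi).
  apply/funext => x; have [[m mx]|nx] := pselect (exists m, im n.+1 m x); last first.
    have out m : ~ im n.+1 m x by move=> mx; apply: nx; exists m.
    rewrite /momentum_size /step_momentum /step_density /step_pressure.
    rewrite (eq_bigr (fun=> 0)) => [|l _]; last by rewrite (pw_out _ out) normr0.
    by rewrite !(pw_out _ out) big1_eq !mul0r !addr0 mul0r.
  rewrite /momentum_size /step_momentum /step_density /step_pressure.
  rewrite !(pw_in _ (@tI n.+1) mx) /error_integrand; congr ((_ + _ + _) * _).
  rewrite mulr_sumr; apply: eq_bigr => l _.
  by rewrite (pw_in _ (@tI n.+1) mx) normrM [`|dens _ _|]ger0_norm.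
rewrite E1 E2 !iE ?lee_fin// => m; first exact: continuous_error_integrand.
apply: continuous_weak_integrand => [|l|]; first exact: V_C1.
  exact: xc.
by apply: continuous_sum => l; exact: dxc.
Qed.

End weak_estimate.

End one_discretization.

(** * Smooth functions and their slices at fixed time *)

Section smooth_functions.
Variable R : realType.
Implicit Types X : normedModType R.

Lemma Cinfty_continuous X (f : X -> R) : Cinfty f -> continuous f.
Proof. by move=> /(_ 0%N)[]. Qed.

Lemma Cinfty_derive X (f : X -> R) v : Cinfty f -> Cinfty ('D_v f).
Proof. by move=> fC n; have [_ /(_ v)[_]] := fC n.+1. Qed.

Lemma Cinfty_derivable X (f : X -> R) z v : Cinfty f -> derivable f z v.
Proof. by move=> /(_ 1%N)[_ /(_ v)[+ _]]; apply. Qed.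

Lemma derive_out X (C : set X) (f : X -> R) v : closed C ->
  (forall z, ~ C z -> f z = 0) -> forall z, ~ C z -> 'D_v f z = 0.
Proof.
move=> cC f0 z nCz.
rewrite (@near_eq_derive _ _ _ f (cst 0)) ?derive_cst//.
have : nbhs z (~` C) by apply: open_nbhs_nbhs; split => //; rewrite openC.
by apply: filterS => y; exact: f0.
Qed.

Variable d : nat.
Implicit Type f : R * 'rV[R]_d -> R.

Let slice_quotient f t (x v : 'rV[R]_d) :
  (fun s : R => s^-1 *: (((fun y => f (t, y)) \o shift x) (s *: v) - f (t, x))) =
  (fun s : R => s^-1 *: ((f \o shift (t, x)) (s *: ((0, v) : R * 'rV[R]_d)) - f (t, x))).
Proof.
apply/funext => s /=; congr (_ *: (f _ - _)).
by congr pair; rewrite /= scaler0 add0r.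
Qed.

Lemma derive_slice f t (x v : 'rV[R]_d) :
  'D_v (fun y => f (t, y)) x = 'D_((0, v) : R * 'rV[R]_d) f (t, x).
Proof. by rewrite /derive slice_quotient. Qed.

Lemma derivable_slice f t (x v : 'rV[R]_d) :
  derivable f (t, x) ((0, v) : R * 'rV[R]_d) -> derivable (fun y => f (t, y)) x v.
Proof. by rewrite /derivable slice_quotient. Qed.

Lemma continuous_slice f t : continuous f -> continuous (fun y => f (t, y)).
Proof.
move=> fc x; apply: (@continuous_comp _ _ _ (fun y => (t, y)) f); last exact: fc.
exact: (@cvg_pair _ _ _ (nbhs x) (nbhs t) (nbhs x) _ _ _ (fun=> t) id (cvg_cst t) cvg_id).
Qed.

End smooth_functions.

(** * Derivatives of a test function *)

Section test_functions.
Variables (R : realType) (d : nat) (phi : R * 'rV[R]_d -> R).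
Hypothesis phi_smooth : Cinfty phi.
Variable C : set (R * 'rV[R]_d).
Hypothesis C_compact : compact C.
Hypothesis phi0 : forall z, ~ C z -> phi z = 0.

(** Relative to one fixed compact [C]: all functions derived from [phi] vanish off the same set, so
    they can be tested on the same slabs. *)
Definition supported (f : R * 'rV[R]_d -> R) : Prop :=
  continuous f /\ forall z, ~ C z -> f z = 0.

Lemma supported_compactly f : supported f -> compactly_supported f.
Proof. by move=> [fc f0]; split => //; exists C. Qed.

Let C_closed : closed C.
Proof. apply: compact_closed => //; exact: norm_hausdorff. Qed.

Lemma dx_smooth l : Cinfty (dx l phi).
Proof. exact: Cinfty_derive. Qed.

Lemma supported_derive f v : Cinfty f -> (forall z, ~ C z -> f z = 0) ->
  supported ('D_v f).
Proof.
move=> fC f0; split; last exact: derive_out.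
by apply: Cinfty_continuous; exact: Cinfty_derive.
Qed.

Lemma supported_dt : supported (dt phi).
Proof. exact: supported_derive. Qed.

Lemma supported_dx l : supported (dx l phi).
Proof. exact: supported_derive. Qed.

Lemma supported_dxx i l : supported (dx i (dx l phi)).
Proof. by apply: supported_derive; [exact: dx_smooth|have [] := supported_dx l]. Qed.

Lemma supported_sum n (f : 'I_n -> R * 'rV[R]_d -> R) :
  (forall i, supported (f i)) -> supported (fun z => \sum_i f i z).
Proof.
move=> fs; split; first by apply: continuous_sum => i; have [] := fs i.
by move=> z nz; rewrite big1// => i _; have [_ ->] := fs i.
Qed.

Lemma supported_mul (g : 'rV[R]_d -> R) f : continuous g -> supported f ->
  supported (fun z => g z.2 * f z).
Proof.
move=> gc [fc f0]; split; last by move=> z /f0 ->; rewrite mulr0.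
apply: continuous_fun_mul => // z.
by apply: continuous_comp; [exact: cvg_snd|exact: gc].
Qed.

Lemma supported_laplx : supported (laplx phi).
Proof. by apply: supported_sum => i; exact: supported_dxx. Qed.

Lemma supported_Cc D f : supported f -> C `<=` D -> Cc D f.
Proof.
move=> [fc f0] CD; split; first exact: continuous_subspaceT.
by exists C; split => // z _; exact: f0.
Qed.

End test_functions.

(** * Integrals over time slabs *)

Section slab_integrals.
Variables (R : realType) (d : nat).
Local Notation leb := (lebesgue_rV R d).
Local Notation mu := (@lebesgue_measure R \x lebesgue_rV R d)%E.
Local Notation slab := (@slab R d).
Local Notation spacetime := (measurableTypeR R * 'rV[R]_d)%type.

Lemma integral_supported (D : set spacetime) (f : spacetime -> R) :
  (forall z, ~ D z -> f z = 0) ->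
  (\int[mu]_(z in D) (f z)%:E = \int[mu]_z (f z)%:E)%E.
Proof.
move=> f0; rewrite integral_mkcond; apply: eq_integral => z _.
by rewrite patchE; case: ifPn => // /negP; rewrite inE => /f0 ->.
Qed.

Lemma integrable_fun_sum (I : finType) (f : I -> spacetime -> R) :
  (forall i, mu.-integrable setT (EFin \o f i)) ->
  mu.-integrable setT (EFin \o (fun z => \sum_i f i z)).
Proof.
move=> fi; rewrite (_ : _ \o _ = (fun z => \sum_(i <- index_enum I) (EFin \o f i) z)%E).
  by apply: integrable_sum.
by apply/funext => z /=; rewrite sumEFin.
Qed.

Lemma Rintegral_sum (I : finType) (f : I -> spacetime -> R) :
  (forall i, mu.-integrable setT (EFin \o f i)) ->
  \int[mu]_z (\sum_i f i z) = \sum_i \int[mu]_z f i z.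
Proof.
move=> fi; apply: EFin_inj; rewrite -sumEFin [in LHS]/Rintegral fineK; last first.
  exact: integrable_fin_num (integrable_fun_sum fi).
under [LHS]eq_integral do rewrite -sumEFin.
rewrite integral_sum//; apply: eq_bigr => i _.
by rewrite fineK//; exact: integrable_fin_num (fi i).
Qed.

Lemma measurable_slab (I : interval R) : measurable (slab I).
Proof. by apply: measurableX => //; exact: measurable_itv. Qed.

Lemma slab_tonelli (I : interval R) (q : spacetime -> R) :
  measurable_fun setT q -> (forall z, 0 <= q z) ->
  (\int[mu]_(z in slab I) (q z)%:E =
   \int[lebesgue_measure]_(t in [set` I]) \int[leb]_x (q (t, x))%:E)%E.
Proof.
move=> mq q0; rewrite integral_mkcond fubini_tonelli1//; last first.
- by move=> z; rewrite patchE; case: ifP => // _; rewrite lee_fin.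
- apply/(measurable_restrictT _ (measurable_slab I)).
  by apply: measurable_funTS; exact/measurable_EFinP.
rewrite [RHS]integral_mkcond; apply: eq_integral => t _.
rewrite /fubini_F patchE; case: ifPn => tI.
  apply: eq_integral => x _; rewrite patchE mem_set//.
  by split => //=; rewrite inE in tI.
rewrite integral0_eq// => x _; rewrite patchE memNset// => -[/= tI' _].
by move/negP: tI; apply; rewrite inE.
Qed.

(** Fubini for the integrable [j] and Tonelli for the nonnegative [q], whose integral may be
    infinite; the bound at fixed time is integrated in between. *)
Lemma slab_integral_le (T w : R) (j q : spacetime -> R) :
  mu.-integrable setT (EFin \o j) -> (forall (t : R) x, ~ (0 < t < T) -> j (t, x) = 0) ->
  measurable_fun setT q -> (forall z, 0 <= q z) -> 0 <= w ->
  (forall t : R, (0 < t)%R -> (t < T)%R ->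
    `|\int[leb]_x (j (t, x))%:E| <= w%:E * \int[leb]_x (q (t, x))%:E)%E ->
  (`|\int[mu]_z (j z)%:E| <= w%:E * \int[mu]_(z in slab `]0, T[%R) (q z)%:E)%E.
Proof.
move=> ij j0 mq q0 w0 jq.
have mqt : measurable_fun [set: measurableTypeR R] (fun t => \int[leb]_x (q (t, x))%:E)%E.
  apply: (measurable_fun_fubini_tonelli_F (m2 := leb) (EFin \o q)) => //.
  exact/measurable_EFinP.
have qt0 t : (0 <= \int[leb]_x (q (t, x))%:E)%E.
  by apply: integral_ge0 => x _; rewrite lee_fin.
rewrite slab_tonelli// -ge0_integralZl//; last first.
  by apply: measurable_funTS.
rewrite -(integral12_prod_meas1 ij).
have mjt := measurable_int _ (integrable_fubini_F ij).
apply: (le_trans (le_abse_integral _ _ mjt)) => //.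
rewrite [leRHS]integral_mkcond; apply: ge0_le_integral => //.
- exact: measurableT_comp.
- apply/(measurable_restrictT _ (measurable_itv _)).
  by apply: measurable_funTS; exact: measurable_funeM.
move=> t _; rewrite patchE /fubini_F; case: ifPn.
  by rewrite inE /= in_itv /= => /andP[]; exact: jq.
move=> tn; rewrite integral0_eq ?abse0// => x _; rewrite /= j0//.
by move=> tT; move/negP: tn; apply; rewrite inE /= in_itv.
Qed.

Variable tau : R.
Hypothesis tau_gt0 : 0 < tau.
Variable F : nat -> 'rV[R]_d -> R.
Hypothesis mF : forall n, measurable_fun setT (F n).
Hypothesis F_ge0 : forall n x, 0 <= F n x.

Let mass n : \bar R := (\int[leb]_x (F n x)%:E)%E.

Let mass_ge0 n : (0 <= mass n)%E.
Proof. by apply: integral_ge0 => x _; rewrite lee_fin. Qed.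

Lemma integral_slab_in_time (I : interval R) :
  (\int[mu]_(z in slab I) (in_time tau F z)%:E =
   \int[lebesgue_measure]_(t in [set` I]) mass (step_index tau t))%E.
Proof.
rewrite slab_tonelli//; first exact: measurable_in_time.
by move=> z; exact: F_ge0.
Qed.

Let mmass : measurable_fun [set: measurableTypeR R] (fun t => mass (step_index tau t)).
Proof.
apply: (measurable_fun_fubini_tonelli_F (m2 := leb) (EFin \o in_time tau F)).
  by apply/measurable_EFinP; exact: measurable_in_time.
by move=> z; rewrite /= lee_fin; exact: F_ge0.
Qed.

Lemma in_time_mass_le (T M : R) : 0 < T -> (forall n, (mass n <= M%:E)%E) ->
  (\int[mu]_(z in slab `]0, T[%R) (in_time tau F z)%:E <= (M * T)%:E)%E.
Proof.
move=> T0 massM; rewrite integral_slab_in_time.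
have M0 : 0 <= M by rewrite -lee_fin; exact: le_trans (massM 0%N).
apply: (@le_trans _ _ (\int[lebesgue_measure]_(t in [set` `]0, T[%R]) M%:E)%E).
  apply: ge0_le_integral => //; first exact: measurable_funTS.
rewrite integral_cst//= [X in (_ * X)%E](lebesgue_measure_itv `]0, T[%R) /= lte_fin T0.
by rewrite -EFinD subr0 EFinM.
Qed.

(** Each step [n + 1] lives on an interval of length [tau]; finitely many of these cover []0, T[],
    and the last ones may reach beyond [T]. *)
Lemma in_time_sum_le (T : R) : exists N : nat,
  (\int[mu]_(z in slab `]0, T[%R) (in_time tau F z)%:E <=
   tau%:E * \sum_(n < N) mass n.+1)%E.
Proof.
(* The index of a time up to [T] is at most [T / tau + 1]. *)
exists (Num.bound `|T / tau + 1|); set N := Num.bound _.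
rewrite integral_slab_in_time.
pose J (n : nat) : set (measurableTypeR R) := `]n%:R * tau, n.+1%:R * tau]%classic.
pose g (n : 'I_N) (t : measurableTypeR R) : \bar R := (mass n.+1 * (\1_(J n) t)%:E)%E.
have mJ n : measurable (J n) by exact: measurable_itv.
have mg n : measurable_fun setT (g n).
  by apply: measurable_funeM; apply/measurable_EFinP; exact: measurable_indic.
have g0 n t : (0 <= g n t)%E by rewrite mule_ge0// lee_fin.
have msum : measurable_fun setT (fun t => \sum_(n < N) g n t)%E.
  exact: emeasurable_sum.
apply: (@le_trans _ _ (\int[lebesgue_measure]_(t in [set` `]0, T[%R])
    \sum_(n < N) g n t)%E).
  apply: ge0_le_integral => //.
  - exact: measurable_funTS.
  - exact: measurable_funTS.
  move=> t; rewrite /= in_itv /= => /andP[t0 tT].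
  have t_ge0 := ltW t0.
  have [k kE] : exists k, step_index tau t = k.+1.
    by case: step_index (step_index_gt0 tau_gt0 t0) => // k _; exists k.
  have tle : `|t| <= T by rewrite ger0_norm// ltW.
  have kN : (k < N)%N.
    have : (k.+1)%:R < N%:R :> R.
      rewrite -kE; apply: (le_lt_trans (step_index_le tau_gt0 tle)).
      exact: le_lt_trans (ler_norm _) (archi_boundP (normr_ge0 _)).
    by rewrite ltr_nat; exact: ltnW.
  have tJ : J k t.
    have := ceil_itv (t / tau); have c0 : 0 <= Num.ceil (t / tau).
      by rewrite -(ler0z R); have /andP[_] := ceil_itv (t / tau); apply: le_trans; rewrite divr_ge0// ltW.
    rewrite -[Num.ceil _]gez0_abs// -/(step_index tau t) kE.
    rewrite ltr_pdivlMr// ler_pdivrMr// /J /= in_itv /=.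
    by rewrite (_ : (k.+1%:Z - 1) = k%:Z)// -addn1 PoszD addrK.
  rewrite kE (bigD1 (Ordinal kN))//= {1}/g indicE mem_set// mule1 leeDl//.
  by apply: sume_ge0.
apply: (@le_trans _ _ (\int[lebesgue_measure]_t \sum_(n < N) g n t)%E).
  apply: ge0_subset_integral => //.
  by move=> t _; apply: sume_ge0.
rewrite ge0_integral_sum//.
rewrite ge0_sume_distrr//.
apply: lee_sum => n _.
rewrite ge0_integralZl//; last first.
  by apply/measurable_EFinP; exact: measurable_indic.
rewrite integral_indic// setIT muleC.
rewrite [X in (X * _)%E](lebesgue_measure_itv `]_, _]) /=.
rewrite lte_fin ltr_pM2r// ltr_nat ltnSn -EFinB -mulrBl.
by rewrite -natrB// subSnn mul1r.
Qed.

End slab_integrals.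

(** * Convergence of the densities in space-time *)

Section limit_density.
Variables (R : realType) (d : nat).
Local Notation leb := (lebesgue_rV R d).
Local Notation mu := (@lebesgue_measure R \x lebesgue_rV R d)%E.
Local Notation slab := (@slab R d).
Local Notation spacetime := (measurableTypeR R * 'rV[R]_d)%type.
Variables (rho : R -> 'rV[R]_d -> R) (T : R).
Hypothesis T_gt0 : 0 < T.
Hypothesis rho_P2 : forall t, 0 <= t -> P2ac (rho t).
Hypothesis rho_meas : measurable_fun (slab `[0, +oo[)
  (fun z : R * 'rV[R]_d => rho z.1 z.2).

(** Unit mass at every time is integrable only over a finite time interval; extension by zero then
    allows integrals over all of space-time. *)
Definition cut_density : spacetime -> R :=
  (fun z : spacetime => rho z.1 z.2) \_ (slab `]0, T[).

Lemma slab_sub : slab `]0, T[ `<=` slab `[0, +oo[.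
Proof.
move=> z [/= + _]; rewrite in_itv /= => /andP[z0 _]; split => //=.
by rewrite in_itv /= andbT ltW.
Qed.

Lemma cut_densityE t x : 0 < t < T -> cut_density (t, x) = rho t x.
Proof.
by move=> tT; rewrite /cut_density patchE mem_set//; split => //=; rewrite in_itv.
Qed.

Lemma measurable_cut (f : spacetime -> R) : measurable_fun (slab `[0, +oo[) f ->
  measurable_fun setT (f \_ (slab `]0, T[)).
Proof.
move=> mf; apply/(measurable_restrictT _ (measurable_slab _)).
by apply: measurable_funS slab_sub mf; exact: measurable_slab.
Qed.

Lemma measurable_cut_density : measurable_fun setT cut_density.
Proof. exact: measurable_cut. Qed.

Lemma cut_density_ge0 z : 0 <= cut_density z.
Proof.
rewrite /cut_density patchE; case: ifPn => //; rewrite inE => /slab_sub[/= + _].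
by rewrite in_itv /= andbT => /rho_P2[_ H _ _]; exact: H.
Qed.

Let integral_cut_density t : 0 < t < T -> (\int[leb]_x (cut_density (t, x))%:E = 1)%E.
Proof.
move=> tT; have t0 : 0 <= t by case/andP: tT => /ltW.
have [_ _ <- _] := rho_P2 t0; apply: eq_integral => x _.
by rewrite cut_densityE.
Qed.

Lemma integrable_cut_density : mu.-integrable setT (EFin \o cut_density).
Proof.
have mc := measurable_cut_density.
apply/integrableP; split; first exact/measurable_EFinP.
under eq_integral => z _ do rewrite /= ger0_norm ?cut_density_ge0//.
rewrite -(@integral_supported _ _ (slab `]0, T[)); last first.
  by move=> z nz; rewrite /cut_density patchE memNset.
rewrite slab_tonelli//; last exact: cut_density_ge0.
rewrite (eq_integral (fun=> 1%E)) => [|t]; last first.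
  by rewrite inE /= in_itv /=; exact: integral_cut_density.
rewrite integral_cst//= mul1e [X in (X < _)%E](lebesgue_measure_itv `]0, T[%R) /= lte_fin T_gt0.
by rewrite -EFinD ltry.
Qed.

Lemma integrable_cut_mul (f : spacetime -> R) (phi : R * 'rV[R]_d -> R) :
  mu.-integrable setT (EFin \o f) -> compactly_supported phi ->
  mu.-integrable setT (EFin \o (fun z => f z * phi z)).
Proof.
move=> fi cphi; have [B [_ [HB _]]] := compactly_supported_bounded cphi.
rewrite (_ : _ \o _ = ((EFin \o f) \* (EFin \o phi))%E); last first.
  by apply/funext => z /=; rewrite EFinM.
apply: integrableMl => //.
  by apply: continuous_measurable_prod; case: cphi.
by exists B; split; [rewrite num_real|move=> N BN z _; exact: le_trans (HB z) (ltW BN)].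
Qed.

Variables (tau : nat -> R) (dens : nat -> nat -> 'rV[R]_d -> R) (M : R).
Hypothesis tau_gt0 : forall k, 0 < tau k.
Hypothesis dens_nice : forall k n, nice (dens k n).
Hypothesis dens_ge0 : forall k n x, 0 <= dens k n x.
Hypothesis mass_le : forall k n, (\int[leb]_x (dens k n x)%:E <= M%:E)%E.
Hypothesis dens_cvg : forall t, 0 < t -> forall psi : 'rV[R]_d -> R,
  continuous psi -> (exists B, forall x, `|psi x| <= B) ->
  (\int[leb]_x (psi x * dens k (step_index (tau k) t) x)%:E)%E @[k --> \oo] -->
  (\int[leb]_x (psi x * rho t x)%:E)%E.
Variable phi : R * 'rV[R]_d -> R.
Hypothesis phi_supp : compactly_supported phi.
Hypothesis phi0 : forall t x, ~ (0 < t < T) -> phi (t, x) = 0.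

(** Narrow convergence at each fixed time, with [phi (t, .)] as test function, followed by dominated
    convergence in time; the bound on [phi] times the mass bound is the dominating constant. *)
Lemma in_time_density_cvg :
  (\int[mu]_z (in_time (tau k) (dens k) z * phi z)%:E)%E @[k --> \oo] -->
  (\int[mu]_z (cut_density z * phi z)%:E)%E.
Proof.
have [B [_ [HB _]]] := compactly_supported_bounded phi_supp.
have [phic _] := phi_supp.
have iA k := integrable_in_time (tau_gt0 k) (dens_nice k) phi_supp.
have iC := integrable_cut_mul integrable_cut_density phi_supp.
have slice (f : spacetime -> R) : mu.-integrable setT (EFin \o (fun z => f z * phi z)) ->
    (\int[mu]_z (f z * phi z)%:E =
     \int[lebesgue_measure]_(t in [set` `]0, T[%R])
       \int[leb]_x (phi (t, x) * f (t, x))%:E)%E.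
  move=> fi; rewrite -(integral12_prod_meas1 fi) [RHS]integral_mkcond.
  apply: eq_integral => t _; rewrite /fubini_F patchE; case: ifPn => tI.
    by apply: eq_integral => x _; rewrite /= mulrC.
  rewrite integral0_eq// => x _; rewrite /= phi0 ?mulr0// => tT.
  by move/negP: tI; apply; rewrite inE /= in_itv.
under eq_fun => k do rewrite (slice _ (iA k)).
rewrite (slice _ iC).
have B0 : 0 <= B by exact: le_trans (HB (0, 0)).
apply: (@dominated_cvg _ _ _ _ _ _ _ _ (fun=> (B * M)%:E)) => //.
- move=> k; apply: measurable_funTS.
  rewrite (_ : (fun t => _) =
    fubini_F leb (EFin \o (fun z => in_time (tau k) (dens k) z * phi z))).
    exact: measurable_int (integrable_fubini_F (iA k)).
  by apply/funext => t; apply: eq_integral => x _; rewrite /= mulrC.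
- move=> t; rewrite /= in_itv /= => tT; have [t0 _] := andP tT.
  under [X in _ --> X]eq_integral => x _ do rewrite cut_densityE//.
  apply: (dens_cvg t0 (psi := fun x => phi (t, x))); last by exists B => x; exact: HB.
  exact: continuous_slice.
- apply: (@measurable_bounded_integrable _ _ _ _ (cst (B * M))) => //.
    by rewrite [X in (X < _)%E](lebesgue_measure_itv `]0, T[%R) /= lte_fin T_gt0 -EFinD ltry.
  exists (B * M); split; first by rewrite num_real.
  move=> N BN z _; apply: le_trans (ltW BN); rewrite /= ger0_norm// mulr_ge0//.
  by rewrite -lee_fin; apply: le_trans (mass_le 0%N 0%N); apply: integral_ge0 => x _; rewrite lee_fin.
move=> k t _; have [mF _ iF] := dens_nice k (step_index (tau k) t).
have mphi : measurable_fun setT (fun x => phi (t, x)).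
  by apply: continuous_measurable_rV; exact: continuous_slice.
apply: (le_trans (le_abse_integral _ _ _)) => //.
  by apply/measurable_EFinP; exact: measurable_funM.
apply: (@le_trans _ _ (\int[leb]_x (B%:E * (dens k (step_index (tau k) t) x)%:E))%E).
  apply: ge0_le_integral => //.
  - by apply: measurableT_comp => //; apply/measurable_EFinP; exact: measurable_funM.
  - by apply: measurable_funeM; exact/measurable_EFinP.
  move=> x _; rewrite -EFinM lee_fin normrM [`|in_time _ _ _|]ger0_norm; last exact: dens_ge0.
  by apply: ler_wpM2r => //; exact: dens_ge0.
rewrite ge0_integralZl//; last 2 first.
- exact/measurable_EFinP.
- by move=> x _; rewrite lee_fin.
by rewrite EFinM; apply: lee_wpmul2l.
Qed.

End limit_density.

(** * Integrability of the limit momentum *)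

Section limit_momentum.
Variables (R : realType) (d : nat).
Local Notation leb := (lebesgue_rV R d).
Local Notation mu := (@lebesgue_measure R \x lebesgue_rV R d)%E.
Local Notation slab := (@slab R d).
Local Notation spacetime := (measurableTypeR R * 'rV[R]_d)%type.
Variables (rho : R -> 'rV[R]_d -> R) (v : R -> 'rV[R]_d -> 'rV[R]_d) (T : R).
Hypothesis T_gt0 : 0 < T.
Hypothesis rho_P2 : forall t, 0 <= t -> P2ac (rho t).
Hypothesis rho_meas : measurable_fun (slab `[0, +oo[)
  (fun z : R * 'rV[R]_d => rho z.1 z.2).
Hypothesis v_L2 : L2_velocity rho v.

Definition cut_momentum l : spacetime -> R :=
  (fun z : spacetime => v z.1 z.2 ord0 l * rho z.1 z.2) \_ (slab `]0, T[).

Let cut_kinetic : spacetime -> R :=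
  (fun z : spacetime => enorm (v z.1 z.2) ^+ 2 * rho z.1 z.2) \_ (slab `]0, T[).

Let measurable_v_comp (g : 'rV[R]_d -> R) : continuous g ->
  measurable_fun (slab `[0, +oo[) (fun z : spacetime => g (v z.1 z.2)).
Proof.
move=> gc; apply: (@measurableT_comp _ _ _ _ _ _ g _ _ _ v_L2.1).
exact: continuous_measurable_rV.
Qed.

Let measurable_kinetic : measurable_fun (slab `[0, +oo[)
  (fun z : spacetime => enorm (v z.1 z.2) ^+ 2 * rho z.1 z.2).
Proof.
apply: measurable_funM => //.
under eq_fun do rewrite enorm_sqr.
by apply: (@measurable_v_comp (fun x => dotv x x)); exact: continuous_dotv.
Qed.

Let rho_ge0 (z : spacetime) : slab `[0, +oo[ z -> 0 <= rho z.1 z.2.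
Proof. by move=> [/= + _]; rewrite in_itv /= andbT => /rho_P2[_ H _ _]; exact: H. Qed.

Let kinetic_ge0 z : slab `[0, +oo[ z -> 0 <= enorm (v z.1 z.2) ^+ 2 * rho z.1 z.2.
Proof. by move=> /rho_ge0 ?; rewrite mulr_ge0// sqr_ge0. Qed.

Let integrable_cut_kinetic : mu.-integrable setT (EFin \o cut_kinetic).
Proof.
apply/integrableP; split; first by apply/measurable_EFinP; exact: measurable_cut.
have ck0 z : 0 <= cut_kinetic z.
  rewrite /cut_kinetic patchE; case: ifPn => //; rewrite inE => /slab_sub.
  exact: kinetic_ge0.
under eq_integral => z _ do rewrite /= ger0_norm//.
rewrite -(@integral_supported _ _ (slab `]0, T[)); last first.
  by move=> z nz; rewrite /cut_kinetic patchE memNset.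
apply: le_lt_trans v_L2.2.
rewrite (eq_integral (fun z : spacetime => (enorm (v z.1 z.2) ^+ 2 * rho z.1 z.2)%:E)); last first.
  by move=> z zT; rewrite /cut_kinetic patchE zT.
apply: ge0_subset_integral.
- exact: measurable_slab.
- exact: measurable_slab.
- exact/measurable_EFinP.
- by move=> z /kinetic_ge0; rewrite lee_fin.
- exact: slab_sub.
Qed.

(** Each component obeys [|v_l| rho <= rho + |v|^2 rho], and both terms are integrable over a finite
    time interval. *)
Lemma integrable_cut_momentum l : mu.-integrable setT (EFin \o cut_momentum l).
Proof.
have ic := integrable_cut_density T_gt0 rho_P2 rho_meas.
apply: (@le_integrable _ _ _ mu setT measurableT _ (EFin \o (cut_density rho T \+ cut_kinetic)%R)) => //.
- apply/measurable_EFinP; apply: measurable_cut; apply: measurable_funM => //.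
  by apply: (@measurable_v_comp (fun x => x ord0 l)); exact: coord_continuous.
- move=> z _; rewrite /= lee_fin [leRHS]ger0_norm.
    rewrite /cut_momentum /cut_density /cut_kinetic !patchE; case: ifPn; last first.
      by rewrite normr0 addr0.
    rewrite inE => /slab_sub /rho_ge0 r0.
    rewrite normrM [`|rho _ _|]ger0_norm// -[X in X + _]mul1r -mulrDl ler_wpM2r//.
    set u := v _ _; have := norm_le_enorm u; have := rV_norm_coord u l.
    move=> /le_trans/[apply] H; apply: (le_trans H).
    have := sqr_ge0 (enorm u - 1); rewrite sqrrB1; have := sqrtr_ge0 (dotv u u).
    rewrite -/(enorm u); lra.
  rewrite addr_ge0//; first exact: cut_density_ge0.
  rewrite /cut_kinetic patchE; case: ifPn => //; rewrite inE => /slab_sub.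
  exact: kinetic_ge0.
- rewrite (_ : _ \o _ = ((EFin \o cut_density rho T) \+ (EFin \o cut_kinetic))%E).
    exact: integrableD.
  by apply/funext => z /=; rewrite EFinD.
Qed.

End limit_momentum.

(** * The momentum balance integrated in time *)

Section momentum_error.
Variables (R : realType) (d : nat).
Local Notation leb := (lebesgue_rV R d).
Local Notation mu := (@lebesgue_measure R \x lebesgue_rV R d)%E.
Local Notation slab := (@slab R d).
Local Notation spacetime := (measurableTypeR R * 'rV[R]_d)%type.
Variables (tau T : R) (dens pres kin : nat -> 'rV[R]_d -> R).
Variable mom : 'I_d -> nat -> 'rV[R]_d -> R.
Hypotheses (tau_gt0 : 0 < tau) (T_gt0 : 0 < T).
Hypothesis dens_nice : forall n, nice (dens n).
Hypothesis pres_nice : forall n, nice (pres n).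
Hypothesis kin_nice : forall n, nice (kin n).
Hypothesis mom_nice : forall l n, nice (mom l n).
Hypothesis dens_ge0 : forall n x, 0 <= dens n x.
Hypothesis pres_ge0 : forall n x, 0 <= pres n x.
Hypothesis kin_ge0 : forall n x, 0 <= kin n x.
Hypothesis mom_le : forall l n x, `|mom l n x| <= dens n x + kin n x.
Variables (g : 'I_d -> 'rV[R]_d -> R) (xi dxi : 'I_d -> R * 'rV[R]_d -> R).
Hypothesis g_cont : forall l, continuous (g l).
Hypothesis xi_supp : forall l, compactly_supported (xi l).
Hypothesis gxi_supp : compactly_supported (fun z => \sum_l g l z.2 * xi l z).
Hypothesis dxi_supp : compactly_supported (fun z => \sum_l dxi l z).
Hypothesis xi0 : forall l t x, ~ (0 < t < T) -> xi l (t, x) = 0.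
Hypothesis dxi0 : forall l t x, ~ (0 < t < T) -> dxi l (t, x) = 0.
Variables (chi : 'rV[R]_d -> R) (B Bg w M E0 Q : R).
Hypothesis chi_cont : continuous chi.
Hypothesis chi_ge0 : forall x, 0 <= chi x.
Hypothesis chi_le : forall x, chi x <= B.
Hypothesis gchi_le : forall x, (\sum_l `|g l x|) * chi x <= Bg.
Hypothesis w_ge0 : 0 <= w.
Hypothesis mass_le : forall n, (\int[leb]_x (dens n x)%:E <= M%:E)%E.
Hypothesis kin_le : forall N,
  (tau%:E * \sum_(n < N) \int[leb]_x (kin n.+1 x)%:E <= E0%:E)%E.
Hypothesis pres_le :
  (\int[mu]_(z in slab `]0, T[%R) (in_time tau pres z * chi z.2)%:E <= Q%:E)%E.

Let size n x : R :=
  (\sum_l `|mom l n x| + dens n x * (\sum_l `|g l x|) + pres n x) * chi x.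

Let balance n (y dy : 'I_d -> 'rV[R]_d -> R) x : R :=
  \sum_l mom l n x * y l x + dens n x * (\sum_l g l x * y l x) -
  pres n x * \sum_l dy l x.

Hypothesis balance_le : forall n t,
  (`|\int[leb]_x (balance n.+1 (fun l x => xi l (t, x)) (fun l x => dxi l (t, x)) x)%:E|
   <= w%:E * \int[leb]_x (size n.+1 x)%:E)%E.

Let j (z : spacetime) : R :=
  \sum_l in_time tau (mom l) z * xi l z +
  in_time tau dens z * (\sum_l g l z.2 * xi l z) -
  in_time tau pres z * \sum_l dxi l z.

Let q (z : spacetime) : R := size (step_index tau z.1) z.2.

Let B_ge0 : 0 <= B.
Proof. exact: le_trans (chi_ge0 0) (chi_le 0). Qed.

Let Bg_ge0 : 0 <= Bg.
Proof. by apply: le_trans (gchi_le 0); rewrite mulr_ge0// sumr_ge0. Qed.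

Let size_ge0 n x : 0 <= size n x.
Proof.
by rewrite mulr_ge0// addr_ge0// addr_ge0 ?sumr_ge0// mulr_ge0// sumr_ge0.
Qed.

Let measurable_nice (F : nat -> 'rV[R]_d -> R) : (forall n, nice (F n)) -> forall n, measurable_fun setT (F n).
Proof. by move=> nF n; case: (nF n). Qed.

Let measurable_size n : measurable_fun setT (size n).
Proof.
apply: measurable_funM; last exact: continuous_measurable_rV.
apply: measurable_funD; last exact: measurable_nice.
apply: measurable_funD.
  by apply: measurable_sum => l; apply: measurableT_comp => //; exact: measurable_nice.
apply: measurable_funM; first exact: measurable_nice.
by apply: measurable_sum => l; apply: measurableT_comp => //; exact: continuous_measurable_rV.
Qed.

Let imom l := integrable_in_time tau_gt0 (mom_nice l) (xi_supp l).
Let idens := integrable_in_time tau_gt0 dens_nice gxi_supp.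
Let ipres := integrable_in_time tau_gt0 pres_nice dxi_supp.

Let isum := integrable_fun_sum imom.

Let isumdens : mu.-integrable setT (EFin \o (fun z =>
  \sum_l in_time tau (mom l) z * xi l z + in_time tau dens z * (\sum_l g l z.2 * xi l z))).
Proof. exact: integrableD isum idens. Qed.

Let ij : mu.-integrable setT (EFin \o j).
Proof. exact: integrableB isumdens ipres. Qed.

(** The momentum is bounded by density plus kinetic energy, [d] times with weight at most [B]; the
    force by density times [Bg]. Over time the mass contributes [M T], the kinetic energies [E0],
    the pressure [Q]. *)
Lemma integral_size_le :
  (\int[mu]_(z in slab `]0, T[%R) (q z)%:E <=
   ((d%:R * B + Bg) * (M * T) + d%:R * B * E0 + Q)%:E)%E.
Proof.
(* Coefficients of the density (its share of the momentum bound plus the force) and of the kinetic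
   energy. *)
pose c1 := d%:R * B + Bg; pose c2 := d%:R * B.
have c2_ge0 : 0 <= c2 by rewrite mulr_ge0.
have c1_ge0 : 0 <= c1 by rewrite addr_ge0.
have mq : measurable_fun setT q by exact: measurable_in_time.
have mdens : measurable_fun setT (in_time tau dens).
  by apply: measurable_in_time => //; exact: (measurable_nice dens_nice).
have mkin : measurable_fun setT (in_time tau kin).
  by apply: measurable_in_time => //; exact: (measurable_nice kin_nice).
have mpres : measurable_fun setT (fun z : spacetime => in_time tau pres z * chi z.2).
  apply: measurable_funM; first by apply: measurable_in_time => //; exact: (measurable_nice pres_nice).
  apply: (@measurableT_comp _ _ _ _ _ _ chi); last exact: measurable_snd.
  exact: continuous_measurable_rV.
have mS := @measurable_slab R d `]0, T[%R.
have mE (c : R) (F : spacetime -> R) (D : set spacetime) : measurable_fun setT F ->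
    measurable_fun D (fun z => c%:E * (F z)%:E)%E.
  move=> mF; apply: measurable_funTS; under eq_fun do rewrite -EFinM.
  by apply/measurable_EFinP; exact: measurable_funM.
apply: (@le_trans _ _ (\int[mu]_(z in slab `]0, T[%R)
    (c1%:E * (in_time tau dens z)%:E + c2%:E * (in_time tau kin z)%:E +
     (in_time tau pres z * chi z.2)%:E))%E).
  apply: ge0_le_integral => //.
  - by move=> z _; rewrite lee_fin; exact: size_ge0.
  - by apply/measurable_EFinP; exact: measurable_funTS.
  - apply: emeasurable_funD; first by apply: emeasurable_funD; exact: mE.
    by apply: measurable_funTS; exact/measurable_EFinP.
  move=> [t x] _; rewrite -!EFinM -!EFinD lee_fin /q /size /in_time /=.
  set n := step_index tau t.
  rewrite mulrDl lerD2r mulrDl.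
  rewrite (_ : c1 * dens n x + c2 * kin n x =
    d%:R * B * (dens n x + kin n x) + dens n x * Bg); last by rewrite /c1 /c2; ring.
  apply: lerD; last by rewrite -mulrA ler_wpM2l.
  rewrite [leRHS]mulrAC; apply: ler_pM => //; first exact: sumr_ge0.
  rewrite mulr_natl -[X in _ *+ X](card_ord d) -sumr_const.
  by apply: ler_sum => l _; exact: mom_le.
rewrite ge0_integralD//; last 4 first.
- by move=> z _; rewrite adde_ge0// mule_ge0// lee_fin//; [exact: dens_ge0|exact: kin_ge0].
- by apply: emeasurable_funD; exact: mE.
- by move=> z _; rewrite lee_fin mulr_ge0//; exact: pres_ge0.
- by apply: measurable_funTS; exact/measurable_EFinP.
rewrite ge0_integralD//; last 4 first.
- by move=> z _; rewrite mule_ge0// lee_fin//; exact: dens_ge0.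
- exact: mE.
- by move=> z _; rewrite mule_ge0// lee_fin//; exact: kin_ge0.
- exact: mE.
rewrite !ge0_integralZl//; last 4 first.
- by apply: measurable_funTS; exact/measurable_EFinP.
- by move=> z _; rewrite lee_fin; exact: kin_ge0.
- by apply: measurable_funTS; exact/measurable_EFinP.
- by move=> z _; rewrite lee_fin; exact: dens_ge0.
rewrite [leRHS]EFinD; apply: leeD => //; rewrite [leRHS]EFinD; apply: leeD.
  rewrite [leRHS]EFinM; apply: lee_wpmul2l; first by rewrite lee_fin.
  by apply: in_time_mass_le => //; exact: (measurable_nice dens_nice).
rewrite [leRHS]EFinM; apply: lee_wpmul2l; first by rewrite lee_fin.
have [N HN] := in_time_sum_le tau_gt0 (measurable_nice kin_nice) kin_ge0 T.
exact: le_trans HN (kin_le N).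
Qed.

Lemma momentum_error :
  `|\sum_l \int[mu]_z (in_time tau (mom l) z * xi l z) +
    \int[mu]_z (in_time tau dens z * (\sum_l g l z.2 * xi l z)) -
    \int[mu]_z (in_time tau pres z * \sum_l dxi l z)| <=
  w * ((d%:R * B + Bg) * (M * T) + d%:R * B * E0 + Q).
Proof.
rewrite -Rintegral_sum//.
rewrite -RintegralD// -RintegralB// -lee_fin EFin_normr_Rintegral// [leRHS]EFinM.
apply: (@le_trans _ _ (w%:E * \int[mu]_(z in slab `]0, T[%R) (q z)%:E)%E); last first.
  by apply: lee_wpmul2l; [rewrite lee_fin|exact: integral_size_le].
apply: slab_integral_le => //.
- move=> t x tT; rewrite /j big1 => [|l _]; last by rewrite xi0// mulr0.
  rewrite [X in _ * X]big1 => [|l _]; last by rewrite xi0// mulr0.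
  rewrite [X in _ - _ * X]big1 => [|l _]; last by rewrite dxi0.
  by rewrite !mulr0 addr0 subr0.
- exact: measurable_in_time.
- by move=> z; exact: size_ge0.
move=> t t0 tT; rewrite /j /q /in_time /=.
(* A positive time has index at least 1, so the balance of a genuine step applies. *)
by case E : (step_index tau t) (step_index_gt0 tau_gt0 t0) => [//|n] _; exact: balance_le.
Qed.

End momentum_error.

(** * Moduli of continuity, cutoffs and exchange of representatives *)

Section limit_tools.
Variables (R : realType) (d : nat).
Local Notation leb := (lebesgue_rV R d).
Local Notation mu := (@lebesgue_measure R \x lebesgue_rV R d)%E.
Local Notation spacetime := (measurableTypeR R * 'rV[R]_d)%type.

Lemma Ck_pred (X : normedModType R) n (f : X -> R) : Ck n.+1 f -> Ck n f.
Proof.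
elim: n f => [|n IH] f [fc fd]; split => // v.
by have [fv fC] := fd v; split => //; exact: IH.
Qed.

Lemma admissible_affine (K : set 'rV[R]_d) (S : simplicial_decomposition K) G :
  admissible S G -> exists Ab : ('I_(sd_size S) -> 'M[R]_d) * ('I_(sd_size S) -> 'rV[R]_d),
    (forall m, 0 < \det (Ab.1 m)) /\ affine_on (S := S) G Ab.1 Ab.2.
Proof.
move=> [_ GA]; have /choice[A HA] := GA; have /choice[b Hb] := HA.
by exists (A, b); split => [m|m w cw] /=; have [d0 E] := Hb m; [|exact: E].
Qed.

(** The modulus in space is uniform in [t], because uniform continuity holds jointly in both
    variables; one mesh size then serves all times. *)
Lemma compactly_supported_modulus (f : R * 'rV[R]_d -> R) e :
  compactly_supported f -> 0 < e -> exists2 dl, 0 < dl & forall t (x y : 'rV[R]_d),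
    `|x - y| < dl -> `|f (t, x) - f (t, y)| <= e.
Proof.
move=> [fc [C [cC f0]]] e0; have [dl dl0 H] := compact_unif cC fc e0.
exists dl => // t x y xy.
have n2 (u v : 'rV[R]_d) : `|u - v| < dl -> `|(t, u) - (t, v)| < dl.
  by move=> uv; rewrite prod_normE /= subrr normr0 gt_max uv andbT.
have [Cy|nCy] := pselect (C (t, y)); first by apply/ltW/H => //; exact: n2.
have [Cx|nCx] := pselect (C (t, x)); last by rewrite !f0// subrr normr0 ltW.
by rewrite distrC; apply/ltW/H => //; apply: n2; rewrite distrC.
Qed.

(** A cone over the ball of radius [r]. It is never differentiated, so continuity is enough. *)
Definition cutoff (r : R) (x : 'rV[R]_d) : R := Num.max 0 (r - `|x|).

Lemma cutoff_continuous r : continuous (cutoff r).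
Proof.
have nc : continuous (fun y : 'rV[R]_d => r - `|y|).
  by apply: continuous_fun_sub; [exact: cst_continuous|exact: norm_continuous].
by move=> x; apply: (@continuous_max _ _ (cst 0) _ x _ (nc x)); exact: cst_continuous.
Qed.

Lemma cutoff_ge0 r x : 0 <= cutoff r x.
Proof. by rewrite le_max lexx. Qed.

Lemma cutoff_le r x : 0 <= r -> cutoff r x <= r.
Proof. by move=> r0; rewrite ge_max r0 /= gerBl. Qed.

Lemma cutoff_out r x : r <= `|x| -> cutoff r x = 0.
Proof. by move=> rx; rewrite /cutoff max_l// subr_le0. Qed.

Lemma cutoff_ge r s x : `|x| <= s -> r - s <= cutoff r x.
Proof. by move=> xs; rewrite le_max lerD2l lerN2 xs orbT. Qed.

Lemma integral_eq_supported (D : set spacetime) (f F : spacetime -> R) :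
  mu.-integrable setT (EFin \o F) -> (forall z, D z -> f z = F z) ->
  (forall z, ~ D z -> F z = 0) ->
  (\int[mu]_(z in D) (f z)%:E)%E = (\int[mu]_z F z)%:E.
Proof.
move=> Fi fF F0; rewrite (eq_integral (fun z => (F z)%:E)) => [|z]; last first.
  by rewrite inE => /fF ->.
by rewrite integral_supported// fineK//; exact: integrable_fin_num Fi.
Qed.

(** Passes from the given representatives [f] on [D] to the explicit [F] on all of space-time; [g]
    need agree with the limit [fs] only where the test function does not vanish. *)
Lemma weak_star_in_time (D : set spacetime) (tau : nat -> R)
    (f F : nat -> nat -> 'rV[R]_d -> R) (N : nat -> nat -> set 'rV[R]_d)
    (fs g : R * 'rV[R]_d -> R) (phi : R * 'rV[R]_d -> R) :
  (forall k, 0 < tau k) -> (forall k n, nice (F k n)) ->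
  (forall k n, measurable (N k n)) -> (forall k n, leb (N k n) = 0%E) ->
  (forall k n x, ~ N k n.+1 x -> f k n.+1 x = F k n.+1 x) ->
  (forall z, D z -> 0 <= z.1) ->
  weak_star_cvg D (fun k => in_time (tau k) (f k)) fs -> Cc D phi ->
  compactly_supported phi -> (forall z, ~ D z -> phi z = 0) ->
  (forall z, D z -> fs z * phi z = g z * phi z) ->
  mu.-integrable setT (EFin \o (fun z => g z * phi z)) ->
  \int[mu]_z (in_time (tau k) (F k) z * phi z) @[k --> \oo] -->
  \int[mu]_z (g z * phi z).
Proof.
move=> tau0 nF mN N0 fF D0 fcvg Cphi cphi phi0 fg gi.
have fi : (\int[mu]_(z in D) (fs z * phi z)%:E = (\int[mu]_z (g z * phi z))%:E)%E.
  by apply: integral_eq_supported => // z /phi0 ->; rewrite mulr0.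
have Fk k : (\int[mu]_(z in D) (in_time (tau k) (f k) z * phi z)%:E =
    \int[mu]_z (in_time (tau k) (F k) z * phi z)%:E)%E.
  rewrite (integral_in_time_eq (tau0 k) phi (mN k) (N0 k) (fF k))//.
  by rewrite integral_supported// => z /phi0 ->; rewrite mulr0.
suff : (\int[mu]_z (in_time (tau k) (F k) z * phi z)%:E)%E @[k --> \oo] -->
    (\int[mu]_z (g z * phi z))%:E by move=> /fine_cvg.
rewrite -fi -(funext Fk); exact: fcvg.
Qed.

End limit_tools.

(** * Limit of the momentum balance and the equation for [rho_star] *)

Theorem corollary4p5 (R : realType) (d : nat) (h : R -> R)
    (V : 'rV[R]_d -> R) (rhobar : 'rV[R]_d -> R) (K : set 'rV[R]_d)
    (tau : nat -> R) (S : nat -> simplicial_decomposition K)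
    (G : nat -> nat -> 'rV[R]_d -> 'rV[R]_d)
    (rho : nat -> nat -> 'rV[R]_d -> R)
    (v : nat -> nat -> 'rV[R]_d -> 'rV[R]_d)
    (rho0 : 'rV[R]_d -> R)
    (rho_star : R -> 'rV[R]_d -> R) (v_star : R -> 'rV[R]_d -> 'rV[R]_d)
    (T : R) (p_star : R * 'rV[R]_d -> R)
    (d_ge2 : (2 <= d)%N)
    (h_ok : entropy_density h)
    (V_C2 : Ck 2 V)
    (V_ge0 : forall x, 0 <= V x)
    (rhobar_P2 : P2ac rhobar)
    (rhobar_support : density_support rhobar = K)
    (K_convex : convex_set K)
    (K_compact : compact K)
    (tau_gt0 : forall k, 0 < tau k)
    (tau_cvg0 : tau k @[k --> \oo] --> 0)
    (mesh_cvg0 : mesh (S k) @[k --> \oo] --> 0)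
    (G_admissible : forall k n, admissible (S k) (G k n))
    (G_minimizer : forall k n,
       is_minimizer (S k)
         (fun G' => energy_tau K (tau k) h V (discrete_density (S k) rhobar)
                      G' (G k n))
         (G k n.+1))
    (rho_push : forall k n,
       push_density K (G k n) (discrete_density (S k) rhobar) (rho k n))
    (v_induced : forall k n,
       induced_velocity K (tau k) (G k n) (G k n.+1) (v k n.+1))
    (rho0_P2 : P2ac rho0)
    (rho0_cvg : narrow_cvg (fun k => rho k 0%N) rho0)
    (rho0_entropy :
       (ereal_sup (range (fun k => entropy h V (rho k 0%N))) < +oo)%E)
    (rho_star_P2 : forall t, 0 <= t -> P2ac (rho_star t))
    (rho_star_meas : measurable_fun (slab `[0, +oo[)
       (fun z : R * 'rV[R]_d => rho_star z.1 z.2))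
    (rho_star_holder : W2_holder_half rho_star)
    (rho_cvg : forall t, 0 < t ->
       narrow_cvg (fun k => interpolation (tau k) (rho k) t) (rho_star t))
    (v_star_L2 : L2_velocity rho_star v_star)
    (v_cvg : forall i : 'I_d,
       weak_star_cvg (slab `[0, +oo[)
         (fun k z => interpolation (tau k) (v k) z.1 z.2 ord0 i
                     * interpolation (tau k) (rho k) z.1 z.2)
         (fun z => v_star z.1 z.2 ord0 i * rho_star z.1 z.2))
    (star_continuity : continuity_equation rho_star v_star)
    (T_gt0 : 0 < T)
    (p_star_L1 : (lebesgue_measure \x lebesgue_rV R d)%E.-integrable
       (slab `[0, T]) (EFin \o p_star))
    (pressure_cvg : weak_star_cvg (slab `[0, T])
       (fun k z => pressure h (interpolation (tau k) (rho k) z.1 z.2)) p_star)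
    (G_injective : forall k n, set_inj K (G k n))
    (shape_regular : exists C : R,
       forall k n (m : 'I_(sd_size (S k))),
         diameter (G k n @` cell m) <= C * inradius (G k n @` cell m))
    (image_mesh_cvg0 : forall e : R, 0 < e -> \forall k \near \oo,
       forall n (m : 'I_(sd_size (S k))), diameter (G k n @` cell m) < e) :
  limit_equation T V rho_star p_star.
Proof.
have d_gt0 : (0 < d)%N by exact: ltnW.
have V_C1 : Ck 1 V by exact: Ck_pred.
pose r k := cell_average (S := S k) rhobar.
have [_ rhobar_ge0 _ _] := rhobar_P2.
have r_ge0 k m : 0 <= r k m by exact: cell_average_ge0.
have rrE k m w : icell (S := S k) m w -> discrete_density (S k) rhobar w = r k m.
  exact: discrete_densityE.
have AB k n := cid (admissible_affine (G_admissible k n)).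
pose A k n := (sval (AB k n)).1; pose b k n := (sval (AB k n)).2.
have detA k n m : 0 < \det (A k n m) by exact: (svalP (AB k n)).1.
have GE k n : affine_on (S := S k) (G k n) (A k n) (b k n).
  exact: (svalP (AB k n)).2.
pose dens k := step_density (r k) (A k) (b k).
pose pres k := step_pressure h (r k) (A k) (b k).
pose mom k l := step_momentum (r k) (A k) (b k) (tau k) l.
pose kin k := step_kinetic (r k) (A k) (b k) (tau k).
have dens_nice k n : nice (dens k n) by exact: step_density_nice.
have pres_nice k n : nice (pres k n) by exact: step_pressure_nice.
have mom_nice k l n : nice (mom k l n) by exact: step_momentum_nice.
have kin_nice k n : nice (kin k n) by exact: step_kinetic_nice.
have dens_ge0 k n x : 0 <= dens k n x by exact: step_density_ge0.
have pres_ge0 k n x : 0 <= pres k n x by exact: step_pressure_ge0.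
have kin_ge0 k n x : 0 <= kin k n x by exact: step_kinetic_ge0.
have mom_le k l n x : `|mom k l n x| <= dens k n x + kin k n x.
  exact: (step_momentum_le (r_ge0 k) (detA k) (GE k) (@G_injective k)).
have /choice[N HN] k := step_density_ae d_gt0 (@rrE k) (detA k) (GE k) (rho_push k).
have mN k n : measurable (N k n) by have [H _ _] := HN k; exact: H.
have N0 k n : lebesgue_rV R d (N k n) = 0%E by have [_ H _] := HN k; exact: H.
have densE k n x : ~ N k n x -> rho k n x = dens k n x.
  by have [_ _ H] := HN k; exact: H.
have presE k n x : ~ N k n x -> pressure h (rho k n x) = pres k n x.
  move=> /densE ->.
  exact: (pressure_step_density h_ok (r k) (detA k) (GE k) (@G_injective k)).
have momE k l n x : ~ N k n.+1 x -> v k n.+1 x ord0 l * rho k n.+1 x = mom k l n.+1 x.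
  move=> /densE ->.
  exact: (velocity_step_density (r k) (detA k) (GE k) (@G_injective k) (v_induced k)).
have mass0 k n : (\int[lebesgue_rV R d]_x (dens k n x)%:E =
    \int[lebesgue_rV R d]_x (rho k 0%N x)%:E)%E.
  exact: (integral_step_density d_gt0 (@rrE k) (detA k) (GE k) (rho_push k)).
have mass_fin k n : (\int[lebesgue_rV R d]_x (dens k n x)%:E)%E \is a fin_num.
  by have [_ _ H] := dens_nice k n; exact: integrable_fin_num H.
(* The initial masses converge, by narrow convergence tested with the constant 1, so they are
   bounded in [k]; the mass does not change with [n]. *)
have [M HM] : exists M, forall k n, (\int[lebesgue_rV R d]_x (dens k n x)%:E <= M%:E)%E.
  have one (f : 'rV[R]_d -> R) : (\int[lebesgue_rV R d]_x (cst 1 x * f x)%:E =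
      \int[lebesgue_rV R d]_x (f x)%:E)%E.
    by apply: eq_integral => x _; rewrite mul1r.
  have mcvg : (\int[lebesgue_rV R d]_x (rho k 0%N x)%:E)%E @[k --> \oo] --> 1%:E.
    have [_ _ <- _] := rho0_P2; rewrite -one -(funext (fun k => one (rho k 0%N))).
    by apply: rho0_cvg; [exact: cst_continuous|exists 1 => x; rewrite normr1].
  have [M [_ HM]] := cvg_seq_bounded (cvgP _ (fine_cvg mcvg)).
  exists (M + 1) => k n; rewrite mass0 -(mass0 k 0%N) -[leLHS]fineK// lee_fin mass0.
  by apply: le_trans (ler_norm _) _; apply: HM => //; rewrite ltrDl.
have [E0 HE0] : exists E0, forall k, (entropy h V (rho k 0%N) <= E0%:E)%E.
  (* The maximum with 0 makes the value finite, so that [fine] does not fall back on its default. *)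
  exists (fine (Order.max 0%E (ereal_sup (range (fun k => entropy h V (rho k 0%N)))))).
  move=> k; rewrite fineK.
    rewrite le_max; apply/orP; right; apply: ereal_sup_ubound; by exists k.
  by rewrite ge0_fin_numE ?gt_max ?rho0_entropy ?ltry// le_max lexx.
have kin_sum k n : ((tau k)%:E * \sum_(i < n) \int[lebesgue_rV R d]_x (kin k i.+1 x)%:E
    <= (2 * E0)%:E)%E.
  have := kinetic_sum_le d_gt0 h_ok V_C1 V_ge0 (r_ge0 k) (@rrE k) (detA k) (GE k)
    (@G_injective k) (tau_gt0 k) (G_admissible k) (G_minimizer k) (rho_push k) n.
  move=> /le_trans /(_ (HE0 k)).
  have -> : (\sum_(i < n) \int[lebesgue_rV R d]_x (kin k i.+1 x)%:E)%E =
      (\sum_(i < n) \int[lebesgue_rV R d]_x kin k i.+1 x)%:E.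
    rewrite -sumEFin; apply: eq_bigr => i _; rewrite fineK//.
    by have [_ _ H] := kin_nice k i.+1; exact: integrable_fin_num H.
  rewrite -EFinM !lee_fin -/(kin k); lra.
move=> phi [phi_smooth [C [cC CU phi0]]].
have nC t x : ~ (0 < t < T) -> ~ C (t, x).
  by move=> nt /CU[/= + _]; rewrite in_itv.
pose xi l := dx l phi; pose dxi l := dx l (dx l phi).
pose g l x : R := grad V x ord0 l.
have g_cont l : continuous (g l) by exact: continuous_gradV.
have sxi l : supported C (xi l) by exact: supported_dx.
have sdxi i l : supported C (dx i (dx l phi)) by exact: supported_dxx.
have sdt : supported C (dt phi) by exact: supported_dt.
have sgxi : supported C (fun z => \sum_l g l z.2 * xi l z).
  by apply: supported_sum => l; exact: supported_mul.
have slap : supported C (fun z => \sum_l dxi l z) by exact: supported_laplx.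
have sC f : supported C f -> compactly_supported f by exact: supported_compactly.
have f0 f (t : R) x : supported C f -> ~ (0 < t < T) -> f (t, x) = 0.
  by move=> [_ H] nt; apply: H; exact: nC.
have Cpos : C `<=` slab `[0, +oo[ by move=> z /CU; exact: slab_sub.
have subT : @slab R d `]0, T[ `<=` slab `[0, T].
  move=> [t x] [/= + _]; rewrite in_itv /= => /andP[t0 tT]; split => //=.
  by rewrite in_itv /= !ltW.
have CT : C `<=` slab `[0, T] by move=> z /CU; exact: subT.
pose Jm k l :=
  \int[(@lebesgue_measure R \x lebesgue_rV R d)%E]_z
  (in_time (tau k) (mom k l) z * xi l z).
pose Jd k :=
  \int[(@lebesgue_measure R \x lebesgue_rV R d)%E]_z
  (in_time (tau k) (dens k) z * \sum_l g l z.2 * xi l z).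
pose Jp k :=
  \int[(@lebesgue_measure R \x lebesgue_rV R d)%E]_z
  (in_time (tau k) (pres k) z * \sum_l dxi l z).
pose crho := cut_density rho_star T; pose cmom := cut_momentum rho_star v_star T.
pose cp : measurableTypeR R * 'rV[R]_d -> R := p_star \_ (slab `[0, T]).
have icrho := integrable_cut_density T_gt0 rho_star_P2 rho_star_meas.
have icmom l := integrable_cut_momentum T_gt0 rho_star_P2 rho_star_meas v_star_L2 l.
have icp : (lebesgue_measure \x lebesgue_rV R d)%E.-integrable setT (EFin \o cp).
  move/(integrable_mkcond _ (@measurable_slab R d _)): p_star_L1.
  by rewrite restrict_EFin.
pose Lm l :=
  \int[(@lebesgue_measure R \x lebesgue_rV R d)%E]_z (cmom l z * xi l z).
pose Ld :=
  \int[(@lebesgue_measure R \x lebesgue_rV R d)%E]_z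
  (crho z * \sum_l g l z.2 * xi l z).
pose Lp :=
  \int[(@lebesgue_measure R \x lebesgue_rV R d)%E]_z (cp z * \sum_l dxi l z).
have Jm_cvg l : Jm k l @[k --> \oo] --> Lm l.
  apply: (weak_star_in_time (D := slab `[0, +oo[) (N := N)
    (f := fun k n x => v k n x ord0 l * rho k n x)
    (fs := fun z => v_star z.1 z.2 ord0 l * rho_star z.1 z.2)) => //.
  - move=> k n x; exact: momE.
  - by move=> z [/= + _]; rewrite in_itv /= andbT.
  - exact: v_cvg.
  - exact: (supported_Cc cC (sxi l) Cpos).
  - exact: sC.
  - by move=> z nz; have [_ H] := sxi l; apply: H => /Cpos.
  (* The cut and the full momentum differ only outside []0, T[], where the test function is 0. *)
  - move=> [t x] _; rewrite /cmom /cut_momentum patchE; case: ifPn => // /negP.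
    rewrite inE => ns; have [_ H] := sxi l.
    by rewrite H ?mulr0// => /CU.
  - exact: (integrable_cut_mul (icmom l) (sC _ (sxi l))).
have Jp_cvg : Jp k @[k --> \oo] --> Lp.
  apply: (weak_star_in_time (D := slab `[0, T]) (N := N)
    (f := fun k n x => pressure h (rho k n x)) (fs := p_star)) => //.
  - move=> k n x; exact: presE.
  - by move=> z [/= + _]; rewrite in_itv /= => /andP[].
  - exact: (supported_Cc cC slap CT).
  - exact: sC.
  - by move=> z nz; have [_ H] := slap; apply: H => /CT.
  - by move=> z zT; rewrite /cp patchE mem_set.
  - exact: (integrable_cut_mul icp (sC _ slap)).
have Jd_cvg : Jd k @[k --> \oo] --> Ld.
  have dens_cvg t : 0 < t -> forall psi : 'rV[R]_d -> R, continuous psi ->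
      (exists B, forall x, `|psi x| <= B) ->
      (\int[lebesgue_rV R d]_x (psi x * dens k (step_index (tau k) t) x)%:E)%E
        @[k --> \oo] --> (\int[lebesgue_rV R d]_x (psi x * rho_star t x)%:E)%E.
    move=> t0 psi psic psib.
    have E k : (\int[lebesgue_rV R d]_x (psi x * interpolation (tau k) (rho k) t x)%:E =
        \int[lebesgue_rV R d]_x (psi x * dens k (step_index (tau k) t) x)%:E)%E.
      apply: (eq_integral_off_null (mN k _) (N0 k (step_index (tau k) t))) => x _ nx.
      by congr (_ * _)%:E; exact: densE.
    rewrite -(funext E); exact: rho_cvg.
  have := in_time_density_cvg T_gt0 rho_star_P2 rho_star_meas tau_gt0 dens_nice dens_ge0
    HM dens_cvg (sC _ sgxi) (fun t x => f0 _ t x sgxi).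
  rewrite -[X in _ --> X -> _]fineK; last first.
    exact: integrable_fin_num (integrable_cut_mul icrho (sC _ sgxi)).
  by move=> /fine_cvg.
have [Rad Rad0 HRad] : exists2 Rad, 0 <= Rad & forall t x, C (t, x) -> `|x| <= Rad.
  have [M0 [_ HM0]] := compact_bounded cC.
  exists (`|M0| + 1) => [|t x Ctx]; first by rewrite addr_ge0.
  have : `|(t, x)| <= `|M0| + 1 by apply: HM0 => //; rewrite ltr_pwDr// ler_norm.
  by rewrite prod_normE /= ge_max => /andP[].
(* At least 1 on the ball of radius [Rad + 1], which contains the neighbourhood of radius [dl <= 1]
   of the spatial support of [phi]. *)
pose chi := cutoff (d := d) (Rad + 2).
have chi_c : continuous chi by exact: cutoff_continuous.
have chi_le x : chi x <= Rad + 2 by apply: cutoff_le; rewrite addr_ge0.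
(* The gradient of [V] may grow at infinity; it is bounded on the ball where [chi] is positive. *)
have [Bg HBg] : exists Bg, forall x, (\sum_l `|g l x|) * chi x <= Bg.
  have fc : continuous (fun x => (\sum_l `|g l x|) * chi x).
    apply: continuous_fun_mul => //; apply: continuous_sum => l x.
    by apply: continuous_comp; [exact: g_cont|exact: norm_continuous].
  have bB : bounded_set [set x : 'rV[R]_d | `|x| <= Rad + 2].
    exists (Rad + 2); split; first by rewrite num_real.
    by move=> y Ry x /= /le_trans; apply; exact: ltW.
  have [B [_ HB]] := continuous_bounded_image bB fc.
  exists (`|B| + 1) => x; have [xR|xR] := leP `|x| (Rad + 2).
    apply: le_trans (ler_norm _) _; apply: HB => //.
    by rewrite ltr_pwDr// ler_norm.
  by rewrite /chi cutoff_out ?mulr0 ?addr_ge0// ltW.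
(* The cutoff, constant in time, is an admissible test function because the pressures converge on
   the closed slab, whose boundary the support may touch. The integrals thus converge and are
   eventually below the limit plus 1. *)
have [Q HQ] : exists Q, \forall k \near \oo,
    (\int[(@lebesgue_measure R \x lebesgue_rV R d)%E]_(z in @slab R d `]0, T[%R)
       (in_time (tau k) (pres k) z * chi z.2)%:E <= Q%:E)%E.
  pose chis (z : R * 'rV[R]_d) := chi z.2.
  have chisc : continuous chis.
    by move=> z; apply: (@continuous_comp _ _ _ snd chi); [exact: cvg_snd|exact: chi_c].
  have chiC : Cc (slab `[0, T]) chis.
    split; first exact: continuous_subspaceT.
    exists (`[0, T]%classic `*` [set x | `|x| <= Rad + 2]); split.
    - by apply: compact_setX; [exact: segment_compact|exact: closed_ball0_compact].
    - by move=> z [zT _].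
    move=> z [zT _] nz; apply: cutoff_out; rewrite leNgt; apply/negP => zR.
    by apply: nz; split => //=; exact: ltW.
  have ichi : (lebesgue_measure \x lebesgue_rV R d)%E.-integrable (slab `[0, T])
      (EFin \o (fun z => p_star z * chis z)).
    rewrite (_ : _ \o _ = ((EFin \o p_star) \* (EFin \o chis))%E); last first.
      by apply/funext => z /=; rewrite EFinM.
    apply: integrableMl => //; first exact: measurable_slab.
      by apply: measurable_funTS; exact: continuous_measurable_prod.
    exists (Rad + 2); split; first by rewrite num_real.
    move=> B RB z _ /=; rewrite /chis ger0_norm ?cutoff_ge0//.
    exact: le_trans (chi_le _) (ltW RB).
  have Lfin := integrable_fin_num (@measurable_slab R d `[0, T]) ichi.
  have presI k : (\int[(@lebesgue_measure R \x lebesgue_rV R d)%E]_(z in @slab R d `[0, T]%R)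
      (pressure h (interpolation (tau k) (rho k) z.1 z.2) * chis z)%:E =
      \int[(@lebesgue_measure R \x lebesgue_rV R d)%E]_(z in @slab R d `[0, T]%R)
      (in_time (tau k) (pres k) z * chis z)%:E)%E.
    apply: (integral_in_time_eq (f := fun n x => pressure h (rho k n x)) (tau_gt0 k) chis
      (mN k) (N0 k)).
      by move=> n x; exact: presE.
    by move=> z [/= + _]; rewrite in_itv /= => /andP[].
  pose L := fine (\int[(@lebesgue_measure R \x lebesgue_rV R d)%E]_(z in @slab R d `[0, T]%R)
    (p_star z * chis z)%:E)%E.
  have cv : (\int[(@lebesgue_measure R \x lebesgue_rV R d)%E]_(z in @slab R d `[0, T]%R)
      (in_time (tau k) (pres k) z * chis z)%:E)%E @[k --> \oo] --> L%:E.
    by rewrite fineK// -(funext presI); exact: pressure_cvg.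
  have [finc fc] := (fine_cvgP _ _).1 cv.
  have L1 : L < L + 1 by rewrite ltrDl.
  have near_k := filterI finc (cvgr_lt _ fc _ L1).
  exists (L + 1); case: near_k => n0 _ near_k; exists n0 => // k /near_k[fk lk] /=.
  apply: (@le_trans _ _ (\int[(@lebesgue_measure R \x lebesgue_rV R d)%E]_(z in
      @slab R d `[0, T]%R) (in_time (tau k) (pres k) z * chis z)%:E)%E); last first.
    by rewrite -[leLHS]fineK// lee_fin ltW.
  apply: ge0_subset_integral.
  - exact: measurable_slab.
  - exact: measurable_slab.
  - apply/measurable_EFinP; apply: measurable_funTS; apply: measurable_funM.
      by apply: measurable_in_time => // n; case: (pres_nice k n).
    exact: continuous_measurable_prod.
  - by move=> z _; rewrite lee_fin mulr_ge0//; [exact: pres_ge0|exact: cutoff_ge0].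
  - exact: subT.
have [C0 HC0] := shape_regular.
(* The interpolation constant, with [|C0|] so that it is nonnegative whatever the sign of [C0]. *)
pose K0 : R := d%:R * (1 + d%:R * (2 * `|C0|)).
have K0_ge0 : 0 <= K0 by rewrite mulr_ge0// addr_ge0// mulr_ge0// mulr_ge0.
pose c : R := (d%:R * (Rad + 2) + Bg) * (M * T) + d%:R * (Rad + 2) * (2 * E0) + Q.
have small e : 0 < e -> \forall k \near \oo, `|\sum_l Jm k l + Jd k - Jp k| <= e.
  move=> e0.
  have D0 : 0 < K0 * `|c| + 1 by rewrite ltr_wpDl// mulr_ge0.
  (* Chosen so that the final error [K0 w |c|] is at most [e]; the summand 1 avoids division by
     zero. *)
  pose w := e / (K0 * `|c| + 1).
  have w0 : 0 < w by rewrite divr_gt0.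
  (* One mesh size for all second derivatives and all times, at most 1 to match the margin of
     [chi]. *)
  have [dl dl0 [dl1 Hdl]] : exists2 dl, 0 < dl & dl <= 1 /\ forall l i t (z z' : 'rV[R]_d),
      `|z - z'| <= dl -> `|dx i (xi l) (t, z) - dx i (xi l) (t, z')| <= w.
    have /choice[m Hm] (p : 'I_d * 'I_d) : exists m, 0 < m /\ forall t (z z' : 'rV[R]_d),
        `|z - z'| < m -> `|dx p.2 (xi p.1) (t, z) - dx p.2 (xi p.1) (t, z')| <= w.
      have [m m0 H] := compactly_supported_modulus (sC _ (sdxi p.2 p.1)) w0.
      by exists m.
    have : \forall s \near 0^'+, forall p, s < m p.
      have := @filter_forall _ _ (fun p (s : R) => s < m p) (0^'+).
      by apply => p; apply: nbhs_right_lt; exact: (Hm p).1.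
    move=> /(filterI (nbhs_right_gt 0))/(filterI (nbhs_right_lt ltr01)).
    move=> /filter_ex[s [s1 [s0 sm]]]; exists s => //; split; first exact: ltW.
    move=> l i t z z' zz; apply: (Hm (l, i)).2; exact: le_lt_trans zz (sm _).
  near=> k.
  have diam n m : diameter (G k n @` cell (S := S k) m) <= dl.
    apply: ltW; move: n m; near: k; exact: image_mesh_cvg0.
  have shape n m : diameter (G k n @` cell (S := S k) m) <=
      `|C0| * inradius (G k n @` cell (S := S k) m).
    apply: (le_trans (HC0 _ _ _)); apply: ler_wpM2r; first exact: inradius_ge0.
    exact: ler_norm.
  have presk : (\int[(@lebesgue_measure R \x lebesgue_rV R d)%E]_(z in @slab R d `]0, T[%R)
       (in_time (tau k) (pres k) z * chi z.2)%:E <= Q%:E)%E by near: k.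
  have dxE t l i : 'D_(delta_mx ord0 i) (fun x : 'rV[R]_d => xi l (t, x)) =
      (fun x => dx i (xi l) (t, x)).
    by apply/funext => x; rewrite derive_slice.
  have xd t l i z : derivable (fun x => xi l (t, x)) z (delta_mx ord0 i).
    by apply: derivable_slice; apply: Cinfty_derivable; exact: dx_smooth.
  have xc t l : continuous (fun x => xi l (t, x)).
    by apply: continuous_slice; case: (sxi l).
  have dxc t l i : continuous ('D_(delta_mx ord0 i) (fun x : 'rV[R]_d => xi l (t, x))).
    by rewrite dxE; apply: continuous_slice; case: (sdxi i l).
  have md t l i (z z' : 'rV[R]_d) : `|z - z'| <= dl ->
      `|'D_(delta_mx ord0 i) (fun x : 'rV[R]_d => xi l (t, x)) z -
        'D_(delta_mx ord0 i) (fun x : 'rV[R]_d => xi l (t, x)) z'| <= w.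
    move=> zz; exact: (eq_ind_r (fun f : 'rV[R]_d -> R => `|f z - f z'| <= w)
      (Hdl l i t z z' zz) (dxE t l i)).
  (* Beyond radius [Rad + 1], all points within [dl <= 1] of [x] lie outside the support. *)
  have chi1 t x : 1 <= chi x \/ forall l i (z : 'rV[R]_d), `|z - x| <= dl ->
      'D_(delta_mx ord0 i) (fun x : 'rV[R]_d => xi l (t, x)) z = 0.
    have [xR|xR] := leP `|x| (Rad + 1).
      by left; apply: le_trans (cutoff_ge (Rad + 2) xR); lra.
    right=> l i z zx.
    apply: (eq_ind_r (fun f : 'rV[R]_d -> R => f z = 0) _ (dxE t l i)).
    have [_ H] := sdxi i l; apply: H => /HRad zR.
    have := ler_normD (x - z) z; rewrite subrK distrC => xz.
    by move: xR zx dl1 zR xz; lra.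
  have balance n t := weak_estimate d_gt0 h_ok V_C1 (r_ge0 k) (@rrE k) (detA k) (GE k)
    (@G_injective k) (tau_gt0 k) (G_minimizer k) (xd t) (@xc t) (@dxc t) chi_c
    (cutoff_ge0 _) (ltW w0) dl1 (md t) (chi1 t) (diam n.+1) (shape n.+1).
  have bal n t : (`|\int[lebesgue_rV R d]_x (\sum_l mom k l n.+1 x * xi l (t, x) +
      dens k n.+1 x * (\sum_l g l x * xi l (t, x)) -
      pres k n.+1 x * \sum_l dxi l (t, x))%:E| <=
      (K0 * w)%:E * \int[lebesgue_rV R d]_x ((\sum_l `|mom k l n.+1 x| +
        dens k n.+1 x * (\sum_l `|g l x|) + pres k n.+1 x) * chi x)%:E)%E.
    (* Only the divergence term has to be rewritten, by [dxE]: the derivative of a slice is the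
       slice of the derivative. The rest is conversion. *)
    exact: (eq_ind _ (fun F : 'I_d -> 'rV[R]_d -> R => (`|\int[lebesgue_rV R d]_x
      (momentum_balance h V (r k) (A k) (b k) (tau k) n.+1
        (fun l x => xi l (t, x)) F x)%:E| <=
      (K0 * w)%:E * \int[lebesgue_rV R d]_x
        (momentum_size h V (r k) (A k) (b k) (tau k) n.+1 chi x)%:E)%E)
      (balance n t) _ (funext (fun l => dxE t l l))).
  have Kw0 : 0 <= K0 * w by rewrite mulr_ge0// ltW.
  apply: le_trans (momentum_error (tau_gt0 k) T_gt0 (dens_nice k) (pres_nice k)
    (kin_nice k) (mom_nice k) (dens_ge0 k) (pres_ge0 k) (kin_ge0 k) (mom_le k) g_cont
    (fun l => sC _ (sxi l)) (sC _ sgxi) (sC _ slap)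
    (fun l t x => f0 _ t x (sxi l)) (fun l t x => f0 _ t x (sdxi l l))
    chi_c (cutoff_ge0 _) chi_le HBg Kw0 (HM k) (kin_sum k) presk bal) _.
  rewrite -/c; apply: (@le_trans _ _ (K0 * w * `|c|)); first by rewrite ler_wpM2l// ler_norm.
  rewrite mulrAC -[leRHS]mulr1 /w mulrCA; apply: ler_wpM2l; first exact: ltW.
  by rewrite ler_pdivrMr// mul1r lerDl.
have Lim : \sum_l Lm l + Ld - Lp = 0.
  have cv : \sum_l Jm k l + Jd k - Jp k @[k --> \oo] --> \sum_l Lm l + Ld - Lp.
    apply: cvgB => //; apply: cvgD => //.
    by apply: cvg_big => //; exact: add_continuous.
  apply/eqP; rewrite -normr_le0; apply/ler_addgt0Pl => e e0; rewrite addr0.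
  apply: cvgr_to_le (cvg_norm cv) _; exact: small.
pose Ldt := \int[(@lebesgue_measure R \x lebesgue_rV R d)%E]_z (crho z * dt phi z).
have idt := integrable_cut_mul icrho (sC _ sdt).
have imom l := integrable_cut_mul (icmom l) (sC _ (sxi l)).
have irho := integrable_cut_mul icrho (sC _ sgxi).
have ip := integrable_cut_mul icp (sC _ slap).
have cut (F : measurableTypeR R * 'rV[R]_d -> R) (f : R * 'rV[R]_d -> R) z :
    supported C f -> (F \_ (slab `]0, T[)) z * f z = F z * f z.
  move=> [_ H]; rewrite patchE; case: ifPn => // /negP; rewrite inE => nz.
  by rewrite H ?mulr0// => /CU.
have out (f : R * 'rV[R]_d -> R) (D : set (R * 'rV[R]_d)) z :
    supported C f -> C `<=` D -> ~ D z -> f z = 0.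
  by move=> [_ H] CD nD; apply: H => /CD.
(* [phi] is also a test function on the unbounded slab, where the continuity equation is posed. *)
have Cont : Ldt + \sum_l Lm l = 0.
  have posC : C `<=` slab `]0, +oo[.
    move=> [t x] /CU[/= + _]; rewrite in_itv /= => /andP[t0 _]; split => //=.
    by rewrite in_itv /= t0.
  have tphi : test_function (slab `]0, +oo[) phi by split => //; exists C.
  have isum := integrable_fun_sum imom.
  rewrite /Ldt /Lm -Rintegral_sum// -RintegralD//; apply: EFin_inj.
  rewrite -[RHS](star_continuity _ tphi); apply/esym; apply: integral_eq_supported.
  - exact: integrableD idt isum.
  - move=> z _; rewrite (cut _ _ _ sdt); congr (_ + _).
    rewrite /dotv mulr_sumr; apply: eq_bigr => l _.
    by rewrite (cut _ _ _ (sxi l)) mulrA [rho_star _ _ * _]mulrC; congr (_ * _); rewrite mxE.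
  - move=> z nz; rewrite (out _ _ _ sdt posC nz) mulr0 add0r big1// => l _.
    by rewrite (out _ _ _ (sxi l) posC nz) mulr0.
have TC : C `<=` slab `]0, T[ by exact: CU.
have sgrad z : dotv (grad V z.2) (gradx phi z) = \sum_l g l z.2 * xi l z.
  by apply: eq_bigr => l _; congr (_ * _); rewrite mxE.
have E1 : (lebesgue_measure \x lebesgue_rV R d)%E.-integrable setT
    (EFin \o (fun z => crho z * dt phi z + cp z * (\sum_l dxi l z))).
  exact: integrableD idt ip.
have E2 : (lebesgue_measure \x lebesgue_rV R d)%E.-integrable setT
    (EFin \o (fun z => crho z * dt phi z + cp z * (\sum_l dxi l z) -
                        crho z * (\sum_l g l z.2 * xi l z))).
  exact: integrableB E1 irho.
apply: etrans (integral_eq_supported (D := slab `]0, T[) E2 _ _) _.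
- move=> z zT; rewrite (cut _ _ _ sdt) (cut _ _ _ sgxi) /cp patchE mem_set.
    by rewrite sgrad.
  exact: subT.
- move=> z nz; rewrite (out _ _ _ sdt TC nz) (out _ _ _ slap TC nz) (out _ _ _ sgxi TC nz).
  by rewrite !mulr0 subr0 addr0.
rewrite RintegralB// RintegralD// -/Ldt -/Lp -/Ld; congr EFin.
(* The limit momentum occurs in both identities and cancels. *)
by move: Cont Lim; lra.
Unshelve. all: end_near.
Qed.
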